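(* Let $1<p\le 2$ and $\theta\in\mathbb{R}$. Then the semigroup $$e^{-t(\Delta_p-\theta)}: L^p(\mu)\to L^p(\mu),\qquad t\ge 0,$$ does not have nonzero periodic points, i.e. if $f\in L^p(\mu)$ and $e^{-t(\Delta_p-\theta)}f=f$ for some $t>0$, then $f=0$. Moreover, when $1<p<2$, the semigroup is not hypercyclic.
   Context: Fix real numbers $\alpha\ge\beta\ge-\frac12$ with $\alpha>-\frac12$, and set $\rho=\alpha+\beta+1$. For $x>0$ let $A(x)=(2\sinh x)^{2\alpha+1}(2\cosh x)^{2\beta+1}$, and let $\mu$ be the measure on $\mathbb{R}^+=(0,\infty)$ with density $A$ with respect to Lebesgue measure; $L^p(\mu)$ is the corresponding (complex) Lebesgue space. The Jacobi operator is $\Delta=-\left(\frac{d}{dx}\right)^2-\frac{A'(x)}{A(x)}\frac{d}{dx}$. For $\lambda\in\mathbb{C}$ the Jacobi function $\varphi_\lambda$ is the unique even smooth function on $\mathbb{R}$ with $\varphi_\lambda(0)=1$ and $\Delta\varphi_\lambda=(\lambda^2+\rho^2)\varphi_\lambda$ for $x>0$. The Jacobi transform of $f$ is $\hat f(\lambda)=\int_{\mathbb{R}^+}f(x)\varphi_\lambda(x)\,d\mu(x)$, whenever defined. Let $\mathcal{D}^\sharp(\mathbb{R}^+)$ be the space of restrictions to $\mathbb{R}^+$ of even smooth compactly supported functions on $\mathbb{R}$. For $1\le p<\infty$, $\Delta_p$ denotes the closure in $L^p(\mu)$ of the operator $\Delta$ with domain $\mathcal{D}^\sharp(\mathbb{R}^+)$.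 Convolution: for each $x,y>0$, $W(x,y,\cdot)$ is the nonnegative kernel, supported in $|x-y|\le u\le x+y$ and symmetric in its three variables, such that $\varphi_\lambda(x)\varphi_\lambda(y)=\int_0^\infty\varphi_\lambda(u)W(x,y,u)\,d\mu(u)$ for all $\lambda\in\mathbb{C}$. Set $\tau_xf(y)=\int_0^\infty f(u)W(x,y,u)\,d\mu(u)$ and $f\star g(x)=\int_0^\infty\tau_xf(y)\,g(y)\,d\mu(y)$. The heat kernel $h_t$, $t>0$, is the nonnegative function on $\mathbb{R}^+$, belonging to $L^p(\mu)$ for all $p\ge1$, with $\widehat{h_t}(\lambda)=e^{-t(\lambda^2+\rho^2)}$ for all $\lambda\in\mathbb{C}$. The family $e^{-t\Delta_p}f=h_t\star f$, $f\in L^p(\mu)$, $t>0$ (identity at $t=0$), is a strongly continuous semigroup on $L^p(\mu)$, and for $\theta\in\mathbb{R}$ the shifted semigroup is $e^{-t(\Delta_p-\theta)}f=e^{\theta t}\,h_t\star f$. A strongly continuous semigroup $\{T(t):t\ge0\}$ on a Banach space $\mathcal{X}$ is hypercyclic if there exists $f\in\mathcal{X}$ such that $\{T(t)f:t\ge0\}$ is dense in $\mathcal{X}$. *)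

(* Defs.v *)
From HB Require Import structures.
From mathcomp Require Import all_boot all_order all_algebra.
From mathcomp Require Import all_classical all_reals all_analysis.
From mathcomp Require Import measurable_realfun.
From mathcomp Require Import complex.

Set Implicit Arguments.
Unset Strict Implicit.
Unset Printing Implicit Defensive.

Import Order.TTheory GRing.Theory Num.Theory.
Import numFieldNormedType.Exports.

Local Open Scope classical_set_scope.
Local Open Scope ring_scope.
Local Open Scope complex_scope.

(* A function on R^+ is represented by a total function on R whose values
   outside ]0, +oo[ are ignored.  Complex-valued functions have values in R[i];
   measurability, derivatives and integrals are taken componentwise. *)

Definition Rpos (R : realType) : set R := `]0, +oo[.

Definition sinh (R : realType) (x : R) : R := (expR x - expR (- x)) / 2.

Definition cosh (R : realType) (x : R) : R := (expR x + expR (- x)) / 2.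

Definition cexp (R : realType) (z : R[i]) : R[i] :=
  (expR (complex.Re z))%:C * (cos (complex.Im z) +i* sin (complex.Im z)).

Definition jacobi_rho (R : realType) (alpha beta : R) : R := alpha + beta + 1.

Definition jacobi_weight (R : realType) (alpha beta x : R) : R :=
  (2 * sinh x) `^ (2 * alpha + 1) * (2 * cosh x) `^ (2 * beta + 1).

(* As a measure on R, it is concentrated on ]0, +oo[. *)
Definition jacobi_measure (R : realType) (alpha beta : R)
    (B : set (measurableTypeR R)) : \bar R :=
  (\int[@lebesgue_measure R]_(x in B `&` @Rpos R)
     (jacobi_weight alpha beta x)%:E)%E.

Lemma jacobi_weight_ge0 (R : realType) (alpha beta x : R) :
  0 <= jacobi_weight alpha beta x.
Proof. by rewrite mulr_ge0 ?powR_ge0. Qed.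

Lemma measurable_jacobi_weight (R : realType) (alpha beta : R) :
  measurable_fun [set: measurableTypeR R] (@jacobi_weight R alpha beta).
Proof.
have mE : measurable_fun [set: measurableTypeR R] (@expR R).
  exact: measurable_expR.
have mN : measurable_fun [set: measurableTypeR R] (fun x : R => expR (- x)).
  exact: (measurableT_comp mE).
apply: measurable_funM; apply: measurableT_comp (measurable_powR _) _.
  apply: measurable_funM => //; apply: measurable_funM => //.
  exact: measurable_funB.
apply: measurable_funM => //; apply: measurable_funM => //.
exact: measurable_funD.
Qed.

Lemma jacobi_measure0 (R : realType) (alpha beta : R) :
  jacobi_measure alpha beta set0 = 0%E.
Proof. by rewrite /jacobi_measure set0I integral_set0. Qed.

Lemma jacobi_measure_ge0 (R : realType) (alpha beta : R) B :
  (0 <= jacobi_measure alpha beta B)%E.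
Proof. by apply: integral_ge0 => x _; rewrite lee_fin jacobi_weight_ge0. Qed.

Lemma jacobi_measure_sigma_additive (R : realType) (alpha beta : R) :
  semi_sigma_additive (@jacobi_measure R alpha beta).
Proof.
move=> /= F mF tF mUF.
have mP : measurable (@Rpos R : set (measurableTypeR R)).
  exact: measurable_itv.
rewrite /jacobi_measure setI_bigcupl ge0_integral_bigcup//=; last 4 first.
- by move=> k; exact: measurableI.
- apply/measurable_EFinP; apply: measurable_funTS.
  exact: measurable_jacobi_weight.
- by move=> x _; rewrite lee_fin jacobi_weight_ge0.
- exact: trivIset_setIr.
apply: is_cvg_ereal_nneg_natsum_cond => n _ _.
exact: jacobi_measure_ge0.
Qed.

HB.instance Definition _ (R : realType) (alpha beta : R) :=
  isMeasure.Build _ _ _ (@jacobi_measure R alpha beta)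
    (@jacobi_measure0 R alpha beta) (@jacobi_measure_ge0 R alpha beta)
    (@jacobi_measure_sigma_additive R alpha beta).

Definition cmeasurable (R : realType) (f : R -> R[i]) : Prop :=
  measurable_fun (@Rpos R : set (measurableTypeR R)) (@complex.Re R \o f) /\
  measurable_fun (@Rpos R : set (measurableTypeR R)) (@complex.Im R \o f).

Definition cintegrable (R : realType)
    (mu : {measure set (measurableTypeR R) -> \bar R}) (f : R -> R[i]) : Prop :=
  mu.-integrable (@Rpos R) (EFin \o @complex.Re R \o f) /\
  mu.-integrable (@Rpos R) (EFin \o @complex.Im R \o f).

Definition cintegral (R : realType)
    (mu : {measure set (measurableTypeR R) -> \bar R}) (f : R -> R[i]) : R[i] :=
  Rintegral mu (@Rpos R) (@complex.Re R \o f) +i*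
  Rintegral mu (@Rpos R) (@complex.Im R \o f).

Definition Lp_norm (R : realType)
    (mu : {measure set (measurableTypeR R) -> \bar R})
    (p : R) (f : R -> R[i]) : \bar R :=
  Lnorm mu p%:E ((fun x => (Normc.normc (f x))%:E) \_ (@Rpos R)).

Definition in_Lp (R : realType)
    (mu : {measure set (measurableTypeR R) -> \bar R})
    (p : R) (f : R -> R[i]) : Prop :=
  cmeasurable f /\ (Lp_norm mu p f < +oo)%E.

(* Equality of the classes of f and g in L^p(mu). *)
Definition Lp_eq (R : realType)
    (mu : {measure set (measurableTypeR R) -> \bar R})
    (f g : R -> R[i]) : Prop :=
  {ae mu, forall x, Rpos x -> f x = g x}.

Definition cderive (R : realType) (f : R -> R[i]) (x : R) : R[i] :=
  (@complex.Re R \o f : R -> R)^`()%classic x +i*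
  (@complex.Im R \o f : R -> R)^`()%classic x.

Definition csmooth (R : realType) (f : R -> R[i]) : Prop :=
  forall (n : nat) (x : R),
    derivable (derive1n n (@complex.Re R \o f : R -> R)) x 1 /\
    derivable (derive1n n (@complex.Im R \o f : R -> R)) x 1.

Definition jacobi_operator (R : realType) (alpha beta : R)
    (f : R -> R[i]) (x : R) : R[i] :=
  - cderive (cderive f) x
  - ((jacobi_weight alpha beta : R -> R)^`()%classic x
      / jacobi_weight alpha beta x)%:C * cderive f x.

(* phi lambda x is the Jacobi function of parameter lambda at x.  This
   predicate determines phi; the kernel W and the heat kernel h are likewise
   given by their defining properties below, which determine them up to
   mu-null sets. *)
Record is_jacobi_function (R : realType) (alpha beta : R)
    (phi : R[i] -> R -> R[i]) : Prop := IsJacobiFunction {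
  jacobi_even : forall lambda x, phi lambda (- x) = phi lambda x ;
  jacobi_smooth : forall lambda, csmooth (phi lambda) ;
  jacobi_at0 : forall lambda, phi lambda 0 = 1 ;
  jacobi_eigen : forall lambda x, 0 < x ->
    jacobi_operator alpha beta (phi lambda) x =
    (lambda ^+ 2 + (jacobi_rho alpha beta ^+ 2)%:C) * phi lambda x
}.

Definition jacobi_transform (R : realType) (alpha beta : R)
    (phi : R[i] -> R -> R[i]) (f : R -> R[i]) (lambda : R[i]) : R[i] :=
  cintegral (jacobi_measure alpha beta) (fun x => f x * phi lambda x).

(* Conditions are imposed at positive arguments only.  Since W x y u may be
   unbounded, the integrability of the integrand and the joint measurability
   of W are stated explicitly. *)
Record is_convolution_kernel (R : realType) (alpha beta : R)
    (phi : R[i] -> R -> R[i]) (W : R -> R -> R -> R) : Prop :=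
  IsConvolutionKernel {
  kernel_measurable :
    measurable_fun
      ((@Rpos R `*` @Rpos R `*` @Rpos R) :
        set (measurableTypeR R * measurableTypeR R * measurableTypeR R))
      (fun z => W z.1.1 z.1.2 z.2) ;
  kernel_ge0 : forall x y u, 0 < x -> 0 < y -> 0 < u -> 0 <= W x y u ;
  kernel_support : forall x y u, 0 < x -> 0 < y -> 0 < u ->
    ~ (`|x - y| <= u <= x + y) -> W x y u = 0 ;
  kernel_sym12 : forall x y u, 0 < x -> 0 < y -> 0 < u -> W x y u = W y x u ;
  kernel_sym23 : forall x y u, 0 < x -> 0 < y -> 0 < u -> W x y u = W x u y ;
  kernel_integrable : forall lambda x y, 0 < x -> 0 < y ->
    cintegrable (jacobi_measure alpha beta)
      (fun u => phi lambda u * (W x y u)%:C) ;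
  kernel_product : forall lambda x y, 0 < x -> 0 < y ->
    phi lambda x * phi lambda y =
    cintegral (jacobi_measure alpha beta)
      (fun u => phi lambda u * (W x y u)%:C)
}.

Definition translation (R : realType) (alpha beta : R) (W : R -> R -> R -> R)
    (x : R) (f : R -> R[i]) (y : R) : R[i] :=
  cintegral (jacobi_measure alpha beta) (fun u => f u * (W x y u)%:C).

Definition convolution (R : realType) (alpha beta : R) (W : R -> R -> R -> R)
    (f g : R -> R[i]) (x : R) : R[i] :=
  cintegral (jacobi_measure alpha beta)
    (fun y => translation alpha beta W x f y * g y).

Record is_heat_kernel (R : realType) (alpha beta : R)
    (phi : R[i] -> R -> R[i]) (h : R -> R -> R) : Prop := IsHeatKernel {
  heat_ge0 : forall t x, 0 < t -> 0 < x -> 0 <= h t x ;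
  heat_Lp : forall t p, 0 < t -> 1 <= p ->
    in_Lp (jacobi_measure alpha beta) p (fun x => (h t x)%:C) ;
  heat_integrable : forall t lambda, 0 < t ->
    cintegrable (jacobi_measure alpha beta)
      (fun x => (h t x)%:C * phi lambda x) ;
  heat_transform : forall t lambda, 0 < t ->
    jacobi_transform alpha beta phi (fun x => (h t x)%:C) lambda =
    cexp (- t%:C * (lambda ^+ 2 + (jacobi_rho alpha beta ^+ 2)%:C))
}.

(* The operator e^{-t (Delta_p - theta)} acting on functions, for t >= 0;
   the formula does not depend on p. *)
Definition shifted_semigroup (R : realType) (alpha beta : R)
    (W : R -> R -> R -> R) (h : R -> R -> R) (theta t : R)
    (f : R -> R[i]) : R -> R[i] :=
  if t == 0 then f
  else fun x => (expR (theta * t))%:C *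
         convolution alpha beta W (fun y => (h t y)%:C) f x.

Definition Lp_hypercyclic (R : realType)
    (mu : {measure set (measurableTypeR R) -> \bar R}) (p : R)
    (T : R -> (R -> R[i]) -> (R -> R[i])) : Prop :=
  exists f : R -> R[i], in_Lp mu p f /\
    forall g : R -> R[i], in_Lp mu p g -> forall eps : R, 0 < eps ->
      exists t : R, 0 <= t /\
        (Lp_norm mu p (fun x => T t f x - g x)%R < eps%:E)%E.

(* Main.v *)
Require Import Defs.
From HB Require Import structures.
From mathcomp Require Import all_boot all_order all_algebra.
From mathcomp Require Import all_classical all_reals all_analysis.
From mathcomp Require Import measurable_realfun complex.
From mathcomp Require Import ring lra.

Set Implicit Arguments.
Unset Strict Implicit.
Unset Printing Implicit Defensive.

Import Order.TTheory GRing.Theory Num.Theory.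
Import numFieldNormedType.Exports.

Local Open Scope classical_set_scope.
Local Open Scope ring_scope.

(** Why the theorem is true.

    Everything takes place at real spectral values. For a real L <= rho^2 the
    Jacobi function with lambda^2 + rho^2 = L is a real function E_L; for
    L = - z <= 0 it is a function e_z >= 1 that grows exponentially (jexp). The
    heat kernel and the translation kernels W act on these functions by scalars,
    and e_z - 1 = z I e_z, where I is the transpose of the Green operator J built
    from a primitive b of 1 / A. Hence J inverts the Jacobi operator on functions
    that decay faster than every exponential and have mean zero.

    Injectivity. If the integrals of nu against all the e_z vanish, then so do
    those of every J^n nu, and the pairings of nu with J^n nu are log-convex in n.
    They decrease faster than every geometric sequence, so that J nu = 0
    (null_transform_green0); up to a constant J nu is I nu,
    and differentiating I nu twice gives nu = 0
    (null_transform_eq0). This replaces the inversion formula: two functions with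
    the same transform at all the e_z coincide (tame_eq_transform), which yields
    the semigroup law and the Taylor formula of the heat semigroup (heat_taylor).

    Periodic points. Let e^(theta t) S_t f = f, with S_t the heat semigroup. The
    Young inequality makes f bounded, hence square integrable since p <= 2. On L^2
    the operators S_s are symmetric and positive, so that f is an eigenfunction of
    S_t/2, S_t/4 and so on, with the positive square roots of the eigenvalue
    (heat_eigen_halve). Letting s = t / 2^n tend to 0 in the Taylor formula gives
    the eigenvalue equation of the generator in weak form (heat_eigen_weak), and
    projections turn it into f = C - theta I f (heat_eigen_green): f is almost
    everywhere the solution F of F'' + (A'/A) F' + theta F = 0 that is regular
    at 0 with F(0) = C. Such an F is not square integrable unless it vanishes
    (regular_solution_square_eq0): if theta <= rho^2 then |F| >= |C| e^(-rho x),
    by comparison, while A grows like e^(2 rho x); if theta > rho^2 then F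
    oscillates with amplitude A^(-1/2), by an energy estimate.

    Orbits are not dense. When p < 2 the conjugate exponent q exceeds 2, and the
    ground state phi_0 = E_(rho^2), which decays like e^(-kappa x) for every
    kappa < rho, belongs to L^q. The pairing l with phi_0 is thus a continuous
    linear functional on L^p, and l(T_t f) = e^((theta - rho^2) t) l(f). The
    modulus of the right-hand side is monotone in t, whereas on a dense orbit l
    would take values arbitrarily close to every real number. *)

(** * Calculus on the half-line *)

Section PointwiseDerivatives.
Context {R : realType}.
Implicit Types (f g : R -> R) (x df dg : R).

Lemma is_derive_add f g x df dg : is_derive x 1 f df -> is_derive x 1 g dg ->
  is_derive x 1 (fun y => f y + g y) (df + dg).
Proof. by move=> hf hg; exact: is_deriveD. Qed.

Lemma is_derive_opp f x df : is_derive x 1 f df ->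
  is_derive x 1 (fun y => - f y) (- df).
Proof. by move=> hf; exact: is_deriveN. Qed.

Lemma is_derive_sub f g x df dg : is_derive x 1 f df -> is_derive x 1 g dg ->
  is_derive x 1 (fun y => f y - g y) (df - dg).
Proof. by move=> hf hg; exact: is_deriveB. Qed.

Lemma is_derive_mul f g x df dg : is_derive x 1 f df -> is_derive x 1 g dg ->
  is_derive x 1 (fun y => f y * g y) (df * g x + f x * dg).
Proof.
move=> hf hg; have h := is_deriveM hf hg; apply: is_derive_eq.
by rewrite /GRing.scale /= addrC mulrC [in RHS]addrC addrC.
Qed.

Lemma is_derive_scale c f x df : is_derive x 1 f df ->
  is_derive x 1 (fun y => c * f y) (c * df).
Proof. by move=> hf; exact: is_deriveZ. Qed.

Lemma is_derive_exp_lin c x :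
  is_derive x 1 (fun y : R => expR (c * y)) (c * expR (c * x)).
Proof.
have h : is_derive x 1 (fun y : R => c * y) (c * 1).
  by apply: is_derive_scale.
have := @is_derive1_comp R expR (fun y => c * y) x _ _ (is_derive_expR _) h.
by rewrite mulr1 mulrC.
Qed.

Lemma is_derive_div f g x df dg : is_derive x 1 f df -> is_derive x 1 g dg ->
  g x != 0 ->
  is_derive x 1 (fun y => f y / g y) ((df - f x / g x * dg) / g x).
Proof.
move=> hf hg g0; have hV := is_deriveV g0 hg.
have := is_derive_mul hf hV; move/is_derive_eq; apply.
rewrite /GRing.scale /= expr2; field.
exact: g0.
Qed.

Lemma is_derive_continuous f x df : is_derive x 1 f df ->
  {for x, continuous f}.
Proof. by move=> h; apply: differentiable_continuous; apply/derivable1_diffP. Qed.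

Lemma is_derive_unique f x df dg : is_derive x 1 f df -> is_derive x 1 f dg ->
  df = dg.
Proof. by move=> [_ <-] [_ <-]. Qed.

End PointwiseDerivatives.

Section HalfLine.
Context {R : realType}.
Implicit Types (f g df : R -> R) (a b l x y : R).

Lemma is_derive_ge0_le f df a b : a <= b ->
  (forall x, a <= x <= b -> is_derive x 1 f (df x)) ->
  (forall x, a <= x <= b -> 0 <= df x) -> f a <= f b.
Proof.
rewrite le_eqVlt => /predU1P[-> //|ab] fdf df0.
have cf : {within `[a, b], continuous f}.
  apply: continuous_in_subspaceT => x; rewrite inE /= in_itv /= => xab.
  exact: is_derive_continuous (fdf x xab).
have fdf' x : x \in `]a, b[%R -> is_derive x 1 f (df x).
  by rewrite in_itv /= => /andP[ax xb]; apply: fdf; rewrite !ltW.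
have [c + fE] := MVT ab fdf' cf.
rewrite in_itv /= => /andP[ac cb]; rewrite -subr_ge0 fE.
by rewrite mulr_ge0 ?subr_ge0 ?(ltW ab)// df0// !ltW.
Qed.

Lemma is_derive_le0_ge f df a b : a <= b ->
  (forall x, a <= x <= b -> is_derive x 1 f (df x)) ->
  (forall x, a <= x <= b -> df x <= 0) -> f b <= f a.
Proof.
move=> ab fdf df0; rewrite -lerN2.
apply: (@is_derive_ge0_le (fun x => - f x) (fun x => - df x)) => // x xab.
  exact/is_derive_opp/fdf.
by rewrite oppr_ge0 df0.
Qed.

Lemma right_lim_le f l b x : f y @[y --> 0^'+] --> l -> 0 < b ->
  (forall y, 0 < y -> y < b -> f y <= x) -> l <= x.
Proof.
move=> fl b0 fx; apply: (cvgr_to_le fl).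
near=> y; apply: fx.
- by near: y; exact: nbhs_right_gt.
- by near: y; exact: nbhs_right_lt.
Unshelve. all: by end_near. Qed.

Lemma right_lim_ge f l b x : f y @[y --> 0^'+] --> l -> 0 < b ->
  (forall y, 0 < y -> y < b -> x <= f y) -> x <= l.
Proof.
move=> fl b0 fx; apply: (cvgr_to_ge fl).
near=> y; apply: fx.
- by near: y; exact: nbhs_right_gt.
- by near: y; exact: nbhs_right_lt.
Unshelve. all: by end_near. Qed.

Lemma is_derive_ge0_right_lim f df l b : 0 < b -> f y @[y --> 0^'+] --> l ->
  (forall x, 0 < x -> is_derive x 1 f (df x)) ->
  (forall x, 0 < x -> x <= b -> 0 <= df x) -> l <= f b.
Proof.
move=> b0 fl fdf df0; apply: (right_lim_le fl b0) => y y0 yb.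
apply: (@is_derive_ge0_le f df) => [|x /andP[yx xb]|x /andP[yx xb]].
- exact: ltW.
- by apply: fdf; exact: lt_le_trans yx.
- by apply: df0 => //; exact: lt_le_trans yx.
Qed.

Lemma is_derive_le0_right_lim f df l b : 0 < b -> f y @[y --> 0^'+] --> l ->
  (forall x, 0 < x -> is_derive x 1 f (df x)) ->
  (forall x, 0 < x -> x <= b -> df x <= 0) -> f b <= l.
Proof.
move=> b0 fl fdf df0; apply: (right_lim_ge fl b0) => y y0 yb.
apply: (@is_derive_le0_ge f df) => [|x /andP[yx xb]|x /andP[yx xb]].
- exact: ltW.
- by apply: fdf; exact: lt_le_trans yx.
- by apply: df0 => //; exact: lt_le_trans yx.
Qed.

(** Connectedness of the half-line, in the form of an induction principle. *)
Lemma half_line_ind (P : R -> Prop) :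
  (exists2 d, 0 < d & forall x, 0 < x -> x < d -> P x) ->
  (forall s, 0 < s -> (forall x, 0 < x -> x < s -> P x) ->
     exists2 d, s < d & forall x, 0 < x -> x < d -> P x) ->
  forall x, 0 < x -> P x.
Proof.
move=> [d0 d0_gt0 Pd0] Pstep x x0; apply: contrapT => nPx.
pose S := [set s | 0 < s /\ forall y, 0 < y -> y < s -> P y].
have Sd0 : S d0 by [].
have ubS : ubound S x.
  by move=> s [s0 Ps]; rewrite leNgt; apply/negP => xs; exact/nPx/Ps.
have supS : has_sup S by split; [exists d0|exists x].
have s0 : 0 < sup S.
  by apply: lt_le_trans d0_gt0 _; apply: ub_le_sup => //; case: supS.
have Psup y : 0 < y -> y < sup S -> P y.
  move=> y0 ys; have e0 : 0 < sup S - y by rewrite subr_gt0.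
  have [t [t0 Pt]] := sup_adherent e0 supS.
  by rewrite subKr => /Pt; apply.
have [d sd Pd] := Pstep _ s0 Psup.
have : d <= sup S.
  apply: ub_le_sup; first by case: supS.
  by split => //; exact: lt_trans sd.
by rewrite leNgt sd.
Qed.

End HalfLine.

(** * Regular solutions of Sturm-Liouville equations on the half-line *)

Section RealODE.
Context {R : realType}.
Implicit Types x z t s l c d L : R.

Lemma near_right_gt0 (f : R -> R) l : f y @[y --> 0^'+] --> l -> 0 < l ->
  exists2 d, 0 < d & forall x, 0 < x -> x < d -> 0 < f x.
Proof.
move=> fl l0; have [e /= e0 he] := cvgr_gt _ fl _ l0.
exists e => // x x0 xe; apply: he => //=.
by rewrite sub0r normrN gtr0_norm.
Qed.

Lemma continuous_near_gt0 (f : R -> R) x : {for x, continuous f} -> 0 < f x ->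
  exists2 d, 0 < d & forall y, `|x - y| < d -> 0 < f y.
Proof.
move=> fx fx0; have [e /= e0 he] := cvgr_gt _ fx _ fx0.
by exists e => // y xy; apply: he.
Qed.

Lemma continuous_left_ge0 (f : R -> R) s : {for s, continuous f} -> 0 < s ->
  (forall t, 0 < t -> t < s -> 0 < f t) -> 0 <= f s.
Proof.
move=> fs s0 f0; rewrite leNgt; apply/negP => fs0.
have cN : {for s, continuous (fun x => - f x)} by exact: continuousN.
have [|d d0 hd] := continuous_near_gt0 cN; first by rewrite oppr_gt0.
pose t := Num.max (s / 2) (s - d / 2).
have [t0 ts] : 0 < t /\ t < s.
  by rewrite /t lt_max gt_max; split; [apply/orP; left|apply/andP; split]; lra.
have /hd : `|s - t| < d.
  rewrite gtr0_norm ?subr_gt0// ltrBlDr -ltrBlDl /t lt_max.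
  by apply/orP; right; lra.
by rewrite oppr_gt0 ltNge (ltW (f0 t t0 ts)).
Qed.

(** The features of A = exp(int a) on which the spectral analysis of
    f |-> - f'' - a f' rests; rho^2 turns out to be the bottom of its
    spectrum. *)
Record sturm_weight (rho : R) (A a : R -> R) : Prop := SturmWeight {
  weight_rho_gt0 : 0 < rho ;
  weight_gt0 : forall x : R, 0 < x -> 0 < A x ;
  weight_derive : forall x : R, 0 < x -> is_derive x 1 A (a x * A x) ;
  weight_log_ge : forall x : R, 0 < x -> 2 * rho <= a x ;
  weight_log_le : forall x0 : R, 0 < x0 -> exists2 K, 0 <= K &
    forall x, x0 <= x -> a x <= 2 * rho + K * expR (- 2 * x) ;
  weight_lim0 : A x @[x --> 0^'+] --> 0 }.

(** y is the solution of y'' + a y' + L y = 0 that is regular at 0, with value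
    c there; p is its derivative. *)
Record regular_solution (a : R -> R) (L c : R) (y p : R -> R) : Prop :=
  RegularSolution {
  solution_derive : forall x : R, 0 < x -> is_derive x 1 y (p x) ;
  solution_derive2 : forall x : R, 0 < x ->
    is_derive x 1 p (- a x * p x - L * y x) ;
  solution_lim0 : y x @[x --> 0^'+] --> c ;
  solution_derive_lim0 : p x @[x --> 0^'+] --> 0 }.

Variables (rho : R) (A a : R -> R).
Hypothesis wA : sturm_weight rho A a.

Lemma weight_a_ge0 x : 0 < x -> 0 <= a x.
Proof.
move=> x0; apply: le_trans (weight_log_ge wA x0).
by rewrite mulr_ge0 ?(ltW (weight_rho_gt0 wA)).
Qed.

Lemma weight_nondecreasing x y : 0 < x -> x <= y -> A x <= A y.
Proof.
move=> x0 xy; apply: (@is_derive_ge0_le _ A (fun x => a x * A x)) => //.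
  by move=> z /andP[xz _]; apply: (weight_derive wA); exact: lt_le_trans xz.
move=> z /andP[xz _]; have z0 := lt_le_trans x0 xz.
by rewrite mulr_ge0 ?weight_a_ge0 ?(ltW (weight_gt0 wA z0)).
Qed.

Lemma weight_exp_growth x y : 0 < x -> x <= y ->
  A x * expR (2 * rho * (y - x)) <= A y.
Proof.
move=> x0 xy.
have : A x * expR (- (2 * rho) * x) <= A y * expR (- (2 * rho) * y).
  apply: (@is_derive_ge0_le _ (fun z => A z * expR (- (2 * rho) * z))
    (fun z => a z * A z * expR (- (2 * rho) * z) +
              A z * (- (2 * rho) * expR (- (2 * rho) * z)))) => // z /andP[xz _].
    apply: is_derive_mul; last exact: is_derive_exp_lin.
    by apply: (weight_derive wA); exact: lt_le_trans xz.
  have z0 := lt_le_trans x0 xz.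
  rewrite [X in 0 <= X](_ : _ = (a z - 2 * rho) * (A z * expR (- (2 * rho) * z))).
    by rewrite mulr_ge0 ?subr_ge0 ?(weight_log_ge wA)// mulr_ge0 ?expR_ge0//
      ltW// (weight_gt0 wA).
  by ring.
move=> h; have := ler_wpM2r (expR_ge0 (2 * rho * y)) h.
rewrite -!mulrA -!expRD [X in _ <= _ * expR X -> _](_ : _ = 0) ?expR0 ?mulr1.
  by congr (_ * expR _ <= _); ring.
by ring.
Qed.

(** The quotient y / w increases, because the Wronskian A (y' w - y w')
    vanishes at 0 and increases as long as y is nonnegative. *)
Lemma solution_comparison L c y p (w dw ddw : R -> R) l d :
  regular_solution a L c y p -> 0 < l <= c ->
  (forall x, 0 < x -> 0 < w x) ->
  (forall x, 0 < x -> is_derive x 1 w (dw x)) ->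
  (forall x, 0 < x -> is_derive x 1 dw (ddw x)) ->
  w x @[x --> 0^'+] --> l -> dw x @[x --> 0^'+] --> d ->
  (forall x, 0 < x -> ddw x + a x * dw x + L * w x <= 0) ->
  forall x, 0 < x -> w x <= y x.
Proof.
move=> sy /andP[l0 lc] w0 dw1 dw2 wl dwl sup.
have cy x : 0 < x -> {for x, continuous y}.
  by move=> x0; exact: is_derive_continuous (solution_derive sy x0).
have key s : 0 < s -> (forall t, 0 < t -> t < s -> 0 < y t) -> w s <= y s.
  move=> s0 ys; have {}ys t : 0 < t -> t <= s -> 0 <= y t.
    move=> t0; rewrite le_eqVlt => /predU1P[->|/(ys _ t0)/ltW//].
    exact: continuous_left_ge0 (cy s s0) s0 ys.
  pose W x := A x * (p x * w x - y x * dw x).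
  have W0 x : 0 < x -> x <= s -> 0 <= W x.
    move=> x0 xs.
    apply: (@is_derive_ge0_right_lim _ W
      (fun x => a x * A x * (p x * w x - y x * dw x) + A x *
       (((- a x * p x - L * y x) * w x + p x * dw x) -
        (p x * dw x + y x * ddw x)))) => //.
    - rewrite /W [X in _ --> X](_ : 0 = 0 * (0 * l - c * d)); last by ring.
      apply: cvgM; first exact: weight_lim0 wA.
      apply: cvgB; apply: cvgM => //; first exact: solution_derive_lim0 sy.
      exact: solution_lim0 sy.
    - move=> z z0; apply: is_derive_mul; first exact: weight_derive wA _ z0.
      apply: is_derive_sub; apply: is_derive_mul.
      + exact: solution_derive2 sy _ z0.
      + exact: dw1.
      + exact: solution_derive sy _ z0.
      + exact: dw2.
    - move=> z z0 zx.
      rewrite [X in 0 <= X](_ : _ =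
        A z * y z * - (ddw z + a z * dw z + L * w z)); last by ring.
      rewrite mulr_ge0 ?oppr_ge0 ?sup// mulr_ge0 ?ys ?(le_trans zx)//.
      exact/ltW/(weight_gt0 wA).
  have : c / l <= y s / w s.
    apply: (@is_derive_ge0_right_lim _ (fun x => y x / w x)
      (fun x => (p x - y x / w x * dw x) / w x)) => //.
    - apply: cvgM; first exact: solution_lim0 sy.
      by apply: cvgV => //; rewrite gt_eqF.
    - move=> x x0; apply: is_derive_div; last by rewrite gt_eqF ?w0.
        exact: solution_derive sy _ x0.
      exact: dw1.
    - move=> x x0 xs; have wx := w0 x x0.
      rewrite divr_ge0 ?(ltW wx)//.
      rewrite (_ : _ - _ = (p x * w x - y x * dw x) / w x).
        rewrite divr_ge0 ?(ltW wx)//.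
        by have := W0 x x0 xs; rewrite /W pmulr_rge0// (weight_gt0 wA).
      by field; rewrite gt_eqF.
  move=> cl; rewrite -[w s]mul1r -ler_pdivlMr ?w0//; apply: le_trans cl.
  by rewrite ler_pdivlMr ?mul1r.
have pos : forall x, 0 < x -> 0 < y x.
  apply: half_line_ind.
    exact: near_right_gt0 (solution_lim0 sy) (lt_le_trans l0 lc).
  move=> s s0 ys; have ys0 : 0 < y s by exact: lt_le_trans (w0 s s0) (key s s0 ys).
  have [d0 d00 hd] := continuous_near_gt0 (cy s s0) ys0.
  exists (s + d0); first by rewrite ltrDl.
  move=> x x0 xs; have [/(ys x x0)//|sx] := ltP x s.
  by apply: hd; rewrite ler0_norm ?subr_le0// opprB ltrBlDl.
by move=> x x0; apply: key => // t t0 _; exact: pos.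
Qed.

(** Energy estimate: e^(-k x) (y^2 + p^2) decreases for k = |1 - L|, the term
    - a p^2 having the right sign. *)
Lemma solution_unique0 L y p : regular_solution a L 0 y p ->
  forall x, 0 < x -> y x = 0.
Proof.
move=> sy x x0; pose k := `|1 - L|.
have : (y x ^+ 2 + p x ^+ 2) * expR (- k * x) <= 0.
  apply: (@is_derive_le0_right_lim _
    (fun x => (y x ^+ 2 + p x ^+ 2) * expR (- k * x))
    (fun x => ((p x * y x + y x * p x) + ((- a x * p x - L * y x) * p x +
       p x * (- a x * p x - L * y x))) * expR (- k * x) +
       (y x ^+ 2 + p x ^+ 2) * (- k * expR (- k * x)))) => //.
  - rewrite [X in _ --> X](_ : 0 = (0 * 0 + 0 * 0) * expR (- k * 0)); last by ring.
    have sl := solution_lim0 sy; have sl' := solution_derive_lim0 sy.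
    apply: cvgM; first by apply: cvgD; apply: cvgM.
    apply: cvg_at_right_filter.
    exact: is_derive_continuous (is_derive_exp_lin _ _).
  - move=> z z0; apply: is_derive_mul; last exact: is_derive_exp_lin.
    have h1 := solution_derive sy z0; have h2 := solution_derive2 sy z0.
    by apply: is_derive_add; exact: is_derive_mul.
  - move=> z z0 _; have a0 := weight_a_ge0 z0.
    have kL : (1 - L) * (2 * (y z * p z)) <= k * (y z ^+ 2 + p z ^+ 2).
      apply: le_trans (ler_norm _) _; rewrite normrM ler_wpM2l ?normr_ge0//.
      rewrite ler_norml; apply/andP; split.
        by rewrite -subr_ge0 (_ : _ - _ = (y z + p z) ^+ 2) ?sqr_ge0//; ring.
      by rewrite -subr_ge0 (_ : _ - _ = (y z - p z) ^+ 2) ?sqr_ge0//; ring.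
    have ap : 0 <= a z * p z ^+ 2 by rewrite mulr_ge0 ?sqr_ge0.
    rewrite [X in X <= 0](_ : _ = ((1 - L) * (2 * (y z * p z))
      - k * (y z ^+ 2 + p z ^+ 2) - 2 * (a z * p z ^+ 2)) * expR (- k * z)).
      by rewrite mulr_le0_ge0 ?expR_ge0//; lra.
    by ring.
rewrite pmulr_lle0 ?expR_gt0// => h; apply/eqP; rewrite -sqrf_eq0.
by rewrite eq_le sqr_ge0 andbT (le_trans _ h)// lerDl sqr_ge0.
Qed.

End RealODE.

Section RealODEGrowth.
Context {R : realType}.
Implicit Types x z t s l c d L : R.
Variables (rho : R) (A a : R -> R).
Hypothesis wA : sturm_weight rho A a.

Lemma is_derive_exp_comp (f : R -> R) x df : is_derive x 1 f df ->
  is_derive x 1 (fun y => expR (f y)) (expR (f x) * df).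
Proof. by move=> h; exact: is_derive1_comp. Qed.

(** As a >= 2 rho and L <= rho^2, the function w = e^(-rho x) satisfies
    w'' + a w' + L w <= 0, so that the comparison lemma applies. *)
Lemma solution_lower_bound L y p : regular_solution a L 1 y p ->
  L <= rho ^+ 2 -> forall x, 0 < x -> expR (- rho * x) <= y x.
Proof.
move=> sy Lrho; have r0 := weight_rho_gt0 wA.
apply: (solution_comparison wA (dw := fun x => - rho * expR (- rho * x))
  (ddw := fun x => - rho * (- rho * expR (- rho * x))) sy
  (l := expR (- rho * 0)) (d := - rho * expR (- rho * 0))).
- by rewrite mulr0 expR0 ltr01 lexx.
- by move=> x _; exact: expR_gt0.
- by move=> x _; exact: is_derive_exp_lin.
- by move=> x _; exact/is_derive_scale/is_derive_exp_lin.
- apply: cvg_at_right_filter.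
  exact: is_derive_continuous (is_derive_exp_lin _ _).
- apply: cvg_at_right_filter.
  exact: is_derive_continuous (is_derive_scale _ (is_derive_exp_lin _ _)).
- move=> x x0; have ax := weight_log_ge wA x0.
  rewrite [X in X <= 0](_ : _ =
    - ((a x - 2 * rho) * rho + (rho ^+ 2 - L)) * expR (- rho * x)); last by ring.
  rewrite mulr_le0_ge0 ?expR_ge0// oppr_le0 addr_ge0 ?subr_ge0//.
  by rewrite mulr_ge0 ?(ltW r0)// subr_ge0.
Qed.

(** Beyond some point e^(-kappa x) is a subsolution, so that the Wronskian of
    y and e^(-kappa x) eventually decreases; hence the derivative of
    y e^(kappa x) is integrable at infinity. *)
Lemma solution_upper_bound y p kappa : regular_solution a (rho ^+ 2) 1 y p ->
  0 < kappa < rho -> exists x1 C, 1 <= x1 /\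
    forall x, x1 <= x -> y x <= C * expR (- kappa * x).
Proof.
move=> sy /andP[k0 krho].
have [K K0 hK] := weight_log_le wA (@ltr01 R).
pose eta := (rho - kappa) ^+ 2 / kappa.
have eta0 : 0 < eta by rewrite divr_gt0 ?exprn_gt0 ?subr_gt0.
pose x1 := Num.max 1 (K / eta).
have x11 : 1 <= x1 by rewrite le_max lexx.
have sub x : x1 <= x -> kappa * (a x - kappa) <= rho ^+ 2.
  move=> x1x; have x1' : 1 <= x by exact: le_trans x1x.
  have x0 : 0 < x by lra.
  have Kx : K * expR (- 2 * x) <= eta.
    have : K / eta <= x by apply: le_trans x1x; rewrite le_max lexx orbT.
    rewrite ler_pdivrMr// => Kx; rewrite mulNr expRN ler_pdivrMr ?expR_gt0//.
    apply: le_trans Kx _; rewrite mulrC ler_pM2l//.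
    have := expR_ge1Dx (2 * x); lra.
  have := hK _ x1' => ax.
  have : kappa * (a x - kappa) <= kappa * (2 * rho + eta - kappa).
    by rewrite ler_wpM2l ?(ltW k0)//; lra.
  move/le_trans; apply; rewrite mulrBr mulrDr.
  rewrite (_ : kappa * eta = (rho - kappa) ^+ 2); last first.
    by rewrite /eta; field; rewrite gt_eqF.
  by rewrite le_eqVlt; apply/orP; left; apply/eqP; ring.
pose w x := expR (- kappa * x).
have w0 x : 0 < w x by exact: expR_gt0.
pose W x := A x * (p x * w x - y x * (- kappa * w x)).
have y0 x : 0 < x -> 0 < y x.
  move=> x0; apply: lt_le_trans (solution_lower_bound sy (lexx _) x0).
  exact: expR_gt0.
have x10 : 0 < x1 by lra.
have WD x : x1 <= x -> W x <= `|W x1|.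
  move=> x1x; apply: le_trans (ler_norm _).
  apply: (@is_derive_le0_ge _ W
      (fun x => a x * A x * (p x * w x - y x * (- kappa * w x)) + A x *
       (((- a x * p x - rho ^+ 2 * y x) * w x + p x * (- kappa * w x)) -
        (p x * (- kappa * w x) + y x * (- kappa * (- kappa * w x)))))) => //.
    move=> z /andP[x1z _]; have z0 := lt_le_trans x10 x1z.
    apply: is_derive_mul; first exact: weight_derive wA _ z0.
    apply: is_derive_sub; apply: is_derive_mul.
    + exact: solution_derive2 sy _ z0.
    + exact: is_derive_exp_lin.
    + exact: solution_derive sy _ z0.
    + exact/is_derive_scale/is_derive_exp_lin.
  move=> z /andP[x1z _]; have z0 := lt_le_trans x10 x1z.
  rewrite [X in X <= 0](_ : _ =
    - (A z * y z * w z * (rho ^+ 2 - kappa * (a z - kappa)))); last by ring.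
  rewrite oppr_le0 !mulr_ge0 ?subr_ge0 ?sub// ltW// ?y0//.
  exact: weight_gt0 wA _ z0.
pose m := 2 * (rho - kappa).
have m0 : 0 < m by rewrite mulr_gt0 ?subr_gt0.
pose B := `|W x1| * (expR (2 * rho * x1) / A x1).
have B0 : 0 <= B.
  by rewrite mulr_ge0 ?normr_ge0 ?divr_ge0 ?expR_ge0 ?(ltW (weight_gt0 wA x10)).
pose F x := y x / w x + B / m * expR (- m * x).
exists x1, (F x1); split => // x x1x.
have FF : F x <= F x1.
  apply: (@is_derive_le0_ge _ F (fun x =>
    (p x - y x / w x * (- kappa * w x)) / w x +
    B / m * (- m * expR (- m * x)))) => //.
    move=> z /andP[x1z _]; have z0 := lt_le_trans x10 x1z.
    apply: is_derive_add; last exact/is_derive_scale/is_derive_exp_lin.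
    apply: is_derive_div; last by rewrite gt_eqF.
      exact: solution_derive sy _ z0.
    exact: is_derive_exp_lin.
  move=> z /andP[x1z _]; have z0 := lt_le_trans x10 x1z.
  have Az := weight_gt0 wA z0.
  have -> : (p z - y z / w z * (- kappa * w z)) / w z = W z / (A z * w z ^+ 2).
    by rewrite /W; field; rewrite !gt_eqF.
  have -> : B / m * (- m * expR (- m * z)) = - (B * expR (- m * z)).
    by field; rewrite gt_eqF.
  rewrite subr_le0; apply: (@le_trans _ _ (`|W x1| / (A z * w z ^+ 2))).
    by rewrite ler_pM2r ?WD// invr_gt0 mulr_gt0// exprn_gt0.
  rewrite /B -mulrA ler_wpM2l ?normr_ge0//.
  rewrite -div1r ler_pdivrMr; last by rewrite mulr_gt0// exprn_gt0.
  have := weight_exp_growth wA x10 x1z.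
  rewrite -(ler_pM2r (x := expR (2 * rho * x1) / A x1 * expR (- m * z) * w z ^+ 2));
    last by rewrite !mulr_gt0 ?exprn_gt0 ?invr_gt0 ?expR_gt0// (weight_gt0 wA).
  rewrite [X in X <= _](_ : _ = 1).
    by move/le_trans; apply; rewrite le_eqVlt; apply/orP; left; apply/eqP; ring.
  rewrite expr2 /w; transitivity (expR (2 * rho * (z - x1)) *
    expR (2 * rho * x1) * expR (- m * z) * expR (- kappa * z) * expR (- kappa * z)).
    by field; rewrite gt_eqF// (weight_gt0 wA).
  by rewrite -!expRD -[RHS]expR0; congr expR; rewrite /m; ring.
have : y x / w x <= F x1.
  apply: le_trans FF; rewrite /F lerDl mulr_ge0 ?expR_ge0//.
  by rewrite divr_ge0 ?(ltW m0).
by rewrite ler_pdivrMr.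
Qed.

(** Above the bottom rho^2 of the spectrum, A (y'^2 + 2 rho y y' + L y^2) is
    a positive definite energy whose logarithmic derivative is O(e^(-2x)). It is
    therefore bounded away from 0, and A y^2 cannot be integrable; Xi is its
    primitive. *)
Lemma solution_not_square_integrable L c y p (Xi : R -> R) M x0 :
  regular_solution a L c y p -> rho ^+ 2 < L -> 0 < x0 ->
  (forall x, x0 <= x -> is_derive x 1 Xi (A x * y x ^+ 2)) ->
  (forall x, x0 <= x -> Xi x <= M) -> y x0 = 0.
Proof.
move=> sy Lrho x00 dXi XiM; apply/eqP/negPn/negP => yx0.
have r0 := weight_rho_gt0 wA.
have L0 : 0 < L by apply: le_lt_trans Lrho; exact: sqr_ge0.
have [K K0 hK] := weight_log_le wA x00.
pose del := (L - rho ^+ 2) / (L + 1).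
have del0 : 0 < del by rewrite divr_gt0 ?subr_gt0// addr_gt0.
pose q x := p x ^+ 2 + 2 * rho * (y x * p x) + L * y x ^+ 2.
have qdel x : del * (p x ^+ 2 + y x ^+ 2) <= q x.
  have del1 : del < 1 by rewrite ltr_pdivrMr ?addr_gt0//; have := sqr_ge0 rho; lra.
  have dE : (1 - del) * (L - del) = rho ^+ 2 + del ^+ 2.
    rewrite (_ : (1 - del) * (L - del) = L - del * (L + 1) + del ^+ 2); last by ring.
    by rewrite {1}/del divfK ?gt_eqF ?addr_gt0//; ring.
  rewrite -subr_ge0 -(pmulr_rge0 (x := 1 - del)); last by rewrite subr_gt0.
  rewrite (_ : _ * _ = ((1 - del) * p x + rho * y x) ^+ 2 +
    ((1 - del) * (L - del) - rho ^+ 2) * y x ^+ 2); last by rewrite /q; ring.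
  by rewrite addr_ge0 ?sqr_ge0// mulr_ge0 ?sqr_ge0// dE addrAC subrr add0r sqr_ge0.
have q0 x : 0 <= q x.
  apply: le_trans (qdel x); rewrite mulr_ge0 ?(ltW del0)//.
  by rewrite addr_ge0 ?sqr_ge0.
pose C := (1 + L) / del.
have C0 : 0 <= C by rewrite divr_ge0 ?(ltW del0)//; lra.
have qC x : `|p x ^+ 2 - L * y x ^+ 2| <= C * q x.
  have : C * (del * (p x ^+ 2 + y x ^+ 2)) <= C * q x by rewrite ler_wpM2l.
  apply: le_trans; rewrite mulrA /C divfK ?gt_eqF//.
  have p2 := sqr_ge0 (p x); have y2 := sqr_ge0 (y x).
  have Lp : 0 <= L * p x ^+ 2 by rewrite mulr_ge0// ltW.
  have Ly : 0 <= L * y x ^+ 2 by rewrite mulr_ge0// ltW.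
  by rewrite ler_norml; apply/andP; split; lra.
pose Q x := A x * q x.
pose dQ x := - (A x * (a x - 2 * rho) * (p x ^+ 2 - L * y x ^+ 2)).
have QdQ x : x0 <= x -> is_derive x 1 Q (dQ x).
  move=> x0x; have xx := lt_le_trans x00 x0x.
  have hA := weight_derive wA xx.
  have h1 := solution_derive sy xx; have h2 := solution_derive2 sy xx.
  have := is_derive_mul hA (is_derive_add (is_derive_add (is_derive_mul h2 h2)
    (is_derive_scale (2 * rho) (is_derive_mul h1 h2)))
    (is_derive_scale L (is_derive_mul h1 h1))).
  by move/is_derive_eq; apply; rewrite /dQ; ring.
pose k := K * C.
have k0 : 0 <= k by rewrite mulr_ge0.
have dQk x : x0 <= x -> `|dQ x| <= k * expR (- 2 * x) * Q x.
  move=> x0x; have xx := lt_le_trans x00 x0x.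
  have Ax := weight_gt0 wA xx.
  rewrite /dQ normrN !normrM (gtr0_norm Ax) ger0_norm ?subr_ge0 ?(weight_log_ge wA)//.
  rewrite [leRHS](_ : _ = A x * ((K * expR (- 2 * x)) * (C * q x))); last first.
    by rewrite /k /Q; ring.
  rewrite -mulrA ler_wpM2l ?(ltW Ax)// ler_pM ?subr_ge0 ?(weight_log_ge wA)//.
  by have := hK x x0x; lra.
have Q0 x : x0 <= x -> 0 <= Q x.
  by move=> x0x; rewrite mulr_ge0// ltW// (weight_gt0 wA)// (lt_le_trans x00).
pose E x := k / 2 * expR (- 2 * x).
have dE s x : is_derive x 1 (fun x => expR (s * E x))
    (expR (s * E x) * (s * (k / 2 * (- 2 * expR (- 2 * x))))).
  exact/is_derive_exp_comp/is_derive_scale/is_derive_scale/is_derive_exp_lin.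
have E0 x : 0 <= E x by rewrite mulr_ge0 ?expR_ge0 ?divr_ge0.
pose q0' := Q x0 * expR (-1 * E x0); pose q1 := Q x0 * expR (1 * E x0).
have Qlow x : x0 <= x -> q0' <= Q x.
  move=> x0x; apply: (@le_trans _ _ (Q x * expR (-1 * E x))); last first.
    rewrite -[leRHS]mulr1 ler_wpM2l ?Q0// -[leRHS]expR0 ler_expR.
    by rewrite mulN1r oppr_le0.
  apply: (@is_derive_ge0_le _ (fun x => Q x * expR (-1 * E x)) (fun x => dQ x *
    expR (-1 * E x) + Q x *
    (expR (-1 * E x) * (-1 * (k / 2 * (- 2 * expR (- 2 * x))))))) => //.
    by move=> z /andP[x0z _]; apply: is_derive_mul; exact: QdQ.
  move=> z /andP[x0z _].
  rewrite [X in 0 <= X](_ : _ = (dQ z + k * expR (- 2 * z) * Q z) * expR (-1 * E z));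
    last by field.
  by rewrite mulr_ge0 ?expR_ge0//; have := dQk z x0z; rewrite ler_norml; lra.
have Qup x : x0 <= x -> Q x <= q1.
  move=> x0x; apply: (@le_trans _ _ (Q x * expR (1 * E x))).
    rewrite -[leLHS]mulr1 ler_wpM2l ?Q0// -[X in X <= _]expR0 ler_expR.
    by rewrite mul1r.
  apply: (@is_derive_le0_ge _ (fun x => Q x * expR (1 * E x)) (fun x => dQ x *
    expR (1 * E x) + Q x *
    (expR (1 * E x) * (1 * (k / 2 * (- 2 * expR (- 2 * x))))))) => //.
    by move=> z /andP[x0z _]; apply: is_derive_mul; exact: QdQ.
  move=> z /andP[x0z _].
  rewrite [X in X <= 0](_ : _ = (dQ z - k * expR (- 2 * z) * Q z) * expR (1 * E z));
    last by field.
  by rewrite mulr_le0_ge0 ?expR_ge0//; have := dQk z x0z; rewrite ler_norml; lra.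
have q0'0 : 0 < q0'.
  rewrite mulr_gt0 ?expR_gt0// mulr_gt0 ?(weight_gt0 wA)//.
  apply: lt_le_trans (qdel x0); rewrite mulr_gt0// ltr_wpDl ?sqr_ge0//.
  by rewrite lt_neqAle sqr_ge0 eq_sym sqrf_eq0 yx0.
pose H x := A x * (y x * p x) + 2 * L * Xi x + rho * (A x * (y x * y x)).
have Hup x : x0 <= x -> H x <= q1 / del + 2 * L * M + rho * (q1 / del).
  move=> x0x; have xx := lt_le_trans x00 x0x; have Ax := weight_gt0 wA xx.
  have Aq : A x * (p x ^+ 2 + y x ^+ 2) <= q1 / del.
    rewrite ler_pdivlMr// -mulrA; apply: le_trans (Qup x x0x).
    by rewrite ler_wpM2l ?(ltW Ax)// mulrC.
  rewrite /H lerD//; first rewrite lerD//.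
  - apply: le_trans Aq; rewrite ler_wpM2l ?(ltW Ax)//.
    have := sqr_ge0 (y x - p x); have := sqr_ge0 (y x); have := sqr_ge0 (p x).
    by rewrite sqrrB -mulr_natr; lra.
  - by rewrite ler_wpM2l ?XiM// mulr_ge0// ltW.
  - rewrite ler_wpM2l ?(ltW r0)//; apply: le_trans Aq.
    by rewrite ler_wpM2l ?(ltW Ax)// -expr2 lerDr sqr_ge0.
have Hlow x : x0 <= x -> H x0 - q0' * x0 <= H x - q0' * x.
  move=> x0x.
  apply: (@is_derive_ge0_le _ (fun x => H x - q0' * x) (fun x => (a x * A x * (y x * p x) +
    A x * (p x * p x + y x * (- a x * p x - L * y x)) + 2 * L * (A x * y x ^+ 2)
    + rho * (a x * A x * (y x * y x) + A x * (p x * y x + y x * p x))) -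
    q0' * 1)) => //.
    move=> z /andP[x0z _]; have zz := lt_le_trans x00 x0z.
    have hA := weight_derive wA zz.
    have h1 := solution_derive sy zz; have h2 := solution_derive2 sy zz.
    exact: is_derive_sub (is_derive_add (is_derive_add
      (is_derive_mul hA (is_derive_mul h1 h2))
      (is_derive_scale (2 * L) (dXi z x0z)))
      (is_derive_scale rho (is_derive_mul hA (is_derive_mul h1 h1))))
      (is_derive_scale q0' (is_derive_id z 1)).
  move=> z /andP[x0z _]; have zz := lt_le_trans x00 x0z.
  have Az := weight_gt0 wA zz.
  rewrite [X in 0 <= X](_ : _ = (Q z - q0') + rho * (a z * (A z * y z ^+ 2)));
    last by rewrite /Q /q; ring.
  rewrite addr_ge0 ?subr_ge0 ?Qlow// mulr_ge0 ?(ltW r0)//.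
  by rewrite mulr_ge0 ?(weight_a_ge0 wA)// mulr_ge0 ?sqr_ge0// ltW.
pose B := q1 / del + 2 * L * M + rho * (q1 / del) - H x0.
pose x1 := x0 + (`|B| + 1) / q0'.
have x01 : x0 <= x1 by rewrite lerDl divr_ge0 ?(ltW q0'0)// addr_ge0.
have := Hlow _ x01; have := Hup _ x01.
have -> : q0' * x1 = q0' * x0 + (`|B| + 1) by rewrite /x1; field; rewrite gt_eqF.
have := ler_norm B; rewrite {1}/B; lra.
Qed.

End RealODEGrowth.

(** * The Jacobi weight *)

Section JacobiWeight.
Context {R : realType}.
Implicit Types x z t s l c d L : R.

Lemma is_derive_powR (f : R -> R) c x df : is_derive x 1 f df -> 0 < f x ->
  is_derive x 1 (fun y => f y `^ c) (c * (df / f x) * f x `^ c).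
Proof.
move=> hf f0; have hl := is_derive1_ln f0.
have h : is_derive (f x) 1 (@powR R ^~ c) (c * (f x)^-1 * f x `^ c).
  apply: (@near_eq_is_derive _ _ _ (fun a => expR (c * ln a))).
  - near=> b; rewrite /powR gt_eqF//; near: b; exact: lt_nbhsr.
  - have := is_derive_exp_comp (is_derive_scale c hl).
    by move/is_derive_eq; apply; rewrite mulrC /powR gt_eqF.
have := is_derive1_comp h hf; move/is_derive_eq; apply; ring.
Unshelve. all: by end_near. Qed.

Lemma is_derive_expRN x : is_derive x 1 (fun y : R => expR (- y)) (- expR (- x)).
Proof.
have := @is_derive_exp_comp R _ x _ (is_derive_opp (is_derive_id x 1)).
by move/is_derive_eq; apply; rewrite mulrN1.
Qed.

Lemma is_derive_sinh x : is_derive x 1 (@sinh R) (cosh x).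
Proof.
have h := is_derive_sub (is_derive_expR x) (is_derive_expRN x).
have := is_derive_scale 2^-1 h.
rewrite (_ : (fun y => _) = @sinh R); last first.
  by apply/funext => y; rewrite /sinh mulrC.
by move/is_derive_eq; apply; rewrite /cosh opprK mulrC.
Qed.

Lemma is_derive_cosh x : is_derive x 1 (@cosh R) (sinh x).
Proof.
have h := is_derive_add (is_derive_expR x) (is_derive_expRN x).
have := is_derive_scale 2^-1 h.
rewrite (_ : (fun y => _) = @cosh R); last first.
  by apply/funext => y; rewrite /cosh mulrC.
by move/is_derive_eq; apply; rewrite /sinh mulrC.
Qed.

Lemma sinh_gt0 x : 0 < x -> 0 < sinh x.
Proof. by move=> x0; rewrite divr_gt0// subr_gt0 ltr_expR; lra. Qed.

Lemma cosh_gt0 x : 0 < cosh x.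
Proof. by rewrite divr_gt0// addr_gt0 ?expR_gt0. Qed.

Definition jacobi_log_weight (alpha beta x : R) : R :=
  (2 * alpha + 1) * (cosh x / sinh x) + (2 * beta + 1) * (sinh x / cosh x).

Variables (alpha beta : R).
Hypotheses (hbeta : - 2^-1 <= beta) (hab : beta <= alpha) (halpha : - 2^-1 < alpha).

Local Notation a := (jacobi_log_weight alpha beta).
Local Notation A := (jacobi_weight alpha beta).
Local Notation rho := (jacobi_rho alpha beta).

Lemma jacobi_weight_derive x : 0 < x -> is_derive x 1 A (a x * A x).
Proof.
move=> x0; have s0 := sinh_gt0 x0; have c0 := cosh_gt0 x.
have s2 : 0 < 2 * sinh x by rewrite mulr_gt0.
have c2 : 0 < 2 * cosh x by rewrite mulr_gt0.
have := is_derive_mul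
  (is_derive_powR (2 * alpha + 1) (is_derive_scale 2 (is_derive_sinh x)) s2)
  (is_derive_powR (2 * beta + 1) (is_derive_scale 2 (is_derive_cosh x)) c2).
move/is_derive_eq; apply; rewrite /jacobi_log_weight /jacobi_weight.
by field; rewrite !gt_eqF.
Qed.

Lemma jacobi_log_weightE x : 0 < x -> a x - 2 * rho =
  2 * expR (- x) * ((2 * alpha + 1) / (expR x - expR (- x)) -
                    (2 * beta + 1) / (expR x + expR (- x))).
Proof.
move=> x0; have d0 : 0 < expR x - expR (- x) by rewrite subr_gt0 ltr_expR; lra.
have c0 : 0 < expR x + expR (- x) by rewrite addr_gt0 ?expR_gt0.
rewrite /jacobi_log_weight /jacobi_rho /sinh /cosh; field.
by rewrite !gt_eqF.
Qed.

(** The assumption beta <= alpha enters through A' / A >= 2 rho. *)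
Lemma jacobi_sturm_weight : sturm_weight rho A a.
Proof.
have [hb [hba ha]] := conj hbeta (conj hab halpha).
have a2 : 0 < 2 * alpha + 1 by lra.
have b2 : 0 <= 2 * beta + 1 by lra.
split.
- by rewrite /jacobi_rho; lra.
- by move=> x x0; rewrite mulr_gt0 ?powR_gt0// mulr_gt0 ?sinh_gt0 ?cosh_gt0.
- exact: jacobi_weight_derive.
- move=> x x0; rewrite -subr_ge0 jacobi_log_weightE//.
  have d0 : 0 < expR x - expR (- x) by rewrite subr_gt0 ltr_expR; lra.
  have e0 := expR_gt0 (- x).
  rewrite mulr_ge0 ?mulr_ge0 ?expR_ge0// subr_ge0 ler_pM ?invr_ge0//; try lra.
  by rewrite lef_pV2 ?posrE; lra.
- move=> x0 x00; have d1 : 0 < 1 - expR (- 2 * x0).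
    by rewrite subr_gt0 -[ltRHS]expR0 ltr_expR; lra.
  exists (2 * (2 * alpha + 1) / (1 - expR (- 2 * x0))).
    by rewrite divr_ge0 ?(ltW d1)//; lra.
  move=> x x0x; have xx := lt_le_trans x00 x0x.
  rewrite -lerBlDl jacobi_log_weightE//.
  have d0 : 0 < expR x - expR (- x) by rewrite subr_gt0 ltr_expR; lra.
  have c0 : 0 < expR x + expR (- x) by rewrite addr_gt0 ?expR_gt0.
  have dE : expR x - expR (- x) = expR x * (1 - expR (- 2 * x)).
    by rewrite mulrBr mulr1 -expRD; congr (_ - expR _); ring.
  have dd : 1 - expR (- 2 * x0) <= 1 - expR (- 2 * x).
    by rewrite lerB// ler_expR; lra.
  apply: (@le_trans _ _ (2 * expR (- x) * ((2 * alpha + 1) / (expR x - expR (- x))))).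
    by rewrite ler_wpM2l ?mulr_ge0 ?expR_ge0// gerBl divr_ge0 ?(ltW c0).
  rewrite dE.
  rewrite (_ : 2 * expR (- x) * _ =
     2 * (2 * alpha + 1) * expR (- 2 * x) * (1 - expR (- 2 * x))^-1); last first.
    rewrite (_ : expR (- 2 * x) = expR (- x) / expR x); last first.
      by rewrite -expRN -expRD; congr expR; ring.
    have := d0; rewrite dE pmulr_rgt0 ?expR_gt0// => h.
    field; rewrite (gt_eqF (expR_gt0 x)) /=.
    apply/eqP => h0; move: h; rewrite (_ : expR (- 2 * x) = expR (- x) / expR x).
      rewrite subr_gt0 ltr_pdivrMr ?expR_gt0// mul1r.
      by move: h0; lra.
    by rewrite -expRN -expRD; congr expR; ring.
  rewrite [leRHS](_ : _ = 2 * (2 * alpha + 1) * expR (- 2 * x) *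
     (1 - expR (- 2 * x0))^-1); last by ring.
  rewrite ler_wpM2l ?mulr_ge0 ?expR_ge0 ?(ltW a2)// lef_pV2 ?posrE//.
  exact: lt_le_trans dd.
- rewrite [X in _ --> X](_ : 0 = 0 * (2 * cosh 0) `^ (2 * beta + 1)); last by rewrite mul0r.
  apply: cvgM.
    have h : (fun x : R => 2 * sinh x) x @[x --> 0^'+] --> 0^'+.
      move=> P /= [e e0 Pe].
      have c : {for 0, continuous (fun x : R => 2 * sinh x)}.
        exact: is_derive_continuous (is_derive_scale 2 (is_derive_sinh 0)).
      have s0 : 2 * sinh 0 = 0 :> R by rewrite /sinh oppr0 subrr mul0r mulr0.
      have : \forall x \near 0^'+, `|2 * sinh 0 - 2 * sinh x| < e.
        by have /cvgr_dist_lt := cvg_at_right_filter c; exact.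
      rewrite s0 => near_e.
      suff : \forall x \near 0^'+, P (2 * sinh x) by [].
      near=> x; apply: Pe => /=; first by near: x; exact: near_e.
      by rewrite mulr_gt0// sinh_gt0.
    exact: cvg_comp h (powR_cvg0 a2).
  apply: cvg_at_right_filter.
  have c2 : 0 < 2 * cosh 0 :> R by rewrite mulr_gt0 ?cosh_gt0.
  exact: is_derive_continuous (is_derive_powR _ (is_derive_scale 2 (is_derive_cosh 0)) c2).
Unshelve. all: by end_near. Qed.

End JacobiWeight.

(** * Jacobi functions at imaginary parameters *)

Section RealJacobiFunction.
Context {R : realType}.
Implicit Types x z t s l c d L : R.

Lemma even_derive0 (f : R -> R) d : (forall x, f (- x) = f x) ->
  is_derive (0 : R) 1 f d -> d = 0.
Proof.
move=> fN f0; have h : is_derive (0 : R) 1 (fun x : R => - x) (-1).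
  exact: is_derive_opp (is_derive_id _ _).
have f0' : is_derive (- 0 : R) 1 f d by rewrite oppr0.
have := is_derive1_comp (f := f) (g := fun x => - x) f0' h.
rewrite (_ : f \o _ = f); last by apply/funext => x; rewrite /= fN.
by case: f0 => _ fd [_]; rewrite fd; lra.
Qed.

(** lambda = i s gives lambda^2 + rho^2 = L. *)
Definition imaginary_parameter (rho L : R) : R[i] :=
  Complex 0 (Num.sqrt (rho ^+ 2 - L)).

Lemma imaginary_parameterE rho L : L <= rho ^+ 2 ->
  imaginary_parameter rho L ^+ 2 + (rho ^+ 2)%:C%C = L%:C%C.
Proof.
move=> h; rewrite /imaginary_parameter expr2; apply/eqP; rewrite eq_complex /=.
rewrite !mul0r mulr0 !addr0 -expr2 sqr_sqrtr ?subr_ge0//.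
by apply/andP; split; apply/eqP; ring.
Qed.

Variables (alpha beta : R) (phi : R[i] -> R -> R[i]).
Hypothesis hphi : is_jacobi_function alpha beta phi.
Local Notation a := (jacobi_log_weight alpha beta).
Local Notation A := (jacobi_weight alpha beta).
Local Notation rho := (jacobi_rho alpha beta).

Definition real_jacobi L : R -> R :=
  @complex.Re R \o phi (imaginary_parameter rho L).

Definition imag_jacobi L : R -> R :=
  @complex.Im R \o phi (imaginary_parameter rho L).

Lemma real_jacobi_is_derive L x :
  is_derive x 1 (real_jacobi L) ((real_jacobi L)^`()%classic x).
Proof.
have [h _] := jacobi_smooth hphi (imaginary_parameter rho L) 0 x.
by rewrite derive1E; exact: derivableP.
Qed.

Lemma imag_jacobi_is_derive L x :
  is_derive x 1 (imag_jacobi L) ((imag_jacobi L)^`()%classic x).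
Proof.
have [_ h] := jacobi_smooth hphi (imaginary_parameter rho L) 0 x.
by rewrite derive1E; exact: derivableP.
Qed.

Lemma real_jacobi_is_derive2 L x :
  is_derive x 1 (real_jacobi L)^`()%classic ((real_jacobi L)^`()^`()%classic x).
Proof.
have [h _] := jacobi_smooth hphi (imaginary_parameter rho L) 1 x.
by rewrite [X in is_derive _ _ _ X]derive1E; exact: derivableP.
Qed.

Lemma imag_jacobi_is_derive2 L x :
  is_derive x 1 (imag_jacobi L)^`()%classic ((imag_jacobi L)^`()^`()%classic x).
Proof.
have [_ h] := jacobi_smooth hphi (imaginary_parameter rho L) 1 x.
by rewrite [X in is_derive _ _ _ X]derive1E; exact: derivableP.
Qed.

Lemma jacobi_eigen_components L x : L <= rho ^+ 2 -> 0 < x ->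
  (real_jacobi L)^`()^`()%classic x =
    - a x * (real_jacobi L)^`()%classic x - L * real_jacobi L x /\
  (imag_jacobi L)^`()^`()%classic x =
    - a x * (imag_jacobi L)^`()%classic x - L * imag_jacobi L x.
Proof.
have re (d2 d d' c w w' : R) : - d2 - (c * d - 0 * d') = L * w - 0 * w' ->
    d2 = - c * d - L * w by lra.
have im (d2 d d' c w w' : R) : - d2 - (c * d' + 0 * d) = L * w' + 0 * w ->
    d2 = - c * d' - L * w' by lra.
move=> hL x0; have := jacobi_eigen hphi (imaginary_parameter rho L) x0.
rewrite imaginary_parameterE// /jacobi_operator.
have -> : (A : R -> R)^`()%classic x / A x = a x.
  have Ax : A x != 0.
    by rewrite gt_eqF// mulr_gt0// powR_gt0// mulr_gt0 ?sinh_gt0 ?cosh_gt0.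
  have [_ dA] := jacobi_weight_derive alpha beta x0.
  by rewrite derive1E dA mulfK.
rewrite /cderive /=.
case E : (phi _ x) => [u v].
move=> [hR hI]; rewrite /real_jacobi /imag_jacobi /= E /=.
by split; [exact: re hR|exact: im hI].
Qed.

Lemma regular_solution_of_even L c (y : R -> R) :
  (forall x, y (- x) = y x) -> y 0 = c ->
  (forall x, is_derive x 1 y (y^`()%classic x)) ->
  (forall x, is_derive x 1 y^`()%classic (y^`()^`()%classic x)) ->
  (forall x, 0 < x -> y^`()^`()%classic x = - a x * y^`()%classic x - L * y x) ->
  regular_solution a L c y y^`()%classic.
Proof.
move=> ye y0 d1 d2 eq; split.
- by move=> x _; exact: d1.
- by move=> x x0; rewrite -eq.
- rewrite -y0; apply: cvg_at_right_filter.
  exact: is_derive_continuous (d1 0).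
- rewrite -[X in _ --> X](even_derive0 ye (d1 0)); apply: cvg_at_right_filter.
  exact: is_derive_continuous (d2 0).
Qed.

Lemma real_jacobi_even L x : real_jacobi L (- x) = real_jacobi L x.
Proof. by rewrite /real_jacobi /= (jacobi_even hphi). Qed.

Lemma real_jacobi0 L : real_jacobi L 0 = 1.
Proof. by rewrite /real_jacobi /= (jacobi_at0 hphi). Qed.

Lemma real_jacobi_continuous L : continuous (real_jacobi L).
Proof. by move=> x; exact: is_derive_continuous (real_jacobi_is_derive L x). Qed.

Lemma real_jacobi_solution L : L <= rho ^+ 2 ->
  regular_solution a L 1 (real_jacobi L) (real_jacobi L)^`()%classic.
Proof.
move=> hL; apply: (@regular_solution_of_even L 1 (real_jacobi L)).
- exact: real_jacobi_even.
- exact: real_jacobi0.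
- exact: real_jacobi_is_derive.
- exact: real_jacobi_is_derive2.
- by move=> x x0; have [] := jacobi_eigen_components hL x0.
Qed.

Hypotheses (hbeta : - 2^-1 <= beta) (hab : beta <= alpha)
  (halpha : - 2^-1 < alpha).

(** The imaginary part solves the same equation with value 0 at 0. *)
Lemma jacobi_imaginary_parameter L x : L <= rho ^+ 2 -> 0 < x ->
  phi (imaginary_parameter rho L) x = (real_jacobi L x)%:C%C.
Proof.
move=> hL x0.
have sI : regular_solution a L 0 (imag_jacobi L) (imag_jacobi L)^`()%classic.
  apply: (@regular_solution_of_even L 0 (imag_jacobi L)).
  - by move=> z; rewrite /imag_jacobi /= (jacobi_even hphi).
  - by rewrite /imag_jacobi /= (jacobi_at0 hphi).
  - exact: imag_jacobi_is_derive.
  - exact: imag_jacobi_is_derive2.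
  - by move=> z z0; have [] := jacobi_eigen_components hL z0.
have := solution_unique0 (jacobi_sturm_weight hbeta hab halpha) sI x0.
rewrite /imag_jacobi /real_jacobi /=.
by case: (phi _ x) => u v /= ->.
Qed.

End RealJacobiFunction.

(** * Real-valued and iterated integrals *)

Lemma norm_mul_le_sqr (R : realType) (u v : R) : `|u * v| <= u ^+ 2 + v ^+ 2.
Proof.
rewrite normrM -[u ^+ 2]real_normK ?num_real// -[v ^+ 2]real_normK ?num_real//.
have u0 := normr_ge0 u; have v0 := normr_ge0 v.
set a := `|u| in u0 *; set b := `|v| in v0 *.
have := sqr_ge0 (a - b); rewrite (_ : (a - b) ^+ 2 = a ^+ 2 + b ^+ 2 - 2 * (a * b));
  last by ring.
by have := mulr_ge0 u0 v0; lra.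
Qed.

Section RealIntegral.
Context d (T : measurableType d) (R : realType).
Variable mu : {measure set T -> \bar R}.
Implicit Types f g : T -> R.

Definition intg f : Prop := mu.-integrable setT (EFin \o f).

Definition Int f : R := Rintegral mu setT f.

Lemma intg_measurable f : intg f -> measurable_fun setT f.
Proof. by case/integrableP => /measurable_EFinP. Qed.

Lemma IntE f : intg f -> (\int[mu]_x (f x)%:E)%E = (Int f)%:E.
Proof. by move=> hf; rewrite /Int /Rintegral fineK//; exact: integrable_fin_num. Qed.

Lemma intg_le f g : measurable_fun setT f -> (forall x, `|f x| <= g x) ->
  intg g -> intg f.
Proof.
move=> mf fg; apply: le_integrable => //; first exact/measurable_EFinP.
by move=> x _ /=; rewrite lee_fin (le_trans (fg x))// ler_norm.
Qed.

Lemma intg_norm f : intg f -> intg (fun x => `|f x|).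
Proof. exact: integrable_norm. Qed.

Lemma intgD f g : intg f -> intg g -> intg (fun x => f x + g x).
Proof. by move=> hf hg; exact: (integrableD measurableT hf hg). Qed.

Lemma intgB f g : intg f -> intg g -> intg (fun x => f x - g x).
Proof. by move=> hf hg; exact: (integrableB measurableT hf hg). Qed.

Lemma intgZ c f : intg f -> intg (fun x => c * f x).
Proof. by move=> hf; exact: (integrableZl measurableT c hf). Qed.

Lemma intg0 : intg (fun=> 0).
Proof. exact: integrable0. Qed.

Lemma IntD f g : intg f -> intg g -> Int (fun x => f x + g x) = Int f + Int g.
Proof. by move=> hf hg; exact: RintegralD. Qed.

Lemma IntB f g : intg f -> intg g -> Int (fun x => f x - g x) = Int f - Int g.
Proof. by move=> hf hg; exact: RintegralB. Qed.

Lemma IntZ c f : intg f -> Int (fun x => c * f x) = c * Int f.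
Proof. by move=> hf; exact: RintegralZl. Qed.

Lemma Int0 : Int (fun=> 0) = 0.
Proof. by rewrite /Int Rintegral_cst// mul0r. Qed.

Lemma Int_le f g : intg f -> intg g -> (forall x, f x <= g x) -> Int f <= Int g.
Proof. by move=> hf hg fg; exact: le_Rintegral. Qed.

Lemma Int_ge0 f : (forall x, 0 <= f x) -> 0 <= Int f.
Proof. by move=> f0; exact: Rintegral_ge0. Qed.

Lemma Int_norm f : intg f -> `|Int f| <= Int (fun x => `|f x|).
Proof. by move=> hf; exact: le_normr_Rintegral. Qed.

Lemma Int_norm_le f g : intg f -> intg g -> (forall x, `|f x| <= g x) ->
  `|Int f| <= Int g.
Proof.
move=> hf hg fg; apply: le_trans (Int_norm hf) _.
by apply: Int_le => //; exact: intg_norm.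
Qed.

Lemma intg_ae f g : measurable_fun setT g -> {ae mu, forall x, f x = g x} ->
  intg f -> intg g.
Proof.
move=> mg fg hf; have mf := intg_measurable hf.
case/integrableP : hf => _ foo; apply/integrableP; split.
  exact/measurable_EFinP.
rewrite (_ : integral _ _ _ = (\int[mu]_x `|(f x)%:E|)%E)//.
apply: ae_eq_integral => //.
- by apply: (measurableT_comp (f := abse)) => //; exact/measurable_EFinP.
- by apply: (measurableT_comp (f := abse)) => //; exact/measurable_EFinP.
- by apply: filterS fg => x /= ->.
Qed.

Lemma Int_ae f g : measurable_fun setT f -> measurable_fun setT g ->
  {ae mu, forall x, f x = g x} -> Int f = Int g.
Proof.
move=> mf mg fg; congr fine; apply: ae_eq_integral => //.
- exact/measurable_EFinP.
- exact/measurable_EFinP.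
- by apply: filterS fg => x /= ->.
Qed.

Lemma intg_ge0P f c : measurable_fun setT f -> (forall x, 0 <= f x) ->
  (\int[mu]_x (f x)%:E <= c%:E)%E -> intg f /\ Int f <= c.
Proof.
move=> mf f0 fc; have hf : intg f.
  apply/integrableP; split; first exact/measurable_EFinP.
  apply: le_lt_trans (ltry c); apply: le_trans fc.
  rewrite le_eqVlt; apply/orP; left; apply/eqP.
  by apply: eq_integral => x _ /=; rewrite ger0_norm.
by split => //; rewrite -lee_fin -IntE.
Qed.

Lemma intg_lty f : measurable_fun setT f ->
  (\int[mu]_x (`|f x|)%:E < +oo)%E -> intg f.
Proof. by move=> mf foo; apply/integrableP; split => //; exact/measurable_EFinP. Qed.

Lemma intg_mul_bounded f g M : measurable_fun setT f -> (forall x, `|f x| <= M) ->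
  intg g -> intg (fun x => f x * g x).
Proof.
move=> mf fM hg; apply: (@intg_le _ (fun x => M * `|g x|)).
- by apply: measurable_funM => //; exact: (intg_measurable hg).
- by move=> x; rewrite normrM ler_wpM2r.
- exact/intgZ/intg_norm.
Qed.

Lemma intg_mul_square f g : measurable_fun setT f -> measurable_fun setT g ->
  intg (fun x => f x ^+ 2) -> intg (fun x => g x ^+ 2) ->
  intg (fun x => f x * g x).
Proof.
move=> mf mg hf hg; apply: (intg_le _ _ (intgD hf hg)).
  exact: measurable_funM.
by move=> x; exact: norm_mul_le_sqr.
Qed.

Lemma Int_cauchy_schwarz f g :
  measurable_fun setT f -> measurable_fun setT g ->
  intg (fun x => f x ^+ 2) -> intg (fun x => g x ^+ 2) ->
  Int (fun x => f x * g x) ^+ 2 <=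
  Int (fun x => f x ^+ 2) * Int (fun x => g x ^+ 2).
Proof.
move=> mf mg hf hg; have hfg := intg_mul_square mf mg hf hg.
set b := Int (fun x => f x * g x); set F := Int _; set G := Int _.
have pos s t : 0 <= s ^+ 2 * F + (2 * s * t) * b + t ^+ 2 * G.
  rewrite -(IntZ (s ^+ 2) hf) -(IntZ (2 * s * t) hfg) -(IntZ (t ^+ 2) hg).
  rewrite -IntD; [|exact: intgZ|exact: intgZ].
  rewrite -IntD; [|exact/intgD/intgZ/hfg/intgZ|exact: intgZ].
  apply: Int_ge0 => x.
  rewrite (_ : _ + _ = (s * f x + t * g x) ^+ 2) ?sqr_ge0//; ring.
have F0 : 0 <= F by apply: Int_ge0 => x; exact: sqr_ge0.
have := pos b (- F); have := pos 1 (- b); have := pos (- b) 1; have := pos G (- b).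
have G0 : 0 <= G by apply: Int_ge0 => x; exact: sqr_ge0.
move: F0; rewrite le_eqVlt => /predU1P[F0|F0] h1 h2 h3 h4.
  rewrite -F0 mul0r; move: (pos (- b * (G + 1)) 1); rewrite -F0 mulr0 add0r.
  have : 0 <= b ^+ 2 by exact: sqr_ge0.
  have : 0 <= b ^+ 2 * G by rewrite mulr_ge0// sqr_ge0.
  nra.
rewrite -subr_ge0 -(pmulr_rge0 _ F0).
by apply: le_trans h4 _; rewrite le_eqVlt; apply/orP; left; apply/eqP; ring.
Qed.

Lemma Int_square_eq0 f : measurable_fun setT f -> intg (fun x => f x ^+ 2) ->
  Int (fun x => f x ^+ 2) = 0 -> {ae mu, forall x, f x = 0}.
Proof.
move=> mf hf f0; have : (\int[mu]_x `|(f x ^+ 2)%:E| = 0)%E.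
  rewrite (_ : integral _ _ _ = (\int[mu]_x (f x ^+ 2)%:E)%E).
    by rewrite (IntE hf) f0.
  by apply: eq_integral => x _ /=; rewrite ger0_norm// sqr_ge0.
move/(ae_eq_integral_abs mu measurableT _).1 => h.
have {h} : ae_eq mu setT (fun x => (f x ^+ 2)%:E) (cst 0%E).
  by apply: h; exact/measurable_EFinP/(intg_measurable hf).
by apply: filterS => x /= /(_ I) [/eqP]; rewrite sqrf_eq0 => /eqP.
Qed.

End RealIntegral.

Section RealFubini.
Context d (T : measurableType d) (R : realType).
Variable mu : {sigma_finite_measure set T -> \bar R}.
Implicit Types (F : T -> T -> R) (g : T -> R).

Definition measurable2 F : Prop := measurable_fun setT (fun z : T * T => F z.1 z.2).

Lemma measurable2_section F x : measurable2 F -> measurable_fun setT (F x).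
Proof.
move=> mF.
by apply: (measurableT_comp (f := fun z : T * T => F z.1 z.2) (g := pair x)).
Qed.

Lemma measurable2_swap F : measurable2 F -> measurable2 (fun x y => F y x).
Proof.
move=> mF.
apply: (measurableT_comp (f := fun z : T * T => F z.1 z.2)
  (g := fun z => (z.2, z.1))) => //.
exact: measurable_fun_pair.
Qed.

Lemma measurable2_mul F G : measurable2 F -> measurable2 G ->
  measurable2 (fun x y => F x y * G x y).
Proof. by move=> mF mG; exact: measurable_funM. Qed.

Lemma measurable2_fst g : measurable_fun setT g -> measurable2 (fun x _ => g x).
Proof. by move=> mg; apply: (measurableT_comp mg). Qed.

Lemma measurable2_snd g : measurable_fun setT g -> measurable2 (fun _ y => g y).
Proof. by move=> mg; apply: (measurableT_comp mg). Qed.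

Lemma measurable2_norm F : measurable2 F -> measurable2 (fun x y => `|F x y|).
Proof. by move=> mF; exact: measurableT_comp. Qed.

Lemma measurable_Int F : measurable2 F ->
  measurable_fun setT (fun x => Int mu (F x)).
Proof.
move=> mF; apply: measurableT_comp; first exact: fine_measurable.
rewrite (_ : (fun x => _) = (fun x => \int[mu]_y ((fun z : T * T => (F z.1 z.2)%:E)^\+ (x, y))
   - \int[mu]_y ((fun z : T * T => (F z.1 z.2)%:E)^\- (x, y)))%E); last first.
  apply/funext => x; rewrite [LHS]integralE.
  by congr (_ - _)%E; apply: eq_integral => y _; rewrite ?funeposE ?funenegE.
have mE : measurable_fun setT (fun z : T * T => (F z.1 z.2)%:E) by exact/measurable_EFinP.
apply: emeasurable_funB.
  by apply: (measurable_fun_fubini_tonelli_F _ (measurable_funepos mE)).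
by apply: (measurable_fun_fubini_tonelli_F _ (measurable_funeneg mE)).
Qed.

Definition intg2 F : Prop := measurable2 F /\
  (\int[mu]_x \int[mu]_y (`|F x y|)%:E < +oo)%E.

Lemma intg2_bound F g : measurable2 F -> intg mu g ->
  (forall x, \int[mu]_y (`|F x y|)%:E <= (g x)%:E)%E -> intg2 F.
Proof.
move=> mF hg Fg; split => //; apply: (@le_lt_trans _ _ (\int[mu]_x (g x)%:E)%E).
  apply: ge0_le_integral => //.
  - by move=> x _; exact: integral_ge0.
  - apply: (measurable_fun_fubini_tonelli_F (fun z : T * T => (`|F z.1 z.2|)%:E)) => //.
    by apply/measurable_EFinP; exact: (measurable2_norm mF).
  - exact/measurable_EFinP/(intg_measurable hg).
by rewrite IntE// ltry.
Qed.

Lemma intg2_swap F : intg2 F -> intg2 (fun x y => F y x).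
Proof.
move=> [mF Foo]; split; first exact: measurable2_swap.
rewrite -(fubini_tonelli (m1 := mu) (m2 := mu) (fun z : T * T => (`|F z.1 z.2|)%:E))//.
by apply/measurable_EFinP; exact: (measurable2_norm mF).
Qed.

Lemma intg2_section F : intg2 F -> {ae mu, forall x, intg mu (F x)}.
Proof.
move=> [mF Foo].
have mF' : measurable_fun setT (fun z : T * T => (F z.1 z.2)%:E) by exact/measurable_EFinP.
have iF : (mu \x mu)%E.-integrable setT (fun z : T * T => (F z.1 z.2)%:E).
  exact/(integrable12ltyP _ _ mF').
exact: ae_integrable1 iF.
Qed.

Lemma intg2_Int F : intg2 F -> intg mu (fun x => Int mu (F x)).
Proof.
move=> [mF Foo].
have mF' : measurable_fun setT (fun z : T * T => (F z.1 z.2)%:E) by exact/measurable_EFinP.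
have iF : (mu \x mu)%E.-integrable setT (fun z : T * T => (F z.1 z.2)%:E).
  exact/(integrable12ltyP _ _ mF').
apply: le_integrable (integrable_fubini_F iF) => //.
  by apply/measurable_EFinP; exact: measurable_Int.
move=> x _ /=; rewrite /Int /Rintegral /fubini_F.
by case: (integral _ _ _) => [r| |] //=; rewrite normr0 leey.
Qed.

Lemma intg2_Fubini F : intg2 F ->
  Int mu (fun x => Int mu (F x)) = Int mu (fun y => Int mu (fun x => F x y)).
Proof.
move=> hF; have [mF Foo] := hF.
have mF' : measurable_fun setT (fun z : T * T => (F z.1 z.2)%:E) by exact/measurable_EFinP.
have iF : (mu \x mu)%E.-integrable setT (fun z : T * T => (F z.1 z.2)%:E).
  exact/(integrable12ltyP _ _ mF').
have E G : intg2 G ->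
    (\int[mu]_x \int[mu]_y (G x y)%:E = \int[mu]_x (Int mu (G x))%:E)%E.
  move=> hG; apply: ae_eq_integral => //.
  - have [mG Goo] := hG; apply: (measurable_fubini_F (m1 := mu) (m2 := mu) (f := fun z : T * T => (G z.1 z.2)%:E)).
    have mG' : measurable_fun setT (fun z : T * T => (G z.1 z.2)%:E).
      exact/measurable_EFinP.
    exact/(integrable12ltyP _ _ mG').
  - exact/measurable_EFinP/(intg_measurable (intg2_Int hG)).
  - by apply: filterS (intg2_section hG) => x /= hx _; rewrite IntE.
rewrite /Int /Rintegral -(E _ hF) -(E _ (intg2_swap hF)).
by congr fine; exact: (Fubini iF).
Qed.

End RealFubini.

(** * Positive symmetric kernels with exponential eigenfunctions *)

Section TransformKernels.
Context d (T : measurableType d) (R : realType).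
Variable mu : {sigma_finite_measure set T -> \bar R}.
Implicit Types (f g : T -> R) (k F G : T -> T -> R) (z M N : R).

Lemma intg2P F : measurable2 F ->
  (intg2 mu F <-> (mu \x mu)%E.-integrable setT (fun z : T * T => (F z.1 z.2)%:E)).
Proof.
move=> mF.
have mF' : measurable_fun setT (fun z : T * T => (F z.1 z.2)%:E) by exact/measurable_EFinP.
split => [[_ Foo]|iF]; first exact/(integrable12ltyP _ _ mF').
by split => //; have /(_ iF) := (integrable12ltyP mu mu mF').1.
Qed.

Lemma intg2D F G : intg2 mu F -> intg2 mu G -> intg2 mu (fun x y => F x y + G x y).
Proof.
move=> hF hG; have [mF _] := hF; have [mG _] := hG.
apply/intg2P; first exact: measurable_funD.
move/(intg2P mF) in hF; move/(intg2P mG) in hG.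
exact: (integrableD measurableT hF hG).
Qed.

Lemma intg2_le F G : measurable2 F -> (forall x y, `|F x y| <= G x y) ->
  intg2 mu G -> intg2 mu F.
Proof.
move=> mF FG hG; have [mG _] := hG.
apply/intg2P => //; move/(intg2P mG) in hG; apply: le_integrable hG => //.
  exact/measurable_EFinP.
by move=> x _ /=; rewrite lee_fin (le_trans (FG _ _))// ler_norm.
Qed.

Definition kernel_op k g : T -> R := fun x => Int mu (fun y => k x y * g y).

(** Family of exponentials: common eigenfunctions of the kernels below. *)
Variable e : R -> T -> R.
Hypothesis me : forall z, measurable_fun setT (e z).
Hypothesis e_ge1 : forall z x, 0 <= z -> 1 <= e z x.
Hypothesis e0 : forall x, e 0 x = 1.

(** Test functions: the class is stable under the kernels below, and all
    integrals against them converge. *)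
Record tame f : Prop := Tame {
  tame_measurable : measurable_fun setT f ;
  tame_bounded : exists M, forall x, `|f x| <= M ;
  tame_intg : forall z, 0 <= z -> intg mu (fun x => f x * e z x) }.

(** The eigenvalue equation holds almost everywhere only, because the kernels
    below are cut off to the half-line; the inequality then holds everywhere. *)
Record transform_kernel (hat : R -> R) k : Prop := TransformKernel {
  kernel_meas : measurable2 k ;
  kernel_pos : forall x y, 0 <= k x y ;
  kernel_sym : forall x y, k x y = k y x ;
  kernel_intg : forall z x, 0 <= z -> intg mu (fun y => k x y * e z y) ;
  kernel_le : forall z x, 0 <= z -> kernel_op k (e z) x <= hat z * e z x ;
  kernel_eigen : forall z, 0 <= z ->
    {ae mu, forall x, kernel_op k (e z) x = hat z * e z x} }.

Lemma e_gt0 z x : 0 <= z -> 0 < e z x.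
Proof. by move=> z0; apply: lt_le_trans (e_ge1 x z0). Qed.

Lemma tame_intg0 f : tame f -> intg mu f.
Proof.
move=> tf; have := tame_intg tf (lexx 0).
by rewrite (_ : (fun x => _) = f)//; apply/funext => x; rewrite e0 mulr1.
Qed.

Lemma tameD f g : tame f -> tame g -> tame (fun x => f x + g x).
Proof.
move=> [mf [M fM] hf] [mg [N gN] hg]; split.
- exact: measurable_funD.
- by exists (M + N) => x; apply: le_trans (ler_normD _ _) _; rewrite lerD.
- move=> z z0; rewrite (_ : (fun x => _) = (fun x => f x * e z x + g x * e z x)).
    by apply: intgD; [exact: hf|exact: hg].
  by apply/funext => x; rewrite mulrDl.
Qed.

Lemma tameZ c f : tame f -> tame (fun x => c * f x).
Proof.
move=> [mf [M fM] hf]; split.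
- exact: measurable_funM.
- by exists (`|c| * M) => x; rewrite normrM ler_wpM2l.
- move=> z z0; rewrite (_ : (fun x => _) = (fun x => c * (f x * e z x))).
    by apply: intgZ; exact: hf.
  by apply/funext => x; rewrite mulrA.
Qed.

Lemma tameB f g : tame f -> tame g -> tame (fun x => f x - g x).
Proof.
move=> tf tg; rewrite (_ : (fun x => _) = (fun x => f x + -1 * g x)).
  exact/tameD/tameZ.
by apply/funext => x; rewrite mulN1r.
Qed.

Lemma tame_le f g : measurable_fun setT f -> (forall x, `|f x| <= `|g x|) ->
  tame g -> tame f.
Proof.
move=> mf fg [mg [M gM] hg]; split => //.
  by exists M => x; exact: le_trans (gM x).
move=> z z0; apply: (intg_le _ _ (intg_norm (hg z z0))).
  exact: measurable_funM.
by move=> x; rewrite !normrM ler_wpM2r.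
Qed.

Lemma tame_square f : tame f -> intg mu (fun x => f x ^+ 2).
Proof.
move=> tf; have [M fM] := tame_bounded tf.
rewrite (_ : (fun x => _) = (fun x => f x * f x)); last first.
  by apply/funext => x; rewrite expr2.
by apply: intg_mul_bounded fM (tame_intg0 tf); exact: tame_measurable tf.
Qed.

Section OneKernel.
Variables (hat : R -> R) (k : T -> T -> R).
Hypothesis hk : transform_kernel hat k.

Lemma kernel_section x : measurable_fun setT (k x).
Proof. exact: measurable2_section (kernel_meas hk). Qed.

Lemma kernel_intg0 x : intg mu (k x).
Proof.
have := kernel_intg hk x (lexx 0).
by rewrite (_ : (fun y => _) = k x)//; apply/funext => y; rewrite e0 mulr1.
Qed.

Lemma kernel_mass x : Int mu (k x) <= hat 0.
Proof.
have := kernel_le hk x (lexx 0); rewrite e0 mulr1 /kernel_op.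
by rewrite (_ : (fun y => _) = k x)//; apply/funext => y; rewrite e0 mulr1.
Qed.

Lemma kernel_intg_bound z f M x : 0 <= z -> measurable_fun setT f ->
  (forall y, `|f y| <= M * e z y) -> intg mu (fun y => k x y * f y).
Proof.
move=> z0 mf fM; apply: (intg_le _ _ (intgZ M (kernel_intg hk x z0))).
  by apply: measurable_funM => //; exact: kernel_section.
move=> y; rewrite normrM (ger0_norm (kernel_pos hk x y)) mulrCA.
by rewrite ler_wpM2l ?(kernel_pos hk).
Qed.

Lemma kernel_intg_bounded f M x : measurable_fun setT f ->
  (forall y, `|f y| <= M) -> intg mu (fun y => k x y * f y).
Proof.
move=> mf fM; apply: (kernel_intg_bound (z := 0) (M := M)) => // y.
by rewrite e0 mulr1.
Qed.

Lemma op_measurable f : measurable_fun setT f -> measurable_fun setT (kernel_op k f).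
Proof.
move=> mf; apply: measurable_Int; apply: measurable2_mul.
  exact: kernel_meas hk.
exact: measurable2_snd.
Qed.

Lemma op_bounded f M x : measurable_fun setT f -> (forall y, `|f y| <= M) ->
  `|kernel_op k f x| <= M * hat 0.
Proof.
move=> mf fM; have M0 : 0 <= M by exact: le_trans (fM point).
apply: (@le_trans _ _ (M * Int mu (k x))); last by rewrite ler_wpM2l ?kernel_mass.
rewrite -(IntZ M (kernel_intg0 x)); apply: Int_norm_le.
- exact: kernel_intg_bounded fM.
- exact/intgZ/kernel_intg0.
- by move=> y; rewrite normrM (ger0_norm (kernel_pos hk x y)) mulrC ler_wpM2r ?(kernel_pos hk).
Qed.

Lemma kernel_intg2 z f g M : 0 <= z -> measurable_fun setT f ->
  measurable_fun setT g -> (forall x, `|f x| <= M * e z x) ->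
  intg mu (fun x => g x * e z x) ->
  intg2 mu (fun x y => f x * (k x y * g y)).
Proof.
move=> z0 mf mg fM hg; apply: (@intg2_swap _ _ _ _ (fun y x => f x * (k x y * g y))).
apply: (@intg2_bound _ _ _ _ _ (fun y => M * hat z * `|g y * e z y|)).
- apply: measurable2_mul; first exact: measurable2_snd.
  apply: measurable2_mul; last exact: measurable2_fst.
  exact: (measurable2_swap (kernel_meas hk)).
- exact/intgZ/intg_norm.
- move=> y.
  have h1 : intg mu (fun x => g y * (k y x * f x)).
    exact/intgZ/(kernel_intg_bound (M := M) y z0).
  have h2 : intg mu (fun x => M * `|g y| * (k y x * e z x)).
    exact/intgZ/(kernel_intg hk).
  rewrite (_ : integral _ _ _ = (Int mu (fun x => `|g y * (k y x * f x)|))%:E).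
    rewrite lee_fin; apply: le_trans (Int_le (intg_norm h1) h2 _) _.
      move=> x; rewrite !normrM (ger0_norm (kernel_pos hk y x)).
      rewrite mulrCA [leRHS](_ : _ = k y x * (`|g y| * (M * e z x))); last by ring.
      by rewrite ler_wpM2l ?(kernel_pos hk)// ler_wpM2l.
    rewrite (IntZ (M * `|g y|) (kernel_intg hk y z0)).
    rewrite normrM (gtr0_norm (e_gt0 y z0)).
    rewrite [leRHS](_ : _ = M * `|g y| * (hat z * e z y)); last by ring.
    rewrite ler_wpM2l ?(kernel_le hk)// mulr_ge0//.
    by rewrite -(pmulr_lge0 _ (e_gt0 y z0)); exact: le_trans (fM y).
  rewrite -(IntE (intg_norm h1)); apply: eq_integral => x _.
  by congr (`| _ |%:E); rewrite (kernel_sym hk x y); ring.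
Qed.

Lemma op_intg z f g M N : 0 <= z -> measurable_fun setT f ->
  measurable_fun setT g -> (forall x, `|f x| <= M * e z x) ->
  (forall x, `|g x| <= N) -> intg mu (fun x => g x * e z x) ->
  intg mu (fun x => f x * kernel_op k g x).
Proof.
move=> z0 mf mg fM gN hg; have := intg2_Int (kernel_intg2 z0 mf mg fM hg).
rewrite (_ : (fun x => _) = (fun x => f x * kernel_op k g x))//.
by apply/funext => x; rewrite (IntZ (f x) (kernel_intg_bounded x mg gN)).
Qed.

Lemma op_adjoint z f g M N : 0 <= z -> measurable_fun setT f ->
  measurable_fun setT g -> (forall x, `|f x| <= M * e z x) ->
  (forall x, `|g x| <= N) -> intg mu (fun x => g x * e z x) ->
  Int mu (fun x => f x * kernel_op k g x) = Int mu (fun x => kernel_op k f x * g x).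
Proof.
move=> z0 mf mg fM gN hg; have := intg2_Fubini (kernel_intg2 z0 mf mg fM hg).
rewrite (_ : (fun x => Int mu _) = (fun x => f x * kernel_op k g x)); last first.
  by apply/funext => x; rewrite (IntZ (f x) (kernel_intg_bounded x mg gN)).
move=> ->; congr (Int mu _); apply/funext => y.
rewrite mulrC /kernel_op -(IntZ (g y) (kernel_intg_bound y z0 mf fM)).
by congr (Int mu _); apply/funext => x; rewrite (kernel_sym hk x y); ring.
Qed.

Lemma op_tame g : tame g -> tame (kernel_op k g).
Proof.
move=> [mg [N gN] hg]; split.
- exact: op_measurable.
- by exists (N * hat 0) => x; exact: op_bounded.
- move=> z z0; rewrite (_ : (fun x => _) = (fun x => e z x * kernel_op k g x)); last first.
    by apply/funext => x; rewrite mulrC.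
  apply: (op_intg (z := z) (M := 1) (N := N)) => //; last exact: hg.
  by move=> x; rewrite mul1r gtr0_norm// e_gt0.
Qed.

Lemma op_transform g z : tame g -> 0 <= z ->
  Int mu (fun x => kernel_op k g x * e z x) = hat z * Int mu (fun x => g x * e z x).
Proof.
move=> [mg [N gN] hg] z0.
rewrite (_ : (fun x => _) = (fun x => e z x * kernel_op k g x)); last first.
  by apply/funext => x; rewrite mulrC.
rewrite (op_adjoint (z := z) (M := 1) (N := N))//; last 2 first.
- by move=> x; rewrite mul1r gtr0_norm// e_gt0.
- exact: hg.
rewrite -(IntZ (hat z) (hg z z0)); apply: Int_ae.
- by apply: measurable_funM => //; exact: op_measurable.
- by do 2 apply: measurable_funM => //.
- by apply: filterS (kernel_eigen hk z0) => x /= ->; ring.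
Qed.

Lemma op_adjoint_tame f g M : measurable_fun setT f -> (forall x, `|f x| <= M) ->
  tame g -> Int mu (fun x => f x * kernel_op k g x) = Int mu (fun x => kernel_op k f x * g x).
Proof.
move=> mf fM [mg [N gN] hg]; apply: (op_adjoint (z := 0) (M := M) (N := N)) => //.
  by move=> x; rewrite e0 mulr1.
exact: hg.
Qed.

Lemma op_pairing_le f g M : measurable_fun setT f -> (forall x, `|f x| <= M) ->
  tame g -> `|Int mu (fun x => f x * kernel_op k g x)| <= M * hat 0 * Int mu (fun x => `|g x|).
Proof.
move=> mf fM tg; rewrite (op_adjoint_tame mf fM tg).
have hg := tame_intg0 tg; rewrite -(IntZ _ (intg_norm hg)); apply: Int_norm_le.
- by apply: (intg_mul_bounded (M := M * hat 0)) => //; [exact: op_measurable|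
    move=> x; exact: op_bounded].
- exact/intgZ/intg_norm.
- by move=> x; rewrite normrM ler_wpM2r// op_bounded.
Qed.

Lemma op_intg2_square f : measurable_fun setT f -> intg mu (fun x => f x ^+ 2) ->
  intg2 mu (fun x y => k x y * f y ^+ 2).
Proof.
move=> mf hf.
have := @kernel_intg2 0 (fun=> 1) (fun x => f x ^+ 2) 1 (lexx _).
rewrite (_ : (fun x y => 1 * _) = (fun x y => k x y * f y ^+ 2)); last first.
  by apply/funext => x; apply/funext => y; rewrite mul1r.
apply => //.
- exact: measurable_funX.
- by move=> x; rewrite mul1r e0 normr1.
- by under eq_fun do rewrite e0 mulr1.
Qed.

Lemma op_adjoint_square f g M N : measurable_fun setT f -> measurable_fun setT g ->
  (forall x, `|f x| <= M) -> (forall x, `|g x| <= N) ->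
  intg mu (fun x => f x ^+ 2) -> intg mu (fun x => g x ^+ 2) ->
  Int mu (fun x => f x * kernel_op k g x) = Int mu (fun x => kernel_op k f x * g x).
Proof.
move=> mf mg fM gN hf hg.
have h : intg2 mu (fun x y => f x * (k x y * g y)).
  have := intg2D (intg2_swap (op_intg2_square mf hf)) (op_intg2_square mg hg).
  apply: intg2_le.
    apply: measurable2_mul; first exact: measurable2_fst.
    by apply: measurable2_mul; [exact: kernel_meas hk|exact: measurable2_snd].
  move=> x y; rewrite (kernel_sym hk y x) -mulrDr mulrCA.
  rewrite normrM (ger0_norm (kernel_pos hk x y)) ler_wpM2l ?(kernel_pos hk)//.
  exact: norm_mul_le_sqr.
have := intg2_Fubini h.
rewrite (_ : (fun x => Int mu _) = (fun x => f x * kernel_op k g x)); last first.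
  by apply/funext => x; rewrite (IntZ (f x) (kernel_intg_bounded x mg gN)).
move=> ->; congr (Int mu _); apply/funext => y.
rewrite mulrC /kernel_op -(IntZ (g y) (kernel_intg_bounded y mf fM)).
by congr (Int mu _); apply/funext => x; rewrite (kernel_sym hk x y); ring.
Qed.

(** Jensen's inequality, the kernel having mass at most one. *)
Lemma op_square f M : hat 0 = 1 -> measurable_fun setT f ->
  (forall x, `|f x| <= M) -> intg mu (fun x => f x ^+ 2) ->
  intg mu (fun x => kernel_op k f x ^+ 2).
Proof.
move=> hat1 mf fM hf.
have M0 : 0 <= M by exact: le_trans (fM point).
apply: (intg_le _ _ (intg2_Int (op_intg2_square mf hf))).
  by apply: measurable_funX; exact: op_measurable.
move=> x; rewrite ger0_norm ?sqr_ge0//; set c := kernel_op k f x.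
have h1 := kernel_intg_bounded x mf fM.
have h2 : intg mu (fun y => k x y * f y ^+ 2).
  apply: (kernel_intg_bounded (M := M ^+ 2)) => //; first exact: measurable_funX.
  by move=> y; rewrite normrX lerXn2r ?nnegrE.
have : 0 <= Int mu (fun y => k x y * f y ^+ 2 - 2 * c * (k x y * f y) + c ^+ 2 * k x y).
  apply: Int_ge0 => y.
  rewrite (_ : _ + _ = k x y * (f y - c) ^+ 2); last by ring.
  by rewrite mulr_ge0 ?sqr_ge0 ?(kernel_pos hk).
rewrite IntD; [|exact/intgB/intgZ|exact/intgZ/kernel_intg0].
rewrite IntB//; last exact: intgZ.
rewrite !IntZ//; last exact: kernel_intg0.
have := kernel_mass x; rewrite hat1 => m1.
have := ler_wpM2l (sqr_ge0 c) m1.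
by rewrite -/(kernel_op k f x) -/c -[_ * c * c]mulrA -expr2; lra.
Qed.

End OneKernel.

Lemma tame_test_eq0 (E : nat -> set T) f M : measurable_fun setT f ->
  (forall x, `|f x| <= M) ->
  (forall n, measurable (E n)) -> (forall n, tame \1_(E n)) ->
  (forall x, exists n, E n x) ->
  (forall g, tame g -> Int mu (fun x => f x * g x) = 0) ->
  {ae mu, forall x, f x = 0}.
Proof.
move=> mf fM mE tE cE f0.
have fn n : {ae mu, forall x, f x * \1_(E n) x = 0}.
  have tg : tame (fun x => f x * \1_(E n) x).
    have tM := tameZ M (tE n); apply: tame_le tM.
      by apply: measurable_funM => //; exact: tame_measurable (tE n).
    move=> x; rewrite !normrM ler_wpM2r//.
    by apply: le_trans (fM x) _; exact: ler_norm.
  apply: Int_square_eq0.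
  - exact: tame_measurable tg.
  - exact: tame_square tg.
  - rewrite -[RHS](f0 _ tg); congr (Int mu _); apply/funext => x.
    by rewrite indicE; case: (x \in E n); rewrite ?mulr1 ?mulr0 expr2 ?mulr0.
have : {ae mu, forall x, forall n, f x * \1_(E n) x = 0} by exact: ae_foralln.
apply: filterS => x h; have [n En] := cE x.
by have := h n; rewrite indicE mem_set// mulr1.
Qed.

End TransformKernels.

(** * The Jacobi measure as a density *)

Section Density.
Context d (T : measurableType d) (R : realType).
Variables (mu nu : {measure set T -> \bar R}) (g : T -> R).
Hypothesis mg : measurable_fun setT g.
Hypothesis g0 : forall x, 0 <= g x.
Hypothesis nuE : forall B, measurable B -> nu B = (\int[mu]_(x in B) (g x)%:E)%E.

Let density_indic E : measurable E ->
  (\int[nu]_x (\1_E x)%:E = \int[mu]_x ((\1_E x)%:E * (g x)%:E))%E.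
Proof.
move=> mE; rewrite integral_indic// setIT nuE// integral_mkcond.
apply: eq_integral => x _; rewrite patchE indicE.
by case: ifPn => xE; rewrite ?mul1e ?mul0e.
Qed.

Import HBNNSimple.

Let density_nnsfun (f : {nnsfun T >-> R}) :
  (\int[nu]_x (f x)%:E = \int[mu]_x ((f x)%:E * (g x)%:E))%E.
Proof.
under [LHS]eq_integral do rewrite fimfunE -fsumEFin//.
rewrite [LHS]ge0_integral_fsum//; last 2 first.
  - by move=> r; exact/measurable_EFinP/measurableT_comp.
  - by move=> n x _; rewrite EFinM nnfun_muleindic_ge0.
under [RHS]eq_integral.
  move=> x xD; rewrite fimfunE -fsumEFin// muleC ge0_mule_fsumr; last first.
    by move=> r; rewrite EFinM nnfun_muleindic_ge0.
  over.
rewrite [RHS]ge0_integral_fsum//; last 2 first.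
  - move=> r; apply: emeasurable_funM; first exact/measurable_EFinP.
    by apply/measurable_EFinP; do 2 apply/measurableT_comp => //.
  - move=> n x _; rewrite EFinM mule_ge0//; last by rewrite nnfun_muleindic_ge0.
    by rewrite lee_fin.
apply: eq_fsbigr => r rf.
have [r0|r0] := ltP r 0.
  rewrite (_ : f @^-1` [set r] = set0); last first.
    apply/seteqP; split => // x /= fx; have : 0 <= f x by exact: fun_ge0.
    by rewrite fx leNgt r0.
  by rewrite !integral0_eq// => x _; rewrite indic0 !mulr0 ?mule0.
under [RHS]eq_integral do rewrite EFinM muleCA [((g _)%:E * _)%E]muleC.
under [LHS]eq_integral do rewrite EFinM.
rewrite !ge0_integralZl//; try by rewrite lee_fin.
- by rewrite density_indic.
- by apply: emeasurable_funM; apply/measurable_EFinP => //; exact: measurable_indic.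
- by move=> x _; rewrite mule_ge0// lee_fin// indicE.
- exact/measurable_EFinP/measurable_indic.
Qed.

Lemma ge0_integral_density (f : T -> \bar R) :
  measurable_fun setT f -> (forall x, 0 <= f x)%E ->
  (\int[nu]_x f x = \int[mu]_x (f x * (g x)%:E))%E.
Proof.
move=> mf f0.
pose f_ := nnsfun_approx measurableT mf.
have mgE : measurable_fun setT (EFin \o g) by exact/measurable_EFinP.
transitivity (lim (\int[nu]_x (f_ n x)%:E @[n --> \oo])%E).
  rewrite -monotone_convergence//=.
  - apply: eq_integral => ? /[!inE] xD; apply/esym/cvg_lim => //=.
    exact: cvg_nnsfun_approx.
  - by move=> n; exact/measurable_EFinP/measurable_funTS.
  - by move=> n ? _; rewrite lee_fin.
  - by move=> ? _ ? ? mn; rewrite lee_fin; exact/lefP/nd_nnsfun_approx.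
rewrite [RHS](_ : _ = lim (\int[mu]_x ((f_ n x)%:E * (g x)%:E) @[n --> \oo])%E); last first.
  rewrite -monotone_convergence//=.
  - apply: eq_integral => x _; apply/esym/cvg_lim => //.
    apply: cvgeZr => //; exact: cvg_nnsfun_approx.
  - by move=> n; apply: emeasurable_funM => //; exact/measurable_EFinP.
  - by move=> n ? _; rewrite mule_ge0// lee_fin.
  - by move=> x _ ? ? mn; rewrite lee_wpmul2r// lee_fin//; exact/lefP/nd_nnsfun_approx.
by apply: congr_lim; apply/funext => n /=; exact: density_nnsfun.
Qed.

End Density.

Section JacobiMeasure.
Context (R : realType) (alpha beta : R).
Local Notation A := (jacobi_weight alpha beta).
Local Notation mu := (jacobi_measure alpha beta).
Local Notation leb := (@lebesgue_measure R).

Lemma measurable_Rpos : measurable (@Rpos R : set (measurableTypeR R)).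
Proof. exact: measurable_itv. Qed.

Lemma jacobi_measure_sigma_finite : sigma_finite setT mu.
Proof.
pose F n : set (measurableTypeR R) := [set x | A x <= n%:R] `&` `]-oo, n%:R].
exists F.
  apply/seteqP; split => // x _.
  pose n := Num.bound (Num.max (A x) x).
  have : Num.max (A x) x <= n%:R by rewrite ltW// (le_lt_trans _ (archi_boundP _))//
    le_max jacobi_weight_ge0.
  rewrite ge_max => /andP[h1 h2].
  by exists n => //; split => //=; rewrite in_itv.
move=> n; have mF : measurable (F n).
  apply: measurableI; last exact: measurable_itv.
  rewrite (_ : [set x | _] = A @^-1` `]-oo, n%:R]); last first.
    by apply/seteqP; split => x /=; rewrite in_itv.
  by rewrite -[X in measurable X]setTI; apply: measurable_jacobi_weight => //; exact: measurable_itv.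
split => //; rewrite /jacobi_measure.
have mFR : measurable (F n `&` @Rpos R) by apply: measurableI => //; exact: measurable_Rpos.
apply: (@le_lt_trans _ _ (\int[leb]_(x in F n `&` @Rpos R) (n%:R)%:E)%E).
  apply: ge0_le_integral => //.
  - by move=> x _; rewrite lee_fin jacobi_weight_ge0.
  - by apply/measurable_EFinP; apply: measurable_funTS; exact: measurable_jacobi_weight.
  - by move=> x [[/= Ax _] _]; rewrite lee_fin.
rewrite integral_cst//; apply: (@le_lt_trans _ _ (n%:R%:E * leb `[0%R, n%:R])%E).
  apply: lee_wpmul2l; first by rewrite lee_fin.
  apply: le_measure; rewrite ?inE//.
  move=> x [[_ /= xn] x0]; move: xn x0.
  by rewrite /Rpos /= !in_itv/= andbT => -> /ltW ->.
rewrite lebesgue_measure_itv /=; case: ifPn => _; rewrite ?mule0 ?ltry//.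
Qed.

HB.instance Definition _ := Measure_isSigmaFinite.Build _ _ _ mu
  jacobi_measure_sigma_finite.

Definition jacobi_density : R -> R := A \_ (@Rpos R).

Lemma jacobi_density_ge0 x : 0 <= jacobi_density x.
Proof. by rewrite /jacobi_density patchE; case: ifPn => // _; exact: jacobi_weight_ge0. Qed.

Lemma jacobi_density_measurable :
  measurable_fun setT (jacobi_density : measurableTypeR R -> R).
Proof.
apply/(measurable_restrictT _ measurable_Rpos); apply: measurable_funTS.
exact: measurable_jacobi_weight.
Qed.

Lemma jacobi_measureE (B : set (measurableTypeR R)) : measurable B ->
  mu B = (\int[leb]_(x in B) (jacobi_density x)%:E)%E.
Proof.
move=> mB; rewrite /jacobi_measure integral_mkcondr; apply: eq_integral => x _.
by rewrite /jacobi_density !patchE; case: ifPn.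
Qed.

Lemma jacobi_integralE (f : R -> \bar R) :
  measurable_fun setT (f : measurableTypeR R -> \bar R) -> (forall x, 0 <= f x)%E ->
  (\int[mu]_x f x = \int[leb]_(x in `]0%R, +oo[) (f x * (A x)%:E))%E.
Proof.
move=> mf f0.
rewrite (ge0_integral_density jacobi_density_measurable jacobi_density_ge0 jacobi_measureE)//.
rewrite [RHS]integral_mkcond; apply: eq_integral => x _.
rewrite /jacobi_density !patchE /Rpos; case: ifPn => _ //.
by rewrite mule0.
Qed.

Lemma jacobi_ae_Rpos : {ae mu, forall x, 0 < x}.
Proof.
exists [set` `]-oo, 0%R]]; split; first exact: measurable_itv.
  rewrite /jacobi_measure (_ : _ `&` _ = set0) ?integral_set0//.
  apply/seteqP; split => // x []; rewrite /Rpos /= !in_itv /= andbT => x0.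
  by rewrite ltNge x0.
by move=> x /= /negP; rewrite -leNgt in_itv.
Qed.

End JacobiMeasure.

Section ImproperFTC.
Context {R : realType}.
Local Notation leb := (@lebesgue_measure R).
Implicit Types (f F : R -> R) (a l w x : R).

Lemma ge0_FTC2_right_lim f F w l : 0 < w ->
  (forall x, 0 < x -> is_derive x 1 F (f x)) ->
  (forall x, 0 < x -> {for x, continuous f}) ->
  (forall x, 0 < x -> x <= w -> 0 <= f x) ->
  F x @[x --> 0^'+] --> l ->
  (\int[leb]_(x in `]0%R, w]) (f x)%:E = (F w - l)%:E)%E.
Proof.
move=> w0 dF cf f0 Fl.
pose S n : set (measurableTypeR R) := [set` `[w / n.+1%:R, w]].
have S0 n : 0 < w / n.+1%:R by rewrite divr_gt0.
have US : \bigcup_n S n = [set` `]0%R, w]].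
  apply/seteqP; split => [x [n _]|x]; rewrite /S /= !in_itv /=.
    by move=> /andP[nx ->]; rewrite andbT (lt_le_trans _ nx).
  move=> /andP[x0 xw]; pose n := Num.bound (w / x).
  exists n => //=; rewrite in_itv /= xw andbT.
  rewrite ler_pdivrMr// mulrC -ler_pdivrMr//.
  have h : 0 <= w / x by rewrite divr_ge0 ?ltW.
  by rewrite ltW// (lt_le_trans (archi_boundP h))// ler_nat.
have cS n : {within S n, continuous f}.
  apply: continuous_in_subspaceT => x; rewrite inE /S /= in_itv /= => /andP[nx _].
  by apply: cf; exact: lt_le_trans nx.
have lim1 : (\int[leb]_(x in S n) (f x)%:E @[n --> \oo] -->
             \int[leb]_(x in `]0%R, w]) (f x)%:E)%E.
  rewrite -US; apply: ge0_nondecreasing_set_cvg_integral.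
  - move=> m n mn; rewrite subsetEset => x /=; rewrite /S /= !in_itv /=.
    move=> /andP[mx ->]; rewrite andbT (le_trans _ mx)// ler_wpM2l ?(ltW w0)//.
    by rewrite lef_pV2 ?posrE// ler_nat.
  - by move=> n; exact: measurable_itv.
  - move=> n; apply/measurable_EFinP; apply: subspace_continuous_measurable_fun => //.
    exact: measurable_itv.
  - move=> n x; rewrite /S /= in_itv /= => /andP[nx xw].
    by rewrite lee_fin f0// (lt_le_trans _ nx).
have lim2 : (\int[leb]_(x in S n) (f x)%:E @[n --> \oo] --> (F w - l)%:E)%E.
  have E n : (\int[leb]_(x in S n) (f x)%:E = (F w - F (w / n.+1%:R))%:E)%E.
    have := S0 n; have : w / n.+1%:R <= w by rewrite ler_pdivrMr// ler_peMr ?ler1n// ltW.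
    rewrite le_eqVlt => /predU1P[nw|nw] n0.
      rewrite nw subrr (integral_Sset1 w)// => x.
      by rewrite /S /= in_itv /= nw => /le_anti ->.
    rewrite (@continuous_FTC2 _ f F)//.
    - exact: cS.
    - have dF' x : 0 < x -> derivable F x 1 by move=> x0; have := dF x x0.
      have cF x : 0 < x -> {for x, continuous F}.
        by move=> x0; exact: is_derive_continuous (dF x x0).
      split.
      + by move=> x; rewrite in_itv /= => /andP[nx _]; exact/dF'/(lt_trans _ nx).
      + exact/cvg_at_right_filter/cF.
      + exact/cvg_at_left_filter/cF.
    - move=> x; rewrite in_itv /= => /andP[nx _]; rewrite derive1E.
      by have [_] := dF x (lt_trans n0 nx).
  rewrite (_ : (fun n => _) = (fun n => (F w - F (w / n.+1%:R))%:E)); last exact/funext.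
  apply: cvg_EFin; first exact: nearW.
  apply: cvgB; first exact: cvg_cst.
  have /cvg_comp : (fun n => w / n.+1%:R) n @[n --> \oo] --> 0^'+.
    move=> P /= [e /= e0 Pe].
    have wn : w / n.+1%:R @[n --> \oo] --> (0 : R).
      rewrite -[X in _ --> X](mulr0 w); apply: cvgM; first exact: cvg_cst.
      exact: cvg_harmonic.
    have /cvgr_dist_lt /(_ e e0) near_e := wn.
    suff : \forall n \near \oo, P (w / n.+1%:R) by [].
    near=> n; apply: Pe => /=; last exact: S0.
    by near: n; exact: near_e.
  by apply.
exact: cvg_unique lim1 lim2.
Unshelve. all: by end_near. Qed.

Lemma integrable_exp_decay a c : 0 < c ->
  leb.-integrable `[a, +oo[ (EFin \o (fun x : R => expR (- c * x))).
Proof.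
move=> c0; apply/integrableP; split.
  apply/measurable_EFinP; apply: measurable_funTS.
  apply: continuous_measurable_fun => x.
  exact: is_derive_continuous (is_derive_exp_lin _ _).
rewrite (_ : integral _ _ _ = (\int[leb]_(x in `[a, +oo[) (expR (- c * x))%:E)%E); last first.
  by apply: eq_integral => x _ /=; rewrite ger0_norm ?expR_ge0.
have dF x : is_derive x 1 (fun x => - c^-1 * expR (- c * x)) (expR (- c * x)).
  have := is_derive_scale (- c^-1) (is_derive_exp_lin (- c) x).
  by move/is_derive_eq; apply; field; rewrite gt_eqF.
rewrite (@ge0_continuous_FTC2y _ _ (fun x => - c^-1 * expR (- c * x)) _ 0) ?ltry//.
- have ce : continuous (fun x : R => expR (- c * x)).
    by move=> x; exact: is_derive_continuous (is_derive_exp_lin _ _).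
  exact: continuous_subspaceT ce.
- rewrite -[X in _ --> X](mulr0 (- c^-1)); apply: cvgM; first exact: cvg_cst.
  under eq_fun do rewrite mulNr.
  have cy : (fun x : R => c * x) x @[x --> +oo] --> +oo.
    by apply: gt0_cvgMry => //; exact: cvg_id.
  exact: (cvg_comp _ _ cy (@cvgr_expR R)).
- by apply: cvg_at_right_filter; exact: is_derive_continuous (dF a).
- by move=> x _; rewrite derive1E; have [_] := dF x.
Qed.

End ImproperFTC.

(** * The Green kernel of the Jacobi operator *)

Section GreenPrimitive.
Context {R : realType}.
Variables (alpha beta : R).
Hypotheses (hbeta : - 2^-1 <= beta) (hab : beta <= alpha)
  (halpha : - 2^-1 < alpha).
Local Notation leb := (@lebesgue_measure R).
Local Notation A := (jacobi_weight alpha beta).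
Local Notation a := (jacobi_log_weight alpha beta).
Local Notation rho := (jacobi_rho alpha beta).
Implicit Types (x y z w s c M : R).

Let wA : sturm_weight rho A a := jacobi_sturm_weight hbeta hab halpha.

Lemma jacobi_weight_gt0 x : 0 < x -> 0 < A x.
Proof. exact: weight_gt0 wA x. Qed.

Lemma jacobi_rho_gt0 : 0 < rho.
Proof. exact: weight_rho_gt0 wA. Qed.

Lemma jacobi_weight_continuous x : 0 < x -> {for x, continuous A}.
Proof. by move=> x0; exact: is_derive_continuous (weight_derive wA x0). Qed.

Lemma jacobi_weightV_continuous x : 0 < x -> {for x, continuous (fun x => (A x)^-1)}.
Proof.
move=> x0; apply: cvgV; last exact: jacobi_weight_continuous.
by rewrite gt_eqF// jacobi_weight_gt0.
Qed.

Lemma jacobi_weightV_measurable (D : set (measurableTypeR R)) :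
  measurable_fun D (fun x : measurableTypeR R => (A x)^-1).
Proof.
apply: measurable_funTS; rewrite (_ : (fun x => _) = (fun x => A x `^ (-1))).
  by apply: (measurableT_comp (measurable_powR _)); exact: measurable_jacobi_weight.
by apply/funext => x; rewrite powR_inv1// jacobi_weight_ge0.
Qed.

Lemma jacobi_weightV_integrable c : 0 < c ->
  leb.-integrable `[c, +oo[ (EFin \o (fun x => (A x)^-1)).
Proof.
move=> c0; have r0 : 0 < 2 * rho by rewrite mulr_gt0 ?jacobi_rho_gt0.
pose K := expR (2 * rho * c) / A c.
have mI : measurable ([set` `[c, +oo[] : set (measurableTypeR R)).
  exact: measurable_itv.
have := integrableZl mI K (@integrable_exp_decay R c _ r0).
apply: le_integrable => //.
  by apply/measurable_EFinP; exact: jacobi_weightV_measurable.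
move=> x /=; rewrite in_itv /= andbT => cx.
have Ac := jacobi_weight_gt0 c0; have Ax := jacobi_weight_gt0 (lt_le_trans c0 cx).
have K0 : 0 <= K := divr_ge0 (expR_ge0 _) (ltW Ac).
rewrite lee_fin ger0_norm ?invr_ge0 ?(ltW Ax)// ger0_norm; last first.
  by rewrite mulr_ge0 ?expR_ge0.
rewrite -div1r ler_pdivrMr// /K.
have := weight_exp_growth wA c0 cx.
rewrite -(ler_pM2l (x := K * expR (- (2 * rho) * x))); last first.
  exact: (mulr_gt0 (divr_gt0 (expR_gt0 _) Ac) (expR_gt0 _)).
apply: le_trans; rewrite le_eqVlt; apply/orP; left; apply/eqP.
transitivity (expR (2 * rho * c) * expR (- (2 * rho) * x) * expR (2 * rho * (x - c))).
  by rewrite -!expRD -[LHS]expR0; congr expR; ring.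
by move: (lt0r_neq0 Ac); rewrite /K; move: (A c) => u u0; field.
Qed.

(** A primitive of 1 / A on the half-line; b w - b y, for y < w, is the Green
    function of the Sturm-Liouville operator. *)
Definition green_primitive x : R :=
  - Rintegral leb `]x, +oo[ (fun t => (A t)^-1).
Local Notation b := green_primitive.

Lemma green_primitive_derive x : 0 < x -> is_derive x 1 b (A x)^-1.
Proof.
move=> x0; pose c := x / 2; pose I y := Rintegral leb `[c, y] (fun t => (A t)^-1).
have c0 : 0 < c by rewrite divr_gt0.
have cx : c < x by rewrite /c; lra.
pose K := Rintegral leb `[c, +oo[ (fun t => (A t)^-1).
have bI y : c < y -> I y - K = b y.
  move=> cy; rewrite /b -(Rintegral_itvB (jacobi_weightV_integrable c0)) ?bnd_simp ?(ltW cy)//.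
  by rewrite opprB.
have h : is_derive x 1 (fun y => I y - K) (A x)^-1.
  rewrite -[X in is_derive _ _ _ X]subr0.
  apply: is_derive_sub.
  have xu : x < x + 1 by rewrite ltrDl.
  have iu : leb.-integrable `[c, x + 1] (EFin \o (fun x => (A x)^-1)).
    have m1 : measurable ([set` `[c, +oo[] : set (measurableTypeR R)).
      exact: measurable_itv.
    have m2 : measurable ([set` `[c, x + 1]] : set (measurableTypeR R)).
      exact: measurable_itv.
    apply: (integrableS m1 m2 _ (jacobi_weightV_integrable c0)).
    by apply: subset_itvl; rewrite bnd_simp.
  have [d1 d2] := continuous_FTC1_closed xu iu cx (jacobi_weightV_continuous x0).
  by rewrite -d2 derive1E; exact: derivableP.
apply: near_eq_is_derive h.
near=> y; rewrite bI//; near: y; exact: lt_nbhsr.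
Unshelve. all: by end_near. Qed.

End GreenPrimitive.

Section GreenKernel.
Context {R : realType}.
Variables (alpha beta : R).
Hypotheses (hbeta : - 2^-1 <= beta) (hab : beta <= alpha)
  (halpha : - 2^-1 < alpha).
Variable phi : R[i] -> R -> R[i].
Hypothesis hphi : is_jacobi_function alpha beta phi.
Local Notation leb := (@lebesgue_measure R).
Local Notation A := (jacobi_weight alpha beta).
Local Notation a := (jacobi_log_weight alpha beta).
Local Notation rho := (jacobi_rho alpha beta).
Local Notation mu := (jacobi_measure alpha beta).
Local Notation b := (green_primitive alpha beta).
Implicit Types (x y z w s c M : R).

Let wA : sturm_weight rho A a := jacobi_sturm_weight hbeta hab halpha.

(** The Jacobi function of spectral parameter -z <= 0; for z > 0 it grows
    exponentially. *)
Definition jexp z : R -> R := real_jacobi alpha beta phi (- z).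

Lemma jexp_solution z : 0 <= z ->
  regular_solution a (- z) 1 (jexp z) (jexp z)^`()%classic.
Proof.
move=> z0; apply: real_jacobi_solution hphi _ _.
by rewrite (@le_trans _ _ 0)// ?oppr_le0// sqr_ge0.
Qed.

Lemma jexp_measurable z : measurable_fun setT (jexp z : measurableTypeR R -> R).
Proof. by apply: continuous_measurable_fun; exact: real_jacobi_continuous hphi _. Qed.

Lemma jexp_even_ind (P : R -> Prop) z : P 1 -> (forall x, 0 < x -> P (jexp z x)) ->
  forall x, P (jexp z x).
Proof.
move=> P1 Pp x; have [x0|x0|->] := ltgtP x 0.
- by rewrite /jexp -(real_jacobi_even hphi); apply: Pp; rewrite oppr_gt0.
- exact: Pp.
- by rewrite /jexp (real_jacobi0 hphi).
Qed.

Lemma jexp_ge1 z x : 0 <= z -> 1 <= jexp z x.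
Proof.
move=> z0; move: x; apply: (@jexp_even_ind (fun v => 1 <= v)) => // x x0.
apply: (solution_comparison wA (w := fun=> 1) (dw := fun=> 0) (ddw := fun=> 0)
  (jexp_solution z0) (l := 1) (d := 0)) => //.
- by rewrite ltr01 lexx.
- exact: cvg_cst.
- exact: cvg_cst.
- by move=> t _; rewrite mulr0 !add0r mulr1 oppr_le0.
Qed.

Lemma jexp0 x : jexp 0 x = 1.
Proof.
move: x; apply: (@jexp_even_ind (fun v => v = 1)) => // x x0.
have s1 := jexp_solution (lexx 0).
have s2 : regular_solution a (- 0) 0 (fun x => jexp 0 x - 1) (jexp 0)^`()%classic.
  split.
  - move=> t t0; rewrite -[X in is_derive _ _ _ X]subr0.
    by apply: is_derive_sub; exact: solution_derive s1 _ t0.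
  - move=> t t0; have := solution_derive2 s1 t0.
    by move/is_derive_eq; apply; ring.
  - rewrite -[X in _ --> X](subrr 1); apply: cvgB; last exact: cvg_cst.
    exact: solution_lim0 s1.
  - exact: solution_derive_lim0 s1.
by have /eqP := solution_unique0 wA s2 x0; rewrite subr_eq0 => /eqP.
Qed.

Lemma jexp_le z z' x : 0 <= z -> z <= z' -> jexp z x <= jexp z' x.
Proof.
move=> z0 zz'; have z'0 := le_trans z0 zz'.
suff h t : 0 < t -> jexp z t <= jexp z' t.
  have [x0|x0|->] := ltgtP x 0.
  - rewrite /jexp -(real_jacobi_even hphi) -[leRHS](real_jacobi_even hphi).
    by apply: h; rewrite oppr_gt0.
  - exact: h.
  - by rewrite /jexp !(real_jacobi0 hphi).
have s := jexp_solution z0.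
apply: (solution_comparison wA (w := jexp z) (jexp_solution z'0) (l := 1) (d := 0)).
- by rewrite ltr01 lexx.
- by move=> u _; exact: lt_le_trans (jexp_ge1 u z0).
- exact: solution_derive s.
- exact: solution_derive2 s.
- exact: solution_lim0 s.
- exact: solution_derive_lim0 s.
- move=> u u0; rewrite [X in X <= 0](_ : _ = - ((z' - z) * jexp z u)); last by ring.
  rewrite oppr_le0 mulr_ge0 ?subr_ge0//.
  exact: le_trans (jexp_ge1 u z0).
Qed.

Lemma green_primitive_le y w : 0 < y -> y <= w -> b y <= b w.
Proof.
move=> y0 yw; apply: (@is_derive_ge0_le _ b (fun x => (A x)^-1)) => //.
  move=> x /andP[yx _]; apply: green_primitive_derive => //.
  exact: lt_le_trans yx.
move=> x /andP[yx _]; rewrite invr_ge0 jacobi_weight_ge0//.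
Qed.

Lemma green_primitive_le0 y : b y <= 0.
Proof.
rewrite oppr_le0; apply: Rintegral_ge0 => x _.
by rewrite invr_ge0 jacobi_weight_ge0.
Qed.

(** Differentiate in w, and use that A is nondecreasing. *)
Lemma green_primitive_weight y w : 0 < y -> y <= w -> (b w - b y) * A y <= w.
Proof.
move=> y0 yw.
have : 0 - A y * b y <= (w - y) - A y * b w.
  rewrite -(subrr y).
  apply: (@is_derive_ge0_le _ (fun s => (s - y) - A y * b s)
    (fun s => (1 - 0) - A y * (A s)^-1) _ _ yw) => [s /andP[ys _]|s /andP[ys _]].
    have s0 := lt_le_trans y0 ys.
    exact (is_derive_sub (is_derive_sub (is_derive_id s 1) (is_derive_cst y s 1))
      (is_derive_scale (A y) (green_primitive_derive hbeta hab halpha s0))).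
  have As := weight_gt0 wA (lt_le_trans y0 ys).
  rewrite subr0 subr_ge0 (ler_pdivrMr _ _ As) mul1r.
  exact (weight_nondecreasing wA y0 ys).
by lra.
Qed.

Definition green y w : R := if (0 < y) && (y < w) then b w - b y else 0.

Lemma green_ge0 y w : 0 <= green y w.
Proof.
rewrite /green; case: ifPn => // /andP[y0 yw].
by rewrite subr_ge0 green_primitive_le// ltW.
Qed.

Lemma green_measurable :
  @measurable2 _ (measurableTypeR R) R green.
Proof.
pose b' : measurableTypeR R -> R := b \_ (@Rpos R).
have mb' : measurable_fun setT b'.
  apply/(measurable_restrictT _ (@measurable_Rpos R)).
  apply: open_continuous_measurable_fun; first exact: interval_open.
  move=> x; rewrite inE /Rpos /= in_itv /= andbT => x0.
  exact: is_derive_continuous (green_primitive_derive hbeta hab halpha x0).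
have E : (fun u : measurableTypeR R * measurableTypeR R => green u.1 u.2) =
    (fun u => if (0 < u.1) && (u.1 < u.2) then b' u.2 - b' u.1 else 0).
  apply/funext => -[y w] /=; rewrite /green /b'; case: ifPn => // /andP[y0 yw].
  by rewrite !patchE !mem_set//= /Rpos /= in_itv /= ?y0// andbT (lt_trans y0).
rewrite /measurable2 E.
have m1 : measurable_fun setT (fst : measurableTypeR R * measurableTypeR R -> measurableTypeR R).
  exact: measurable_fst.
have m2 : measurable_fun setT (snd : measurableTypeR R * measurableTypeR R -> measurableTypeR R).
  exact: measurable_snd.
apply: measurable_fun_if => //.
- apply: measurable_and.
    by apply: measurable_fun_ltr.
  by apply: measurable_fun_ltr.
- apply: measurable_funTS; apply: measurable_funB.
    exact: (measurableT_comp mb' m2).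
  exact: (measurableT_comp mb' m1).
Qed.

Lemma green_le0 y w : w <= 0 -> green y w = 0.
Proof.
move=> w0; rewrite /green; case: ifPn => // /andP[y0 yw].
by have := lt_le_trans (lt_trans y0 yw) w0; rewrite ltxx.
Qed.

(** The integrand, times the weight, is the derivative of
    ((b w - b y) A y e_z'(y) + e_z(y)) / z. *)
Lemma green_jexp z w : 0 < z -> 0 < w ->
  intg mu (fun y => green y w * jexp z y) /\
  Int mu (fun y => green y w * jexp z y) = (jexp z w - 1) / z.
Proof.
move=> z0 w0; have s := jexp_solution (ltW z0).
have e1 y := jexp_ge1 y (ltW z0).
have mG : measurable_fun setT ((fun y => green y w * jexp z y) : measurableTypeR R -> R).
  apply: measurable_funM; last exact: jexp_measurable.
  exact: (measurable2_section w (measurable2_swap green_measurable)).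
have g0 y : 0 <= green y w * jexp z y.
  by rewrite mulr_ge0 ?green_ge0// (le_trans _ (e1 y)).
have E : (\int[mu]_y (green y w * jexp z y)%:E = ((jexp z w - 1) / z)%:E)%E.
  rewrite jacobi_integralE//; last exact/measurable_EFinP.
  pose f y := (b w - b y) * (A y * jexp z y).
  transitivity (\int[leb]_(y in `]0%R, w]) (f y)%:E)%E.
    rewrite [LHS]integral_mkcond [RHS]integral_mkcond; apply: eq_integral => y _.
    rewrite !patchE; case: ifPn => [|hy].
      rewrite inE /= in_itv /= andbT => y0; case: ifPn.
        rewrite inE /= in_itv /= y0 /= le_eqVlt => /predU1P[->|yw].
          by rewrite /green ltxx andbF mul0r mul0e /f subrr mul0r.
        by rewrite /green y0 yw /= -EFinM; congr EFin; rewrite /f; ring.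
      move=> /negP; rewrite inE /= in_itv /= y0 /= => /negP; rewrite -ltNge => wy.
      by rewrite /green (lt_gtF wy) andbF mul0r mul0e.
    rewrite ifN//; apply: contra hy; rewrite !inE /= !in_itv /= andbT.
    by move=> /andP[].
  pose F y := ((b w - b y) * (A y * (jexp z)^`()%classic y) + jexp z y) / z.
  transitivity ((F w - 1 / z)%:E); last first.
    by congr EFin; rewrite /F subrr mul0r add0r mulrBl.
  apply: ge0_FTC2_right_lim => //.
  - move=> x x0; have dA := weight_derive wA x0.
    have d1 := solution_derive s x0; have d2 := solution_derive2 s x0.
    have db := green_primitive_derive hbeta hab halpha x0.
    have := is_derive_scale z^-1 (is_derive_add (is_derive_mul (is_derive_sub
      (is_derive_cst (b w) x 1) db) (is_derive_mul dA d2)) d1).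
    rewrite (_ : (fun y => z^-1 * _) = F); last by apply/funext => y; rewrite /F mulrC.
    move/is_derive_eq; apply; rewrite /f.
    have Ax := weight_gt0 wA x0.
    by field; rewrite !gt_eqF.
  - move=> x x0; apply: cvgM.
      apply: cvgB; first exact: cvg_cst.
      exact: is_derive_continuous (green_primitive_derive hbeta hab halpha x0).
    apply: cvgM; first exact: is_derive_continuous (weight_derive wA x0).
    exact: is_derive_continuous (solution_derive s x0).
  - move=> x x0 xw; rewrite mulr_ge0 ?subr_ge0 ?green_primitive_le//.
    by rewrite mulr_ge0 ?jacobi_weight_ge0// (le_trans _ (e1 x)).
  - rewrite /F -[X in _ --> X / z]add0r; apply: cvgM; last exact: cvg_cst.
    apply: cvgD; last exact: solution_lim0 s.
    have p0 := solution_derive_lim0 s.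
    have wp : w * `|(jexp z)^`()%classic y| @[y --> 0^'+] --> 0.
      rewrite -[X in _ --> X](mulr0 w); apply: cvgM; first exact: cvg_cst.
      by rewrite -[X in _ --> X](normr0 R); apply: cvg_norm.
    apply/norm_cvg0P; apply: (squeeze_cvgr _ (cvg_cst 0) wp).
    near=> y; rewrite normr_ge0/= mulrA normrM ler_wpM2r//.
    have y0 : 0 < y by near: y; exact: nbhs_right_gt.
    have yw : y <= w by near: y; exact: nbhs_right_le.
    rewrite ger0_norm; first exact: green_primitive_weight.
    by rewrite mulr_ge0 ?jacobi_weight_ge0// subr_ge0 green_primitive_le.
have [h1 _] : intg mu (fun y => green y w * jexp z y) /\
   Int mu (fun y => green y w * jexp z y) <= (jexp z w - 1) / z.
  by apply: intg_ge0P => //; rewrite E.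
split => //; apply/eqP; rewrite -eqe -IntE//; apply/eqP.
exact: E.
Unshelve. all: by end_near. Qed.

(** Since e_z - 1 = z I e_z, this is the monotonicity of e_z in z. *)
Lemma jexp_convex z x : 0 <= z <= 1 -> jexp z x - 1 <= z * (jexp 1 x - 1).
Proof.
move=> /andP[z0 z1]; move: z0; rewrite le_eqVlt => /predU1P[<-|z0].
  by rewrite jexp0 subrr mul0r.
suff h t : 0 < t -> jexp z t - 1 <= z * (jexp 1 t - 1).
  have [x0|x0|->] := ltgtP x 0.
  - rewrite /jexp -(real_jacobi_even hphi) -[X in _ <= _ * (X - 1)](real_jacobi_even hphi).
    by apply: h; rewrite oppr_gt0.
  - exact: h.
  - by rewrite /jexp !(real_jacobi0 hphi) subrr mulr0.
move=> t0; have [i1 E1] := green_jexp z0 t0; have [i2 E2] := green_jexp ltr01 t0.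
rewrite -[jexp 1 t - 1]divr1 -E2 mulrC -ler_pdivrMr// -E1.
apply: Int_le => // y; rewrite ler_wpM2l ?green_ge0//.
by rewrite jexp_le ?(ltW z0).
Qed.

End GreenKernel.

(** * The Green operator and its transpose *)

Section GreenOperator.
Context {R : realType}.
Variables (alpha beta : R).
Hypotheses (hbeta : - 2^-1 <= beta) (hab : beta <= alpha)
  (halpha : - 2^-1 < alpha).
Variable phi : R[i] -> R -> R[i].
Hypothesis hphi : is_jacobi_function alpha beta phi.
Local Notation mu := (jacobi_measure alpha beta).
Local Notation b := (green_primitive alpha beta).
Local Notation T := (measurableTypeR R).
Local Notation e := (jexp alpha beta phi).
Local Notation G := (green alpha beta).
Implicit Types (x y z w c M : R) (f g k nu : T -> R).

Let e_ge1 z x : 0 <= z -> 1 <= e z x. Proof. exact: jexp_ge1. Qed.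
Let me z : measurable_fun setT (e z : T -> R). Proof. exact: jexp_measurable. Qed.
Let e0 x : e 0 x = 1. Proof. exact: jexp0. Qed.
Let mG : @measurable2 _ T R G. Proof. exact: green_measurable. Qed.

Definition green_op : (T -> R) -> T -> R := kernel_op mu G.
Definition green_opT : (T -> R) -> T -> R := kernel_op mu (fun w y => G y w).
Local Notation J := green_op.
Local Notation I := green_opT.

Definition superexp k : Prop := measurable_fun setT k /\
  forall z, 0 <= z -> intg mu (fun x => k x * e z x).

Lemma tame_superexp k : tame mu e k -> superexp k.
Proof. by case. Qed.

Lemma superexp_intg k : superexp k -> intg mu k.
Proof.
move=> [_ /(_ 0 (lexx _))]; rewrite (_ : (fun x => _) = k)//.
by apply/funext => x; rewrite e0 mulr1.
Qed.

Lemma superexp_norm k : superexp k -> superexp (fun x => `|k x|).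
Proof.
move=> [mk hk]; split; first exact: measurableT_comp.
move=> z z0; rewrite (_ : (fun x => _) = (fun x => `|k x * e z x|)).
  exact/intg_norm/hk.
by apply/funext => x; rewrite normrM (ger0_norm (le_trans ler01 (e_ge1 x z0))).
Qed.

Lemma green_section_le y w : 0 <= G y w <= `|b y|.
Proof.
rewrite green_ge0//= /green; case: ifPn => // /andP[y0 yw].
rewrite ler0_norm; last exact: green_primitive_le0.
by have := @green_primitive_le0 R alpha beta w; lra.
Qed.

Lemma green_section_intg k y : intg mu k -> intg mu (fun w => G y w * k w).
Proof.
move=> hk; apply: (intg_mul_bounded (M := `|b y|)) => //.
  exact: measurable2_section.
by move=> w; have /andP[h1 h2] := green_section_le y w; rewrite ger0_norm.
Qed.

Lemma greenT_jexp_le z w : 0 < z ->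
  intg mu (fun y => G y w * e z y) /\ I (e z) w <= (e z w - 1) / z.
Proof.
move=> z0; have [w0|w0] := ltP 0 w.
  have [h1 h2] := green_jexp hbeta hab halpha hphi z0 w0.
  by split => //; rewrite /I /kernel_op h2.
have E : (fun y => G y w * e z y) = (fun=> 0).
  by apply/funext => y; rewrite green_le0// mul0r.
rewrite /I /kernel_op E Int0; split; first exact: intg0.
by rewrite divr_ge0 ?(ltW z0)// subr_ge0 e_ge1// ltW.
Qed.

Lemma greenT_section_intg z g w M : 0 < z -> measurable_fun setT g ->
  (forall x, `|g x| <= M * e z x) -> intg mu (fun y => G y w * g y).
Proof.
move=> z0 mg gM; have [h1 _] := greenT_jexp_le w z0.
apply: (intg_le _ _ (intgZ M h1)).
  apply: measurable_funM => //; exact: (measurable2_section w (measurable2_swap mG)).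
move=> y; have /andP[G0 _] := green_section_le y w.
by rewrite normrM (ger0_norm G0) mulrCA ler_wpM2l.
Qed.

Lemma green_intg2 z k g M : 0 < z -> measurable_fun setT g ->
  (forall x, `|g x| <= M * e z x) -> superexp k ->
  intg2 mu (fun y w => g y * (G y w * k w)).
Proof.
move=> z0 mg gM [mk hk].
apply: (@intg2_swap _ T R mu (fun w y => g y * (G y w * k w))).
have M0 : 0 <= M.
  have := le_trans (normr_ge0 _) (gM 0); rewrite pmulr_lge0//.
  by rewrite (lt_le_trans _ (e_ge1 0 (ltW z0))).
apply: (@intg2_bound _ T R mu _ (fun w => M / z * `|k w * e z w|)).
- apply: measurable2_mul; first exact: measurable2_snd.
  apply: measurable2_mul; last exact: measurable2_fst.
  exact: (measurable2_swap mG).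
- exact/intgZ/intg_norm/(hk _ (ltW z0)).
- move=> w; have [h1 h2] := greenT_jexp_le w z0.
  have hg : intg mu (fun y => k w * (G y w * g y)).
    exact/intgZ/(greenT_section_intg w z0 mg gM).
  have hG : intg mu (fun y => M * `|k w| * (G y w * e z y)) by exact: intgZ.
  rewrite (_ : integral _ _ _ = (Int mu (fun y => `|k w * (G y w * g y)|))%:E).
    rewrite lee_fin; apply: le_trans (Int_le (intg_norm hg) hG _) _.
      move=> y; have /andP[G0 _] := green_section_le y w.
      rewrite !normrM (ger0_norm G0).
      rewrite [leLHS](_ : _ = G y w * (`|k w| * `|g y|)); last by ring.
      rewrite [leRHS](_ : _ = G y w * (`|k w| * (M * e z y))); last by ring.
      by rewrite ler_wpM2l// ler_wpM2l.
    rewrite (IntZ (M * `|k w|) h1).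
    rewrite normrM (ger0_norm (le_trans ler01 (e_ge1 w (ltW z0)))).
    rewrite [leRHS](_ : _ = M * `|k w| * (e z w / z)); last by field; rewrite gt_eqF.
    rewrite ler_wpM2l ?mulr_ge0//; apply: le_trans h2 _.
    by rewrite ler_pM2r ?invr_gt0//; lra.
  rewrite -(IntE (intg_norm hg)); apply: eq_integral => y _.
  by congr (`| _ |%:E); ring.
Qed.

Lemma green_op_intg z k g M : 0 < z -> measurable_fun setT g ->
  (forall x, `|g x| <= M * e z x) -> superexp k ->
  intg mu (fun y => g y * J k y).
Proof.
move=> z0 mg gM hk; have := intg2_Int (green_intg2 z0 mg gM hk).
rewrite (_ : (fun x => _) = (fun y => g y * J k y))//.
apply/funext => y; exact: (IntZ (g y) (green_section_intg y (superexp_intg hk))).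
Qed.

Lemma green_opT_intg z k g M : 0 < z -> measurable_fun setT g ->
  (forall x, `|g x| <= M * e z x) -> superexp k ->
  intg mu (fun w => I g w * k w).
Proof.
move=> z0 mg gM hk; have := intg2_Int (intg2_swap (green_intg2 z0 mg gM hk)).
rewrite (_ : (fun x => _) = (fun w => I g w * k w))//.
apply/funext => w; rewrite mulrC /I /kernel_op.
rewrite -(IntZ (k w) (greenT_section_intg w z0 mg gM)).
by congr (Int mu _); apply/funext => y; ring.
Qed.

Lemma green_adjoint z k g M : 0 < z -> measurable_fun setT g ->
  (forall x, `|g x| <= M * e z x) -> superexp k ->
  Int mu (fun y => g y * J k y) = Int mu (fun w => I g w * k w).
Proof.
move=> z0 mg gM hk; have := intg2_Fubini (green_intg2 z0 mg gM hk).
rewrite (_ : (fun x => Int mu _) = (fun y => g y * J k y)); last first.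
  by apply/funext => y; exact: (IntZ (g y) (green_section_intg y (superexp_intg hk))).
move=> ->; congr (Int mu _); apply/funext => w; rewrite mulrC /I /kernel_op.
rewrite -(IntZ (k w) (greenT_section_intg w z0 mg gM)).
by congr (Int mu _); apply/funext => y; ring.
Qed.

Lemma green_op_measurable k : measurable_fun setT k -> measurable_fun setT (J k).
Proof.
move=> mk; apply: measurable_Int; apply: measurable2_mul => //.
exact: measurable2_snd.
Qed.

Lemma green_opT_measurable g : measurable_fun setT g -> measurable_fun setT (I g).
Proof.
move=> mg; apply: measurable_Int; apply: measurable2_mul.
  exact: (measurable2_swap mG).
exact: measurable2_snd.
Qed.

Lemma jexp_self_bound z x : 0 <= z -> `|e z x| <= 1 * e z x.
Proof. by move=> z0; rewrite mul1r ger0_norm// (le_trans ler01 (e_ge1 x z0)). Qed.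

Lemma bounded_jexp_bound g M z x : 0 <= z -> (forall x, `|g x| <= M) ->
  `|g x| <= M * e z x.
Proof.
move=> z0 gM; apply: le_trans (gM x) _; rewrite ler_peMr ?e_ge1//.
exact: le_trans (gM x).
Qed.

Lemma green_op_superexp k : superexp k -> superexp (J k).
Proof.
move=> hk; have [mk _] := hk; split; first exact: green_op_measurable.
move=> z z0; have z1 : 0 < z + 1 by rewrite ltr_wpDl.
rewrite (_ : (fun x => _) = (fun x => e z x * J k x)); last first.
  by apply/funext => x; rewrite mulrC.
apply: (green_op_intg z1 (M := 1)) => // x.
rewrite mul1r ger0_norm; last exact: le_trans (e_ge1 x z0).
by apply: jexp_le => //; lra.
Qed.

(** Adjunction, and I e_z = (e_z - 1) / z: up to the value at 0, the operator J
    inverts the Jacobi operator. *)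
Lemma green_op_transform k z : 0 < z -> superexp k ->
  Int mu (fun x => J k x * e z x) =
  (Int mu (fun x => k x * e z x) - Int mu k) / z.
Proof.
move=> z0 hk; have [mk hke] := hk.
rewrite (_ : (fun x => J k x * _) = (fun x => e z x * J k x)); last first.
  by apply/funext => x; rewrite mulrC.
rewrite (green_adjoint z0 (me z) (fun x => jexp_self_bound x (ltW z0)) hk).
have h1 := hke _ (ltW z0); have h2 := superexp_intg hk.
rewrite -IntB// [RHS]mulrC -IntZ; last exact: intgB.
apply: Int_ae.
- by apply: measurable_funM => //; exact: green_opT_measurable.
- apply: measurable_funM => //; apply: measurable_funB => //.
  exact: measurable_funM.
- apply: (@filterS _ _ (ae_filter_ringOfSetsType mu)) (jacobi_ae_Rpos alpha beta) => x x0.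
  have [_ E] := green_jexp hbeta hab halpha hphi z0 x0.
  by rewrite /I /kernel_op E; field; rewrite gt_eqF.
Qed.

Lemma green_op_norm k y : superexp k -> `|J k y| <= J (fun x => `|k x|) y.
Proof.
move=> hk; apply: Int_norm_le.
- exact/green_section_intg/superexp_intg.
- exact/green_section_intg/superexp_intg/superexp_norm.
- by move=> w; have /andP[G0 _] := green_section_le y w; rewrite normrM (ger0_norm G0).
Qed.

(** The limit of J k at 0, when k has mean zero; see [tame_zero_green]. *)
Definition green_const k : R := Int mu (fun w => (b \_ (@Rpos R)) w * k w).

Lemma green_const_intg k : tame mu e k ->
  intg mu (fun w => (b \_ (@Rpos R)) w * k w).
Proof.
move=> tk; have [M kM] := tame_bounded tk; have mk := tame_measurable tk.
have M0 : 0 <= M by exact: le_trans (kM 0).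
have h1 := intg_norm (superexp_intg (tame_superexp tk)).
have [h2 _] := greenT_jexp_le 1 (@ltr01 R).
apply: (intg_le _ _ (intgD (intgZ `|b 1| h1) (intgZ M h2))).
  apply: measurable_funM => //.
  apply/(measurable_restrictT _ (@measurable_Rpos R)).
  apply: open_continuous_measurable_fun; first exact: interval_open.
  move=> x; rewrite inE /Rpos /= in_itv /= andbT => x0.
  exact: is_derive_continuous (green_primitive_derive hbeta hab halpha x0).
move=> w; rewrite normrM patchE; case: ifPn => [|_]; last first.
  rewrite normr0 mul0r addr_ge0 ?mulr_ge0//.
    by have /andP[] := green_section_le w 1.
  exact: le_trans (e_ge1 w ler01).
rewrite inE /Rpos /= in_itv /= andbT => w0.
have bw := @green_primitive_le0 R alpha beta w.
have b1 := @green_primitive_le0 R alpha beta 1.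
have G0 : 0 <= G w 1 by have /andP[] := green_section_le w 1.
have bG : `|b w| <= `|b 1| + G w 1.
  rewrite (ler0_norm bw) (ler0_norm b1); have [w1|w1] := ltP w 1.
    by rewrite /green w0 w1 /=; lra.
  have := @green_primitive_le R alpha beta hbeta hab halpha 1 w ltr01 w1; lra.
apply: le_trans (ler_wpM2r (normr_ge0 (k w)) bG) _; rewrite mulrDl lerD2l.
rewrite [leRHS]mulrCA; apply: ler_wpM2l => //; apply: le_trans (kM w) _.
by rewrite -[leLHS]mulr1; apply: ler_wpM2l => //; exact: (e_ge1 w ler01).
Qed.

End GreenOperator.

(** * Injectivity of the Jacobi transform *)

(** A log-convex sequence decreases at most geometrically. *)
Lemma log_convex_superexp_eq0 (R : realType) (m0 : R) (u : nat -> R) :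
  0 <= m0 -> (forall k, u k ^+ 2 <= m0 * u k.+1) ->
  (forall z, 0 < z -> exists K, forall k, u k <= K * z ^- (2 ^ k)) -> u 1%N <= 0.
Proof.
move=> m00 u2 uK; rewrite leNgt; apply/negP => u1.
have m0_gt0 : 0 < m0.
  rewrite lt_neqAle m00 andbT eq_sym; apply/eqP => m00'.
  have := u2 1%N; rewrite m00' mul0r leNgt => /negP; apply.
  exact: exprn_gt0.
pose q := u 1%N / m0; have q0 : 0 < q by rewrite divr_gt0.
have low k : m0 * q ^+ (2 ^ k) <= u k.+1.
  elim: k => [|k IH]; first by rewrite expn0 expr1 /q mulrC divfK ?gt_eqF.
  rewrite -(ler_pM2l m0_gt0); apply: le_trans (u2 k.+1).
  rewrite [leLHS](_ : _ = (m0 * q ^+ (2 ^ k)) ^+ 2).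
    rewrite lerXn2r ?nnegrE//; first by rewrite mulr_ge0 ?exprn_ge0 ?ltW.
    by apply: le_trans IH; rewrite mulr_ge0 ?exprn_ge0 ?ltW.
  by rewrite expnS mulnC exprM; ring.
pose z := 1 + 2 / q; have z1 : 1 < z by rewrite ltrDl divr_gt0.
have z0 : 0 < z by exact: lt_trans z1.
have qz : 2 <= q * z ^+ 2.
  have : q * z = q + 2 by rewrite /z; field; rewrite gt_eqF.
  rewrite expr2 mulrA => ->; rewrite -[leLHS]mulr1 ler_pM//; [lra|exact: ltW].
have [K hK] := uK z z0.
have bound k : m0 * 2 ^+ (2 ^ k) <= K.
  have h := le_trans (low k) (hK k.+1).
  have zk : 0 < z ^+ (2 ^ k.+1) by rewrite exprn_gt0.
  rewrite -(ler_pM2r zk) divfK ?gt_eqF// in h.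
  apply: le_trans h; rewrite -mulrA ler_pM2l// expnS exprM -exprMn.
  by rewrite lerXn2r ?nnegrE// mulr_ge0 ?exprn_ge0 ?ltW.
pose n := Num.bound (K / m0).
have Kn : K / m0 < n%:R.
  have [K0|K0] := leP 0 K; first by apply: archi_boundP; rewrite divr_ge0.
  by apply: lt_le_trans (ler0n _ _); rewrite pmulr_llt0 ?invr_gt0.
have := bound n; rewrite mulrC -ler_pdivlMr// leNgt => /negP; apply.
apply: lt_le_trans Kn _; rewrite -natrX ler_nat.
by rewrite (leq_trans (ltnW (ltn_expl n (ltnSn 1))))// ltnW// ltn_expl.
Qed.

Section GreenIteration.
Context {R : realType}.
Variables (alpha beta : R).
Hypotheses (hbeta : - 2^-1 <= beta) (hab : beta <= alpha)
  (halpha : - 2^-1 < alpha).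
Variable phi : R[i] -> R -> R[i].
Hypothesis hphi : is_jacobi_function alpha beta phi.
Local Notation mu := (jacobi_measure alpha beta).
Local Notation b := (green_primitive alpha beta).
Local Notation T := (measurableTypeR R).
Local Notation e := (jexp alpha beta phi).
Local Notation G := (green alpha beta).
Local Notation J := (green_op alpha beta).
Local Notation I := (green_opT alpha beta).
Local Notation tame := (@tame _ T R mu e).
Implicit Types (x y z w c M : R) (f g k nu : T -> R).

Let e_ge1 z x : 0 <= z -> 1 <= e z x. Proof. exact: jexp_ge1. Qed.
Let me z : measurable_fun setT (e z : T -> R). Proof. exact: jexp_measurable. Qed.
Let e0 x : e 0 x = 1. Proof. exact: jexp0. Qed.

Lemma tame_int nu : tame nu -> intg mu nu.
Proof. by move=> tn; exact: superexp_intg (tame_superexp tn). Qed.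

Lemma jacobi_aeS (P Q : T -> Prop) : (forall x, P x -> Q x) ->
  {ae mu, forall x, P x} -> {ae mu, forall x, Q x}.
Proof. by move=> PQ; apply: (@filterS _ _ (ae_filter_ringOfSetsType mu)). Qed.

Lemma jacobi_ae_pos (P : T -> Prop) : (forall x, 0 < x -> P x) ->
  {ae mu, forall x, P x}.
Proof. by move=> hP; exact: jacobi_aeS hP (jacobi_ae_Rpos alpha beta). Qed.

(** The kernel of J minus that of I is b w - b y on the whole half-line, and
    nu is orthogonal to the constant b y. *)
Lemma tame_zero_green nu y : tame nu -> Int mu nu = 0 -> 0 < y ->
  J nu y = I nu y + green_const alpha beta nu.
Proof.
move=> tn n0 y0; have [M nM] := tame_bounded tn; have mn := tame_measurable tn.
have hn := tame_int tn.
have h1 := green_section_intg hbeta hab halpha y hn.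
have h2 : intg mu (fun w => G w y * nu w).
  apply: (greenT_section_intg hbeta hab halpha hphi y ltr01 mn (M := M)) => x.
  by apply: bounded_jexp_bound.
have h3 := green_const_intg hbeta hab halpha hphi tn.
have -> : J nu y = Int mu (fun w => (G w y * nu w + (b \_ (@Rpos R)) w * nu w)
   - b y * nu w).
  apply: Int_ae.
  - exact: intg_measurable h1.
  - exact: intg_measurable (intgB (intgD h2 h3) (intgZ (b y) hn)).
  - apply: jacobi_ae_pos => w w0; rewrite patchE mem_set; last first.
      by rewrite /Rpos /= in_itv /= andbT.
    rewrite -mulrDl -mulrBl; congr (_ * _); rewrite /green y0 w0 /=.
    by case: (ltgtP y w) => [|_|->]; lra.
rewrite IntB; [|exact: intgD|exact: intgZ].
by rewrite IntD// IntZ// n0 mulr0 subr0.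
Qed.

Lemma green_op_nonpos nu y : y <= 0 -> J nu y = 0.
Proof.
move=> y0; rewrite /green_op /kernel_op -[RHS](Int0 mu); congr (Int mu _).
by apply/funext => w; rewrite /green (le_gtF y0) mul0r.
Qed.

(** Near 0 the bound comes from the agreement of J and its transpose, away from
    0 from the boundedness of the Green function. *)
Lemma green_op_tame nu : tame nu -> Int mu nu = 0 -> tame (J nu).
Proof.
move=> tn n0; have [M nM] := tame_bounded tn; have mn := tame_measurable tn.
have hn := tame_int tn.
have [mJ hJ] := green_op_superexp hbeta hab halpha hphi (tame_superexp tn).
split => //.
have M0 : 0 <= M by exact: le_trans (nM 0).
have [i1 _] := greenT_jexp_le hbeta hab halpha hphi 1 (@ltr01 R).
pose B1 := `|b 1| * Int mu (fun w => `|nu w|).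
pose B2 := M * Int mu (fun w => G w 1 * e 1 w) + `|green_const alpha beta nu|.
have hn' := intg_norm hn.
have B10 : 0 <= B1 by rewrite mulr_ge0// Int_ge0.
have G0 u v : 0 <= G u v by have /andP[] := green_section_le hbeta hab halpha u v.
have B20 : 0 <= B2.
  rewrite addr_ge0// mulr_ge0// Int_ge0// => w.
  by rewrite mulr_ge0//; exact: le_trans (e_ge1 w ler01).
exists (B1 + B2) => y.
have [y0|y0] := leP y 0; first by rewrite green_op_nonpos// normr0 addr_ge0.
have [y1|y1] := leP 1 y.
  apply: (@le_trans _ _ B1); last by rewrite lerDl.
  rewrite /B1 -IntZ//; apply: Int_norm_le.
  - exact: green_section_intg.
  - exact: intgZ.
  - move=> w; rewrite normrM ler_wpM2r// (ger0_norm (G0 _ _)).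
    have /andP[_ h] := green_section_le hbeta hab halpha y w.
    apply: le_trans h _; rewrite !ler0_norm ?green_primitive_le0// lerN2.
    exact: green_primitive_le.
apply: (@le_trans _ _ B2); last by rewrite lerDr.
rewrite tame_zero_green//; apply: le_trans (ler_normD _ _) _; rewrite lerD2r.
rewrite -IntZ//; apply: Int_norm_le.
- apply: (greenT_section_intg hbeta hab halpha hphi y ltr01 mn (M := M)) => x.
  exact: bounded_jexp_bound.
- exact: intgZ.
- move=> w; rewrite normrM (ger0_norm (G0 _ _)) mulrC ler_pM//.
  apply: (@le_trans _ _ (G w 1)); last by rewrite ler_peMr// (e_ge1 w ler01).
  rewrite /green; case: ifPn => [/andP[w0 wy]|_]; last first.
    by have := G0 w 1; rewrite /green.
  rewrite w0 (lt_trans wy y1) /= lerD2r; apply: green_primitive_le => //.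
  exact: ltW.
Qed.

Definition null_transform nu : Prop :=
  tame nu /\ forall z, 0 <= z -> Int mu (fun x => nu x * e z x) = 0.

Lemma null_transform_Int nu : null_transform nu -> Int mu nu = 0.
Proof.
move=> [_ /(_ 0 (lexx _))]; rewrite (_ : (fun x => _) = nu)//.
by apply/funext => x; rewrite e0 mulr1.
Qed.

Lemma null_transform_green nu : null_transform nu -> null_transform (J nu).
Proof.
move=> nn; have n0 := null_transform_Int nn; have [tn hn] := nn.
have tJ := green_op_tame tn n0; split => //.
have pos z : 0 < z -> Int mu (fun x => J nu x * e z x) = 0.
  move=> z0; rewrite (green_op_transform hbeta hab halpha hphi z0 (tame_superexp tn)).
  by rewrite n0 hn ?(ltW z0)// subrr mul0r.
move=> z; rewrite le_eqVlt => /predU1P[<-|]; last exact: pos.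
(* Int (J nu) is the limit of the values at small z *)
rewrite (_ : (fun x => _) = J nu); last by apply/funext => x; rewrite e0 mulr1.
apply/eqP; rewrite -normr_le0; apply/ler_addgt0Pl => eps eps0; rewrite addr0.
have iJ := tame_int tJ; have iJ1 := tame_intg tJ (@ler01 R).
pose K := Int mu (fun x => `|J nu x * e 1 x|).
have K0 : 0 <= K by apply: Int_ge0 => x.
pose t := eps / (eps + K + 1).
have d0 : 0 < eps + K + 1 by lra.
have t0 : 0 < t by rewrite divr_gt0.
have t1 : t <= 1 by rewrite ler_pdivrMr// mul1r; lra.
have -> : Int mu (J nu) = Int mu (fun x => J nu x - J nu x * e t x).
  by rewrite (IntB iJ (tame_intg tJ (ltW t0))) (pos t t0) subr0.
apply: (@le_trans _ _ (t * K)); last first.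
  by rewrite mulrAC ler_pdivrMr// ler_wpM2l ?(ltW eps0)//; lra.
rewrite /K -IntZ; last exact: intg_norm.
apply: Int_norm_le.
- exact: intgB iJ (tame_intg tJ (ltW t0)).
- exact/intgZ/intg_norm.
- move=> x; rewrite -[X in X - _]mulr1 -mulrBr !normrM mulrCA ler_wpM2l//.
  rewrite ler0_norm; last by rewrite subr_le0 e_ge1// ltW.
  rewrite opprB (ger0_norm (le_trans ler01 (e_ge1 x ler01))).
  have tc : 0 <= t <= 1 by rewrite (ltW t0).
  apply: le_trans (jexp_convex hbeta hab halpha hphi x tc) _.
  by rewrite ler_wpM2l ?(ltW t0)//; lra.
Qed.

(** J and I differ by a constant, to which functions of null transform are
    orthogonal. *)
Lemma green_op_symmetric nu nu' : null_transform nu -> null_transform nu' ->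
  Int mu (fun x => J nu x * nu' x) = Int mu (fun x => nu x * J nu' x).
Proof.
move=> nn nn'; have [tn _] := nn; have [tn' _] := nn'.
have [M' nM'] := tame_bounded tn'; have mn' := tame_measurable tn'.
have gM x : `|nu' x| <= M' * e 1 x by apply: bounded_jexp_bound.
have tJ' := green_op_tame tn' (null_transform_Int nn').
have iJ' : intg mu (fun x => nu x * J nu' x).
  have [M nM] := tame_bounded tn; have mn := tame_measurable tn.
  exact: intg_mul_bounded mn nM (tame_int tJ').
transitivity (Int mu (fun x => nu' x * J nu x)).
  by congr (Int mu _); apply/funext => x; rewrite mulrC.
rewrite (green_adjoint hbeta hab halpha hphi ltr01 mn' gM (tame_superexp tn)).
have := green_opT_intg hbeta hab halpha hphi ltr01 mn' gM (tame_superexp tn).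
move=> iI.
transitivity (Int mu (fun x => nu x * J nu' x - green_const alpha beta nu' * nu x)).
  apply: Int_ae; first exact: intg_measurable iI.
    exact: intg_measurable (intgB iJ' (intgZ _ (tame_int tn))).
  apply: jacobi_ae_pos => x x0.
  by rewrite (tame_zero_green tn' (null_transform_Int nn') x0); ring.
rewrite IntB//; last exact/intgZ/tame_int.
by rewrite (IntZ _ (tame_int tn)) (null_transform_Int nn) mulr0 subr0.
Qed.

Lemma null_transform_iter nu n : null_transform nu -> null_transform (iter n J nu).
Proof. by move=> nn; elim: n => //= n; exact: null_transform_green. Qed.

Lemma green_iter_pairing nu n m : null_transform nu ->
  Int mu (fun x => iter n J nu x * iter m J nu x) =
  Int mu (fun x => nu x * iter (n + m) J nu x).
Proof.
move=> nn; elim: n m => [//|n IH] m.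
by rewrite addSnnS -IH /= green_op_symmetric//; exact: null_transform_iter.
Qed.

Lemma green_iter_decay nu n z : 0 < z -> superexp alpha beta phi nu ->
  superexp alpha beta phi (iter n J nu) /\
  Int mu (fun x => `|iter n J nu x| * e z x) <=
  z ^- n * Int mu (fun x => `|nu x| * e z x).
Proof.
move=> z0 hn; elim: n => [|n [IH1 IH2]] /=; first by rewrite expr0 invr1 mul1r.
split; first exact: green_op_superexp.
have hN := superexp_norm hbeta hab halpha hphi IH1.
have hJ := superexp_norm hbeta hab halpha hphi (green_op_superexp hbeta hab halpha hphi IH1).
have hJN := green_op_superexp hbeta hab halpha hphi hN.
have z0' := ltW z0.
apply: (@le_trans _ _ (Int mu (fun x => J (fun x => `|iter n J nu x|) x * e z x))).
  apply: Int_le; [exact: hJ.2|exact: hJN.2|] => x.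
  by rewrite ler_wpM2r ?(le_trans ler01 (e_ge1 x z0'))// (green_op_norm hbeta hab halpha hphi x IH1).
rewrite (green_op_transform hbeta hab halpha hphi z0 hN).
rewrite exprS invfM -mulrA mulrC ler_pM2l ?invr_gt0//.
by apply: le_trans IH2; rewrite gerBl Int_ge0.
Qed.

(** Iterating J on nu yields the moments of the spectral measure of nu: they are
    log-convex, but decrease superexponentially. *)
Lemma null_transform_green0 nu : null_transform nu ->
  {ae mu, forall x, J nu x = 0}.
Proof.
move=> nn; have [tn _] := nn.
have nk n := null_transform_iter n nn.
have tk n : tame (iter n J nu) by exact: (nk n).1.
have sq n : intg mu (fun x => iter n J nu x ^+ 2).
  have [M kM] := tame_bounded (tk n).
  under eq_fun do rewrite expr2.
  exact: intg_mul_bounded (tame_measurable (tk n)) kM (tame_int (tk n)).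
pose u (k : nat) := Int mu (fun x => nu x * iter (2 ^ k) J nu x).
have u_sq (k : nat) : u k.+1 = Int mu (fun x => iter (2 ^ k) J nu x ^+ 2).
  rewrite /u expnS mul2n -addnn -(green_iter_pairing _ _ nn).
  by congr (Int mu _); apply/funext => x; rewrite expr2.
have : u 1%N <= 0.
  apply: (log_convex_superexp_eq0 (m0 := Int mu (fun x => nu x ^+ 2))).
  - by apply: Int_ge0 => x; exact: sqr_ge0.
  - move=> k; rewrite u_sq; apply: Int_cauchy_schwarz => //.
    + exact: tame_measurable tn.
    + exact: tame_measurable (tk _).
    + exact: (sq 0%N).
  - move=> z z0; have [M nM] := tame_bounded tn.
    have M0 : 0 <= M by exact: le_trans (nM 0).
    exists (M * Int mu (fun x => `|nu x| * e z x)) => k.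
    have [sk dk] := green_iter_decay (2 ^ k) z0 (tame_superexp tn).
    apply: le_trans (ler_norm _) _.
    rewrite -mulrA [_ * z ^- _]mulrC.
    apply: le_trans (ler_wpM2l M0 dk).
    have hN := superexp_norm hbeta hab halpha hphi sk.
    have iN := hN.2 z (ltW z0).
    rewrite -IntZ//; apply: Int_norm_le; last 2 first.
    + exact: intgZ.
    + move=> x; rewrite normrM ler_pM// ler_peMr//.
      exact: (e_ge1 x (ltW z0)).
    + exact: intg_mul_bounded (tame_measurable tn) nM (tame_int (tk _)).
rewrite u_sq expn0 /= => u10.
apply: Int_square_eq0.
- exact: tame_measurable (tk 1%N).
- exact: (sq 1%N).
- apply/eqP; rewrite eq_le u10 /=; apply: Int_ge0 => x; exact: sqr_ge0.
Qed.

End GreenIteration.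

Section Primitive.
Context {R : realType}.
Local Notation leb := (@lebesgue_measure R).
Local Notation T := (measurableTypeR R).
Implicit Types (f g : T -> R) (u w x y : R).

Definition locally_bounded0 f : Prop :=
  forall u, exists M, forall y, 0 <= y <= u -> `|f y| <= M.

Definition primitive0 f w : R := Rintegral leb `[0, w] f.

Let mI u w : measurable ([set` `[u, w]] : set T). Proof. exact: measurable_itv. Qed.

Lemma locally_bounded0_integrable f u : measurable_fun setT f ->
  locally_bounded0 f -> leb.-integrable `[0, u] (EFin \o f).
Proof.
move=> mf fb; have [M fM] := fb u.
apply: measurable_bounded_integrable => //.
- by rewrite /= lebesgue_measure_itv /=; case: ifPn => _; rewrite ?ltry// -EFinD ltry.
- exact: measurable_funTS.
- exists M; split; first exact: num_real.
  move=> N MN y /=; rewrite in_itv /= => /fM h.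
  exact: le_trans h (ltW MN).
Qed.

Lemma primitive0_continuous f w : measurable_fun setT f -> locally_bounded0 f ->
  0 < w -> {for w, continuous (primitive0 f)}.
Proof.
move=> mf fb w0; have w1 : 0 <= w + 1 by lra.
have := parameterized_integral_continuous w1 (locally_bounded0_integrable (w + 1) mf fb).
move=> h; have : {within `]0, w + 1[, continuous (primitive0 f)}.
  by apply: continuous_subspaceW h; exact: subset_itv_oo_cc.
rewrite continuous_open_subspace; last exact: interval_open.
move=> h2; apply: h2.
by rewrite inE /= in_itv /= w0 /= ltrDl ltr01.
Qed.

Lemma primitive0_derive f w : measurable_fun setT f -> locally_bounded0 f ->
  0 < w -> {for w, continuous f} -> is_derive w 1 (primitive0 f) (f w).
Proof.
move=> mf fb w0 cf; have w1 : w < w + 1 by rewrite ltrDl.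
have [d1 d2] := continuous_FTC1_closed w1
  (locally_bounded0_integrable (w + 1) mf fb) w0 cf.
by rewrite -d2 derive1E; exact: derivableP.
Qed.

Lemma primitive0_ae_derive f : measurable_fun setT f -> locally_bounded0 f ->
  {ae leb, forall w, 0 < w -> is_derive w 1 (primitive0 f) (f w)}.
Proof.
move=> mf fb; pose fn (n : nat) : T -> R := f \_ `[0, n%:R].
have mfn n : measurable_fun setT (fn n).
  by apply/(measurable_restrictT _ (mI 0 n%:R)); exact: measurable_funTS.
have fbn n : locally_bounded0 (fn n).
  move=> u; have [M fM] := fb u; exists M => y yu.
  have fy := fM y yu.
  by rewrite /fn patchE; case: ifPn => // _; rewrite normr0 (le_trans _ fy).
have aen n : {ae leb, forall w, 0 < w -> is_derive w 1 (primitive0 (fn n)) (fn n w)}.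
  have loc : locally_integrable setT (fn n).
    by apply: integrable_locally => //; exact: locally_bounded0_integrable.
  have := FTC1 (a := BLeft 0) (fun y => locally_bounded0_integrable y (mfn n) (fbn n)) loc.
  apply: (@filterS _ _ (ae_filter_ringOfSetsType leb)) => w /= h w0.
  have [|d1 d2] := h; first by rewrite lte_fin.
  by rewrite -d2 derive1E; exact: derivableP.
have : {ae leb, forall w, forall n, 0 < w -> is_derive w 1 (primitive0 (fn n)) (fn n w)}.
  exact: ae_foralln.
apply: (@filterS _ _ (ae_filter_ringOfSetsType leb)) => w /= h w0.
pose n := Num.bound w.
have wn : w < n%:R by apply: archi_boundP; exact: ltW.
have := h n w0; rewrite {2}/fn patchE mem_set; last by rewrite /= in_itv /= !ltW.
apply: near_eq_is_derive; near=> y.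
have yn : y <= n%:R by apply/ltW; near: y; exact: (lt_nbhsl wn).
apply: eq_Rintegral => t; rewrite inE /= in_itv /= => /andP[t0 ty].
by rewrite mem_set//= in_itv /= t0 (le_trans ty).
Unshelve. all: by end_near. Qed.

End Primitive.

Section GreenPrimitiveForm.
Context {R : realType}.
Variables (alpha beta : R).
Hypotheses (hbeta : - 2^-1 <= beta) (hab : beta <= alpha)
  (halpha : - 2^-1 < alpha).
Local Notation leb := (@lebesgue_measure R).
Local Notation mu := (jacobi_measure alpha beta).
Local Notation A := (jacobi_weight alpha beta).
Local Notation a := (jacobi_log_weight alpha beta).
Local Notation rho := (jacobi_rho alpha beta).
Local Notation b := (green_primitive alpha beta).
Local Notation dA := (jacobi_density alpha beta).
Local Notation b' := ((green_primitive alpha beta) \_ (@Rpos R)).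
Local Notation T := (measurableTypeR R).
Local Notation G := (green alpha beta).
Local Notation I := (green_opT alpha beta).
Implicit Types (x y z w c M : R) (f g k nu : T -> R).

Let wA : sturm_weight rho A a := jacobi_sturm_weight hbeta hab halpha.

Lemma jacobi_IntE f : measurable_fun setT f ->
  Int mu f = Rintegral leb setT (fun x => f x * dA x).
Proof.
move=> mf; rewrite /Int /Rintegral; congr fine; rewrite [LHS]integralE [RHS]integralE.
have mfE : measurable_fun setT (EFin \o f) by exact/measurable_EFinP.
have d0 := @jacobi_density_ge0 R alpha beta.
have md := @jacobi_density_measurable R alpha beta.
rewrite !(ge0_integral_density md d0 (@jacobi_measureE R alpha beta))//.
- congr (_ - _)%E; apply: eq_integral => x _.
    by rewrite !funeposE /= -!EFin_max -EFinM maxr_pMl ?mul0r.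
  by rewrite !funenegE /= -!EFin_max -EFinM maxr_pMl ?mul0r ?mulNr.
- exact: measurable_funeneg.
- exact: measurable_funepos.
Qed.

Lemma jacobi_density_pos x : 0 < x -> dA x = A x.
Proof. by move=> x0; rewrite /jacobi_density patchE mem_set// /Rpos /= in_itv /= andbT. Qed.

Lemma jacobi_density_nonpos x : x <= 0 -> dA x = 0.
Proof.
move=> x0; rewrite /jacobi_density patchE memNset// /Rpos /= in_itv /= andbT.
by move=> x0'; move: (lt_le_trans x0' x0); rewrite ltxx.
Qed.

Lemma green_primitive_pos x : 0 < x -> b' x = b x.
Proof. by move=> x0; rewrite patchE mem_set// /Rpos /= in_itv /= andbT. Qed.

Lemma green_primitive_measurable : measurable_fun setT (b' : T -> R).
Proof.
apply/(measurable_restrictT _ (@measurable_Rpos R)).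
apply: open_continuous_measurable_fun; first exact: interval_open.
move=> x; rewrite inE /Rpos /= in_itv /= andbT => x0.
exact: is_derive_continuous (green_primitive_derive hbeta hab halpha x0).
Qed.

(** Local boundedness up to 0, where the weight is integrable: enough for the
    mu-primitives below to be finite.  No bound at infinity is imposed. *)
Definition bounded_pos g : Prop :=
  forall u, exists M, forall y, 0 < y <= u -> `|g y| <= M.

Lemma bounded_bounded_pos g M : (forall x, `|g x| <= M) -> bounded_pos g.
Proof. by move=> gM u; exists M => y _. Qed.

Lemma bounded_pos_density g : bounded_pos g -> locally_bounded0 (fun y => g y * dA y).
Proof.
move=> gb u; have [M gM] := gb u; exists (`|M| * A u) => y /andP[y0 yu].
move: y0; rewrite le_eqVlt => /predU1P[y0|y0].
  by rewrite -y0 jacobi_density_nonpos// mulr0 normr0 mulr_ge0// jacobi_weight_ge0.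
rewrite jacobi_density_pos// normrM (ger0_norm (jacobi_weight_ge0 _ _ _)).
have gy : `|g y| <= `|M| by rewrite (le_trans (gM y _)) ?ler_norm ?y0.
exact: ler_pM (normr_ge0 _) (jacobi_weight_ge0 _ _ _) gy (weight_nondecreasing wA y0 yu).
Qed.

Lemma bounded_pos_primitive_density g : bounded_pos g ->
  locally_bounded0 (fun y => b' y * (g y * dA y)).
Proof.
move=> gb u; have [M gM] := gb u; exists (`|M| * (u + `|b u| * A u)) => y /andP[y0 yu].
have u0 := le_trans y0 yu.
move: y0; rewrite le_eqVlt => /predU1P[y0|y0].
  rewrite -y0 jacobi_density_nonpos// !mulr0 normr0.
  by rewrite mulr_ge0// addr_ge0// mulr_ge0// jacobi_weight_ge0.
have Ay0 := jacobi_weight_ge0 alpha beta y.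
rewrite jacobi_density_pos// green_primitive_pos// normrM [`|g y * A y|]normrM (ger0_norm Ay0) mulrCA.
have gy : `|g y| <= `|M| by rewrite (le_trans (gM y _)) ?ler_norm ?y0.
have by0 := @green_primitive_le0 R alpha beta y.
have bu0 := @green_primitive_le0 R alpha beta u.
have h1 := green_primitive_weight hbeta hab halpha y0 yu.
have h2 := weight_nondecreasing wA y0 yu.
apply: (ler_pM (normr_ge0 _) _ gy _); first exact: mulr_ge0 (normr_ge0 _) Ay0.
rewrite (ler0_norm by0) (ler0_norm bu0); move: by0 bu0 Ay0 h1 h2.
move: (A y) (A u) (b y) (b u) => Ay Au b1 b2 b10 b20 Ay0 h1 h2.
have := mulr_ge0 (etrans (oppr_ge0 b2) b20) (etrans (subr_ge0 Ay Au) h2).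
by lra.
Qed.

Local Notation N g := (primitive0 (fun y => g y * dA y)).
Local Notation P g := (primitive0 (fun y => b' y * (g y * dA y))).

Lemma density_mul_measurable g : measurable_fun setT g ->
  measurable_fun setT (fun y => g y * dA y).
Proof. by move=> mg; apply: measurable_funM => //; exact: jacobi_density_measurable. Qed.

Lemma primitive_density_mul_measurable g : measurable_fun setT g ->
  measurable_fun setT (fun y => b' y * (g y * dA y)).
Proof.
move=> mg; apply: measurable_funM; last exact: density_mul_measurable.
exact: green_primitive_measurable.
Qed.

(** Splitting G y w = b w - b y separates the variables. *)
Lemma green_opTE g w : measurable_fun setT g -> bounded_pos g -> 0 < w ->
  I g w = b w * N g w - P g w.
Proof.
move=> mg gb w0.
have m1 := density_mul_measurable mg; have m2 := primitive_density_mul_measurable mg.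
have i1 := locally_bounded0_integrable w m1 (bounded_pos_density gb).
have i2 := locally_bounded0_integrable w m2 (bounded_pos_primitive_density gb).
have mI : measurable ([set` `[0, w]] : set T) by exact: measurable_itv.
rewrite /green_opT /kernel_op jacobi_IntE; last first.
  apply: measurable_funM => //.
  exact: (measurable2_section w (measurable2_swap (green_measurable hbeta hab halpha))).
rewrite /primitive0 -RintegralZl// -RintegralB//; last first.
  exact: (integrableZl mI (b w) i1).
rewrite [RHS]Rintegral_mkcond; apply: eq_Rintegral => y _.
rewrite patchE; case: ifPn => hy.
  move: hy; rewrite inE /= in_itv /= => /andP[y0 yw].
  move: y0; rewrite le_eqVlt => /predU1P[<-|y0].
    by rewrite jacobi_density_nonpos// !mulr0 subr0.
  rewrite green_primitive_pos// /green y0 /=.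
  move: yw; rewrite le_eqVlt => /predU1P[->|->]; last by ring.
  by rewrite ltxx; ring.
have [y0|y0] := leP y 0; first by rewrite jacobi_density_nonpos// mulr0.
rewrite /green; case: ifPn => [/andP[_ yw]|]; last by rewrite !mul0r.
by move/negP: hy; rewrite inE /= in_itv /= !ltW.
Qed.

Lemma green_opT_continuous g w : measurable_fun setT g -> bounded_pos g ->
  0 < w -> {for w, continuous (I g)}.
Proof.
move=> mg gb w0.
have m1 := density_mul_measurable mg; have m2 := primitive_density_mul_measurable mg.
have h : {for w, continuous (fun w => b w * N g w - P g w)}.
  apply: cvgB.
    apply: cvgM.
      exact: is_derive_continuous (green_primitive_derive hbeta hab halpha w0).
    exact: primitive0_continuous m1 (bounded_pos_density gb) w0.
  exact: primitive0_continuous m2 (bounded_pos_primitive_density gb) w0.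
rewrite /prop_for /continuous_at green_opTE//.
apply: cvg_trans h; apply: near_eq_cvg.
by near=> y; rewrite green_opTE//; near: y; exact: lt_nbhsr.
Unshelve. all: by end_near. Qed.

Lemma lebesgue_ae_point (Q : R -> Prop) (u v : R) : u < v -> {ae leb, forall x, Q x} ->
  exists2 x, u < x < v & Q x.
Proof.
move=> uv [S [mS S0 QS]]; apply: contrapT => nQ.
have sub : [set` `]u, v[] `<=` S.
  move=> x /=; rewrite in_itv /= => xuv; apply: QS => Qx.
  by apply: nQ; exists x.
have : (leb [set` `]u, v[] <= leb S)%E.
  by apply: le_measure => //; rewrite inE; [exact: measurable_itv|].
rewrite S0 lebesgue_measure_itv /= lte_fin uv -EFinD lee_fin subr_le0.
by rewrite leNgt uv.
Qed.

Lemma jacobi_null_lebesgue (Q : R -> Prop) : {ae leb, forall x, Q x} ->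
  {ae mu, forall x, Q x}.
Proof.
move=> [S [mS S0 QS]]; exists S; split => //.
rewrite jacobi_measureE// null_set_integral//.
by apply/measurable_EFinP; apply: measurable_funTS; exact: jacobi_density_measurable.
Qed.

Lemma jacobi_ae_lebesgue (Q : R -> Prop) : {ae mu, forall x, Q x} ->
  {ae leb, forall x, 0 < x -> Q x}.
Proof.
move=> [S [mS S0 QS]].
have mR : measurable (@Rpos R : set T) by exact: measurable_Rpos.
have : (\int[leb]_(x in S `&` @Rpos R) `|(A x)%:E| = 0)%E.
  rewrite -[RHS]S0 /jacobi_measure; apply: eq_integral => x _ /=.
  by rewrite ger0_norm// jacobi_weight_ge0.
move/(ae_eq_integral_abs leb (measurableI _ _ mS mR) _).1 => h.
have {h} : ae_eq leb (S `&` @Rpos R) (fun x => (A x)%:E) (cst 0%E).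
  apply: h; apply/measurable_EFinP; apply: measurable_funTS.
  exact: measurable_jacobi_weight.
apply: (@filterS _ _ (ae_filter_ringOfSetsType leb)) => x /= h x0.
apply: contrapT => nQ; have Sx : S x by exact: QS.
have SR : (S `&` @Rpos R) x by split => //; rewrite /Rpos /= in_itv /= x0.
have [Ax] := h SR.
by have := jacobi_weight_gt0 hbeta hab halpha x0; rewrite Ax ltxx.
Qed.

(** The derivative of I g is N g / A, where N g is the mu-primitive of g, whose
    derivative is g A: both hold almost everywhere, by Lebesgue differentiation. *)
Lemma green_opT_const_eq0 g c X : measurable_fun setT g -> bounded_pos g ->
  (forall w, 0 < w < X -> I g w = c) ->
  {ae mu, forall w, 0 < w < X -> g w = 0}.
Proof.
move=> mg gb Ic.
have m1 := density_mul_measurable mg; have m2 := primitive_density_mul_measurable mg.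
have b1 := bounded_pos_density gb; have b2 := bounded_pos_primitive_density gb.
have near0X w : 0 < w < X -> \forall y \near w, 0 < y < X.
  move=> /andP[w0 wX]; near=> y; apply/andP; split.
    by near: y; exact: lt_nbhsr.
  by near: y; exact: lt_nbhsl.
have ae1 : {ae leb, forall w, 0 < w < X -> N g w = 0}.
  have h1 := primitive0_ae_derive m1 b1; have h2 := primitive0_ae_derive m2 b2.
  move: h2; apply: (@filterS2 _ _ (ae_filter_ringOfSetsType leb)) h1 => w d1 d2 w0X.
  have /andP[w0 wX] := w0X.
  have db := green_primitive_derive hbeta hab halpha w0.
  have hd := is_derive_sub (is_derive_mul db (d1 w0)) (d2 w0).
  have h0 : is_derive w 1 (fun w => b w * N g w - P g w) 0.
    apply: near_eq_is_derive (is_derive_cst c w 1).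
    near=> y; have y0X : 0 < y < X by near: y; exact: near0X.
    by rewrite -green_opTE ?Ic//; have /andP[] := y0X.
  have := is_derive_unique hd h0; rewrite green_primitive_pos// => /eqP.
  rewrite addrK mulf_eq0 invr_eq0 (gt_eqF (jacobi_weight_gt0 _ _ _ w0))//=.
  by move/eqP.
have N0 w : 0 < w < X -> N g w = 0.
  move=> w0X; apply/eqP/negPn/negP => Nw.
  have cN : {for w, continuous (fun w => `|N g w|)}.
    apply: continuous_comp; last exact: norm_continuous.
    by apply: primitive0_continuous => //; have /andP[] := w0X.
  have [|d d0 hd] := continuous_near_gt0 cN; first by rewrite normr_gt0.
  have /andP[w0 wX] := w0X.
  have wv : w < Num.min X (w + d) by rewrite lt_min wX ltrDl.
  have [x /andP[wx]] := lebesgue_ae_point wv ae1.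
  rewrite lt_min => /andP[xX xd] Nx.
  have : 0 < `|N g x|.
    by apply: hd; rewrite ltr0_norm ?subr_lt0// opprB ltrBlDl.
  by rewrite Nx ?normr0 ?ltxx// xX andbT (lt_trans w0 wx).
apply: jacobi_null_lebesgue.
have := primitive0_ae_derive m1 b1.
apply: (@filterS _ _ (ae_filter_ringOfSetsType leb)) => w d1 w0X.
have /andP[w0 wX] := w0X.
have h0 : is_derive w 1 (N g) 0.
  apply: near_eq_is_derive (is_derive_cst 0 w 1).
  by near=> y; rewrite N0//; near: y; exact: near0X.
have := is_derive_unique (d1 w0) h0; rewrite jacobi_density_pos// => /eqP.
rewrite mulf_eq0 (gt_eqF (jacobi_weight_gt0 _ _ _ w0))// orbF.
by move/eqP.
Unshelve. all: by end_near. Qed.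

Lemma green_opT_derive g w : measurable_fun setT g -> bounded_pos g ->
  (forall x, 0 < x -> {for x, continuous g}) -> 0 < w ->
  is_derive w 1 (N g) (g w * A w) /\ is_derive w 1 (I g) (N g w / A w).
Proof.
move=> mg gb cg w0.
have m1 := density_mul_measurable mg; have m2 := primitive_density_mul_measurable mg.
have b1 := bounded_pos_density gb; have b2 := bounded_pos_primitive_density gb.
have c1 : {for w, continuous (fun y => g y * dA y)}.
  have h : {for w, continuous (fun y => g y * A y)}.
    by apply: cvgM; [exact: cg|exact: (jacobi_weight_continuous hbeta hab halpha)].
  rewrite /prop_for /continuous_at jacobi_density_pos//.
  apply: cvg_trans h; apply: near_eq_cvg.
  by near=> y; rewrite jacobi_density_pos//; near: y; exact: lt_nbhsr.
have c2 : {for w, continuous (fun y => b' y * (g y * dA y))}.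
  have h : {for w, continuous (fun y => b y * (g y * dA y))}.
    apply: cvgM => //.
    exact: is_derive_continuous (green_primitive_derive hbeta hab halpha w0).
  rewrite /prop_for /continuous_at green_primitive_pos//.
  apply: cvg_trans h; apply: near_eq_cvg.
  by near=> y; rewrite green_primitive_pos//; near: y; exact: lt_nbhsr.
have d1 := primitive0_derive m1 b1 w0 c1; have d2 := primitive0_derive m2 b2 w0 c2.
split; first by rewrite -jacobi_density_pos.
have db := green_primitive_derive hbeta hab halpha w0.
have hd := is_derive_sub (is_derive_mul db d1) d2.
apply: (@near_eq_is_derive _ _ _ (fun w => b w * N g w - P g w)).
  by near=> y; rewrite green_opTE//; near: y; exact: lt_nbhsr.
by move: hd => /is_derive_eq; apply; rewrite green_primitive_pos//; ring.
Unshelve. all: by end_near. Qed.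

Lemma primitive0_density_le g w M : measurable_fun setT g -> 0 < w ->
  (forall y, 0 < y <= w -> `|g y| <= M) -> `|N g w| <= M * (A w * w).
Proof.
move=> mg w0 gM.
have mI : measurable ([set` `[0, w]] : set T) by exact: measurable_itv.
have M0 : 0 <= M by apply: le_trans (gM w _) => //; rewrite w0 lexx.
pose g1 : T -> R := g \_ `]0, w].
have mg1 : measurable_fun setT g1.
  apply/(measurable_restrictT _ (measurable_itv _)); exact: measurable_funTS.
have g1M y : `|g1 y| <= M.
  rewrite /g1 patchE; case: ifPn => [|_]; last by rewrite normr0.
  by rewrite inE /= in_itv /= => /gM.
have i1 := locally_bounded0_integrable w (density_mul_measurable mg1)
  (bounded_pos_density (bounded_bounded_pos g1M)).
have -> : N g w = Rintegral leb `[0, w] (fun y => g1 y * dA y).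
  apply: eq_Rintegral => y; rewrite inE /= in_itv /= => /andP[y0 yw].
  move: y0; rewrite le_eqVlt => /predU1P[<-|y0].
    by rewrite jacobi_density_nonpos// !mulr0.
  by rewrite /g1 patchE mem_set//= in_itv /= y0.
apply: le_trans (le_normr_Rintegral mI i1) _.
have ic : leb.-integrable `[0, w] (EFin \o (fun=> M * A w)).
  apply: measurable_bounded_integrable => //.
  - by rewrite /= lebesgue_measure_itv /=; case: ifPn => _; rewrite ?ltry// -EFinD ltry.
  - exists (M * A w); split; first exact: num_real.
    move=> K MK y _ /=; rewrite ger0_norm; first exact: ltW.
    by rewrite mulr_ge0// jacobi_weight_ge0.
have -> : M * (A w * w) = Rintegral leb `[0, w] (fun=> M * A w).
  rewrite Rintegral_cst// /= lebesgue_measure_itv /= lte_fin w0 -EFinD /= subr0.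
  by rewrite mulrA.
apply: le_Rintegral => //; first exact: (integrable_norm i1).
move=> y /=; rewrite in_itv /= => /andP[y0 yw]; rewrite normrM ler_pM//.
move: y0; rewrite le_eqVlt => /predU1P[<-|y0].
  by rewrite jacobi_density_nonpos// normr0 jacobi_weight_ge0.
rewrite (jacobi_density_pos y0) ger0_norm; last exact: jacobi_weight_ge0.
exact: (weight_nondecreasing wA y0 yw).
Qed.

End GreenPrimitiveForm.

Section Completeness.
Context {R : realType}.
Variables (alpha beta : R).
Hypotheses (hbeta : - 2^-1 <= beta) (hab : beta <= alpha)
  (halpha : - 2^-1 < alpha).
Variable phi : R[i] -> R -> R[i].
Hypothesis hphi : is_jacobi_function alpha beta phi.
Local Notation leb := (@lebesgue_measure R).
Local Notation mu := (jacobi_measure alpha beta).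
Local Notation b := (green_primitive alpha beta).
Local Notation T := (measurableTypeR R).
Local Notation e := (jexp alpha beta phi).
Local Notation J := (green_op alpha beta).
Local Notation I := (green_opT alpha beta).
Local Notation tame := (@tame _ T R mu e).
Implicit Types (x y z w c M : R) (f g k nu : T -> R).

Let e_ge1 z x : 0 <= z -> 1 <= e z x. Proof. exact: jexp_ge1. Qed.
Let me z : measurable_fun setT (e z : T -> R). Proof. exact: jexp_measurable. Qed.
Let e0 x : e 0 x = 1. Proof. exact: jexp0. Qed.

(** An ae property holds at points arbitrarily close to any point of the
    half-line, hence everywhere there if it is closed. *)
Lemma jacobi_ae_continuous_eq f c : {ae mu, forall x, f x = c} ->
  (forall x, 0 < x -> {for x, continuous f}) -> forall x, 0 < x -> f x = c.
Proof.
move=> fc cf w w0; apply/eqP; rewrite -subr_eq0; apply/negPn/negP => fw.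
have cN : {for w, continuous (fun x => `|f x - c|)}.
  apply: cvg_norm; apply: cvgB; [exact: cf|exact: cvg_cst].
have [|d d0 hd] := continuous_near_gt0 cN; first by rewrite normr_gt0.
have wd : w < w + d by rewrite ltrDl.
have [x /andP[wx xd] fx] :=
  lebesgue_ae_point wd (jacobi_ae_lebesgue hbeta hab halpha fc).
have : 0 < `|f x - c|.
  by apply: hd; rewrite ltr0_norm ?subr_lt0// opprB ltrBlDl.
by rewrite fx ?subrr ?normr0 ?ltxx// (lt_trans w0 wx).
Qed.

(** Once J nu = 0, the function I nu is constant by [tame_zero_green], which
    forces nu = 0. *)
Lemma null_transform_eq0 nu : null_transform alpha beta phi nu ->
  {ae mu, forall x, nu x = 0}.
Proof.
move=> nn; have [tn _] := nn; have n0 := null_transform_Int hbeta hab halpha hphi nn.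
have mn := tame_measurable tn; have [M nM] := tame_bounded tn.
have bn := bounded_bounded_pos nM.
have J0 := null_transform_green0 hbeta hab halpha hphi nn.
have Ic : {ae mu, forall x, I nu x = - green_const alpha beta nu}.
  move: J0; apply: (@filterS2 _ _ (ae_filter_ringOfSetsType mu)) (jacobi_ae_Rpos alpha beta) => x x0.
  by rewrite (tame_zero_green hbeta hab halpha hphi tn n0 x0) => /eqP;
    rewrite addr_eq0 => /eqP.
have Ic' := jacobi_ae_continuous_eq Ic
  (fun x px => green_opT_continuous hbeta hab halpha mn bn px).
have h (n : nat) : {ae mu, forall w, 0 < w < n%:R -> nu w = 0}.
  apply: (green_opT_const_eq0 hbeta hab halpha mn bn) => w /andP[w0 _].
  exact: Ic'.
have : {ae mu, forall w, forall n : nat, 0 < w < n%:R -> nu w = 0} by exact: ae_foralln.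
apply: (@filterS2 _ _ (ae_filter_ringOfSetsType mu)) (jacobi_ae_Rpos alpha beta) => x x0 hx.
apply: (hx (Num.bound x)); rewrite x0 /=.
by apply: archi_boundP; exact: ltW.
Qed.

Lemma tame_eq_transform f g : tame f -> tame g ->
  (forall z, 0 < z -> Int mu (fun x => f x * e z x) = Int mu (fun x => g x * e z x)) ->
  Int mu f = Int mu g -> {ae mu, forall x, f x = g x}.
Proof.
move=> tf tg fg fg0.
have : null_transform alpha beta phi (fun x => f x - g x).
  split; first exact: (tameB tf tg).
  move=> z; rewrite le_eqVlt => /predU1P[<-|z0].
    rewrite (_ : (fun x => _) = (fun x => f x - g x)); last first.
      by apply/funext => x; rewrite e0 mulr1.
    by rewrite (IntB (tame_int hbeta hab halpha hphi tf)
      (tame_int hbeta hab halpha hphi tg)) fg0 subrr.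
  rewrite (_ : (fun x => _) = (fun x => f x * e z x - g x * e z x)); last first.
    by apply/funext => x; rewrite mulrBl.
  by rewrite (IntB (tame_intg tf (ltW z0)) (tame_intg tg (ltW z0))) fg// subrr.
move=> /null_transform_eq0; apply: jacobi_aeS => x /eqP; rewrite subr_eq0.
by move/eqP.
Qed.

End Completeness.

(** * Translation kernels *)

Lemma Int_scale_ge0 d (T : measurableType d) (R : realType)
    (mu : {measure set T -> \bar R}) (c : R) (f : T -> R) :
  measurable_fun setT f -> (forall x, 0 <= f x) -> 0 <= c ->
  Int mu (fun x => c * f x) = c * Int mu f.
Proof.
move=> mf f0 c0; rewrite /Int /Rintegral.
under eq_integral do rewrite EFinM.
rewrite ge0_integralZl//; last 2 first.
- by apply/measurable_EFinP.
- by move=> x _; rewrite lee_fin.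
have : (0 <= \int[mu]_x (f x)%:E)%E by apply: integral_ge0 => x _; rewrite lee_fin.
case: (integral _ _ _) => [r| |]//= _; rewrite mulr0.
by move: c0; rewrite le_eqVlt => /predU1P[<-|c0]; rewrite ?mul0e// gt0_muley.
Qed.

Section TranslationKernel.
Context {R : realType}.
Variables (alpha beta : R).
Hypotheses (hbeta : - 2^-1 <= beta) (hab : beta <= alpha)
  (halpha : - 2^-1 < alpha).
Variable phi : R[i] -> R -> R[i].
Hypothesis hphi : is_jacobi_function alpha beta phi.
Variable W : R -> R -> R -> R.
Hypothesis hW : is_convolution_kernel alpha beta phi W.
Local Notation mu := (jacobi_measure alpha beta).
Local Notation T := (measurableTypeR R).
Local Notation e := (jexp alpha beta phi).
Local Notation rho := (jacobi_rho alpha beta).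
Local Notation E := (real_jacobi alpha beta phi).
Implicit Types (x y z u L c M : R) (f g k : T -> R).

Let e_ge1 z x : 0 <= z -> 1 <= e z x. Proof. exact: jexp_ge1. Qed.
Let me z : measurable_fun setT (e z : T -> R). Proof. exact: jexp_measurable. Qed.
Let e0 x : e 0 x = 1. Proof. exact: jexp0. Qed.

Definition positive_kernel x y u : R :=
  if [&& 0 < x, 0 < y & 0 < u] then W x y u else 0.
Local Notation Wp := positive_kernel.

Lemma Wp_ge0 x y u : 0 <= Wp x y u.
Proof. by rewrite /Wp; case: ifPn => // /and3P[x0 y0 u0]; exact: (kernel_ge0 hW). Qed.

Lemma Wp_sym12 x y u : Wp x y u = Wp y x u.
Proof.
rewrite /Wp andbCA; case: ifPn => // /and3P[y0 x0 u0]; exact: (kernel_sym12 hW).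
Qed.

Lemma Wp_sym23 x y u : Wp x y u = Wp x u y.
Proof.
rewrite /Wp [(0 < y) && _]andbC; case: ifPn => // /and3P[x0 u0 y0].
exact: (kernel_sym23 hW).
Qed.

Lemma Wp_pos x y u : 0 < x -> 0 < y -> 0 < u -> Wp x y u = W x y u.
Proof. by rewrite /Wp => -> -> ->. Qed.

Lemma Wp_nonpos x y u : x <= 0 -> Wp x y u = 0.
Proof. by move=> x0; rewrite /Wp ltNge x0. Qed.

Lemma Wp_measurable :
  measurable_fun setT (fun v : T * T * T => Wp v.1.1 v.1.2 v.2).
Proof.
pose D : set (T * T * T) := @Rpos R `*` @Rpos R `*` @Rpos R.
have mD : measurable D.
  by apply: measurableX; [apply: measurableX|]; exact: measurable_Rpos.
rewrite (_ : (fun v => _) = (fun v : T * T * T => W v.1.1 v.1.2 v.2) \_ D).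
  by apply/(measurable_restrictT _ mD); exact: (kernel_measurable hW).
apply/funext => -[[x y] u] /=; rewrite /Wp patchE.
case: ifPn => [/and3P[x0 y0 u0]|h].
  rewrite mem_set// /D /Rpos /=; split; [split|]; by rewrite /= in_itv /= andbT.
rewrite memNset// /D /Rpos /= => -[[]]; rewrite /= !in_itv /= !andbT.
by move=> x0 y0 u0; move/negP: h; apply; rewrite x0 y0 u0.
Qed.

Lemma Wp_measurable2 x : measurable2 (Wp x : T -> T -> R).
Proof.
have := Wp_measurable; rewrite /measurable2 => h.
apply: (measurableT_comp (f := fun v : T * T * T => Wp v.1.1 v.1.2 v.2)
  (g := fun v : T * T => ((x, v.1), v.2))) => //.
apply: measurable_fun_pair => //; apply: measurable_fun_pair => //.
Qed.

Lemma Wp_measurable1 x y : measurable_fun setT (Wp x y : T -> R).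
Proof. exact: measurable2_section (Wp_measurable2 x). Qed.

Lemma real_jacobi_measurable L : measurable_fun setT (E L : T -> R).
Proof. by apply: continuous_measurable_fun; exact: real_jacobi_continuous hphi _. Qed.

(** The product formula at the imaginary parameters, where everything is real. *)
Lemma Wp_product L x y : L <= rho ^+ 2 -> 0 < x -> 0 < y ->
  intg mu (fun u => E L u * Wp x y u) /\
  Int mu (fun u => E L u * Wp x y u) = E L x * E L y.
Proof.
move=> hL x0 y0; pose lam := imaginary_parameter rho L.
have phiE u : 0 < u -> phi lam u = (E L u)%:C%C.
  exact: (jacobi_imaginary_parameter hphi hbeta hab halpha hL).
have ReE : (@complex.Re R \o (fun u => phi lam u * (W x y u)%:C%C)) \_ (@Rpos R)
    = (fun u => E L u * Wp x y u).
  apply/funext => u; rewrite patchE; case: ifPn => [|hu].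
    rewrite inE /Rpos /= in_itv /= andbT => u0.
    by rewrite phiE// Wp_pos//= mulr0 subr0.
  rewrite /Wp x0 y0 /=; case: ifPn; last by rewrite mulr0.
  by move=> u0; move/negP: hu; rewrite inE /Rpos /= in_itv /= u0.
have [iR _] := kernel_integrable hW lam x0 y0.
have mR : measurable (@Rpos R : set T) by exact: measurable_Rpos.
split.
  move/(integrable_mkcond _ mR) : iR; rewrite /intg -ReE.
  by rewrite -restrict_EFin.
have := kernel_product hW lam x0 y0; rewrite !phiE// /cintegral => -[h _].
move: h; rewrite /= mulr0 subr0 => ->.
by rewrite Rintegral_mkcond ReE.
Qed.

Lemma Wp_mass x y : 0 < x -> 0 < y -> intg mu (Wp x y) /\ Int mu (Wp x y) = 1.
Proof.
move=> x0 y0; have h0 : (0 : R) <= rho ^+ 2 by exact: sqr_ge0.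
have := Wp_product h0 x0 y0.
have E0 u : E 0 u = 1 by have := e0 u; rewrite /jexp oppr0.
rewrite (_ : (fun u => E 0 u * Wp x y u) = Wp x y); last first.
  by apply/funext => u; rewrite E0 mul1r.
by rewrite !E0 mulr1.
Qed.

Section OneFunction.
Variable k : T -> R.
Hypothesis mk : measurable_fun setT k.
Hypothesis k0 : forall x, 0 <= k x.

Definition translation_kernel x y : R := Int mu (fun u => k u * Wp x y u).
Local Notation K := translation_kernel.

Lemma translation_kernel_ge0 x y : 0 <= K x y.
Proof. by apply: Int_ge0 => u; rewrite mulr_ge0 ?Wp_ge0. Qed.

Lemma translation_kernel_sym x y : K x y = K y x.
Proof. by congr (Int mu _); apply/funext => u; rewrite Wp_sym12. Qed.

Lemma translation_kernel_nonpos x y : x <= 0 -> K x y = 0.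
Proof.
move=> x0; rewrite /K -[RHS](Int0 mu); congr (Int mu _).
by apply/funext => u; rewrite Wp_nonpos// mulr0.
Qed.

Lemma translation_kernel_measurable : @measurable2 _ T R K.
Proof.
apply: measurableT_comp; first exact: fine_measurable.
apply: (measurable_fun_fubini_tonelli_F (m2 := mu)
  (fun v : (T * T) * T => (k v.2 * Wp v.1.1 v.1.2 v.2)%:E)).
  apply/measurable_EFinP; apply: measurable_funM; last exact: Wp_measurable.
  exact: (measurableT_comp mk).
by move=> v; rewrite lee_fin mulr_ge0 ?Wp_ge0.
Qed.

(** Symmetry of W in its three variables turns the integral in y into the
    product formula at (x, u). *)
Lemma translation_kernel_eigen L x : L <= rho ^+ 2 ->
  (forall y, 0 <= E L y) ->
  intg mu (fun u => k u * E L u) -> 0 < x ->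
  intg mu (fun y => K x y * E L y) /\
  Int mu (fun y => K x y * E L y) = Int mu (fun u => k u * E L u) * E L x.
Proof.
move=> hL EL0 hk x0.
have hF : intg2 mu (fun y u => E L y * (k u * Wp x y u)).
  apply: (@intg2_swap _ T R mu (fun u y => E L y * (k u * Wp x y u))).
  apply: (@intg2_bound _ T R mu _ (fun u => E L x * (k u * E L u))).
  - apply: measurable2_mul.
      by apply: measurable2_snd; exact: real_jacobi_measurable.
    apply: measurable2_mul; first exact: measurable2_fst.
    exact: (measurable2_swap (Wp_measurable2 x)).
  - exact: intgZ.
  - move=> u.
    rewrite (_ : integral _ _ _ = (\int[mu]_y (k u * (E L y * Wp x u y))%:E)%E); last first.
      apply: eq_integral => y _; rewrite ger0_norm ?mulr_ge0 ?Wp_ge0//.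
      by rewrite Wp_sym23 mulrCA.
    have [u0|u0] := ltP 0 u.
      have [i1 E1] := Wp_product hL x0 u0.
      rewrite IntE; last exact: intgZ.
      by rewrite (IntZ _ i1) E1 lee_fin mulrCA.
    rewrite integral0_eq; first by rewrite lee_fin !mulr_ge0.
    by move=> y _; rewrite Wp_sym12 Wp_nonpos// !mulr0.
have IE y : Int mu (fun u => E L y * (k u * Wp x y u)) = K x y * E L y.
  rewrite Int_scale_ge0// 1?mulrC//.
    apply: measurable_funM => //; exact: Wp_measurable1.
  by move=> u; rewrite mulr_ge0 ?Wp_ge0.
have h1 := intg2_Int hF; have h2 := intg2_Fubini hF.
rewrite (_ : (fun y => Int mu _) = (fun y => K x y * E L y)) in h1 h2; last exact/funext.
split => //; rewrite h2 mulrC -(IntZ (E L x) hk).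
apply: Int_ae.
- exact: intg_measurable (intg2_Int (intg2_swap hF)).
- by apply: measurable_funM => //; apply: measurable_funM => //; exact: real_jacobi_measurable.
- apply: jacobi_ae_pos => u u0; have [i1 E1] := Wp_product hL x0 u0.
  rewrite (_ : (fun y => _) = (fun y => k u * (E L y * Wp x u y))).
    by rewrite (IntZ _ i1) E1; ring.
  by apply/funext => y; rewrite Wp_sym23; ring.
Qed.

Lemma translation_transform_kernel :
  (forall z, 0 <= z -> intg mu (fun u => k u * e z u)) ->
  @transform_kernel _ T R mu e (fun z => Int mu (fun u => k u * e z u)) K.
Proof.
move=> hk.
have hz z : 0 <= z -> - z <= rho ^+ 2.
  by move=> z0; rewrite (@le_trans _ _ 0) ?oppr_le0// sqr_ge0.
have ez z y : 0 <= z -> 0 <= E (- z) y.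
  by move=> z0; exact: le_trans ler01 (e_ge1 y z0).
have eig z x : 0 <= z -> 0 < x ->
    intg mu (fun y => K x y * e z y) /\
    Int mu (fun y => K x y * e z y) = Int mu (fun u => k u * e z u) * e z x.
  move=> z0 x0; apply: translation_kernel_eigen => //; first exact: hz.
    by move=> y; exact: ez.
  exact: hk.
have neg z x : x <= 0 -> (fun y => K x y * e z y) = (fun=> 0).
  by move=> x0; apply/funext => y; rewrite translation_kernel_nonpos// mul0r.
have hat0 z x : 0 <= z -> 0 <= Int mu (fun u => k u * e z u) * e z x.
  by move=> z0; rewrite mulr_ge0 ?ez// Int_ge0// => u; rewrite mulr_ge0 ?ez.
split.
- exact: translation_kernel_measurable.
- exact: translation_kernel_ge0.
- exact: translation_kernel_sym.
- move=> z x z0; have [x0|x0] := ltP 0 x; first exact: (eig z x z0 x0).1.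
  by rewrite neg//; exact: intg0.
- move=> z x z0; rewrite /kernel_op; have [x0|x0] := ltP 0 x.
    by rewrite (eig z x z0 x0).2.
  by rewrite neg// Int0 hat0.
- by move=> z z0; apply: jacobi_ae_pos => x x0; rewrite /kernel_op (eig z x z0 x0).2.
Qed.

End OneFunction.

End TranslationKernel.

(** * The heat semigroup on bounded functions *)

Section HeatSemigroup.
Context {R : realType}.
Variables (alpha beta : R).
Hypotheses (hbeta : - 2^-1 <= beta) (hab : beta <= alpha)
  (halpha : - 2^-1 < alpha).
Variable phi : R[i] -> R -> R[i].
Hypothesis hphi : is_jacobi_function alpha beta phi.
Variable W : R -> R -> R -> R.
Hypothesis hW : is_convolution_kernel alpha beta phi W.
Variable h : R -> R -> R.
Hypothesis hh : is_heat_kernel alpha beta phi h.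
Local Notation mu := (jacobi_measure alpha beta).
Local Notation A := (jacobi_weight alpha beta).
Local Notation T := (measurableTypeR R).
Local Notation e := (jexp alpha beta phi).
Local Notation rho := (jacobi_rho alpha beta).
Local Notation E := (real_jacobi alpha beta phi).
Local Notation K := (translation_kernel alpha beta W).
Local Notation tame := (@tame _ T R mu e).
Local Notation op := (@kernel_op _ T R mu).
Implicit Types (x y z u t s L c M : R) (f g k : T -> R).

Let e_ge1 z (x : T) : 0 <= z -> 1 <= e z x. Proof. exact: jexp_ge1. Qed.
Let me z : measurable_fun setT (e z : T -> R). Proof. exact: jexp_measurable. Qed.
Let e0 (x : T) : e 0 x = 1. Proof. exact: jexp0. Qed.

Definition heat_pos t : T -> R := (h t) \_ (@Rpos R).

Lemma heat_pos_ge0 t x : 0 < t -> 0 <= heat_pos t x.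
Proof.
move=> t0; rewrite /heat_pos patchE; case: ifPn => // .
by rewrite inE /Rpos /= in_itv /= andbT => x0; exact: (heat_ge0 hh).
Qed.

Lemma heat_pos_measurable t : 0 < t -> measurable_fun setT (heat_pos t).
Proof.
move=> t0; apply/(measurable_restrictT _ (@measurable_Rpos R)).
by have [[m1 _] _] := heat_Lp hh t0 (lexx 1).
Qed.

Lemma heat_pos_transform t L : 0 < t -> L <= rho ^+ 2 ->
  intg mu (fun u => heat_pos t u * E L u) /\
  Int mu (fun u => heat_pos t u * E L u) = expR (- t * L).
Proof.
move=> t0 hL; pose lam := imaginary_parameter rho L.
have phiE u : 0 < u -> phi lam u = (E L u)%:C%C.
  exact: (jacobi_imaginary_parameter hphi hbeta hab halpha hL).
have ReE : (@complex.Re R \o (fun u => (h t u)%:C%C * phi lam u)) \_ (@Rpos R)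
    = (fun u => heat_pos t u * E L u).
  apply/funext => u; rewrite /heat_pos !patchE; case: ifPn => [|_]; last by rewrite mul0r.
  rewrite inE /Rpos /= in_itv /= andbT => u0.
  by rewrite phiE//= mulr0 subr0.
have [iR _] := heat_integrable hh lam t0.
have mR : measurable (@Rpos R : set T) by exact: measurable_Rpos.
split.
  move/(integrable_mkcond _ mR) : iR; rewrite /intg -ReE.
  by rewrite -restrict_EFin.
have := congr1 (@complex.Re R) (heat_transform hh lam t0).
rewrite imaginary_parameterE// /jacobi_transform /cintegral /= Rintegral_mkcond ReE.
move=> hE; rewrite /Int hE /cexp /=.
by rewrite !(mul0r, mulr0, subr0, addr0, oppr0, cos0, mulr1).
Qed.

Lemma transform_kernel_ext hat hat' (k : T -> T -> R) : (forall z, 0 <= z -> hat z = hat' z) ->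
  @transform_kernel _ T R mu e hat k -> @transform_kernel _ T R mu e hat' k.
Proof.
move=> hE [m0 p0 s0 i0 l0 a0]; split => //.
- by move=> z x z0; rewrite -hE//; exact: l0.
- by move=> z z0; rewrite -hE//; exact: a0.
Qed.

Local Notation S t := (translation_kernel alpha beta W (heat_pos t)).

Lemma heat_transform_kernel t : 0 < t ->
  @transform_kernel _ T R mu e (fun z => expR (t * z)) (S t).
Proof.
move=> t0.
have hz z : 0 <= z -> - z <= rho ^+ 2.
  by move=> z0; rewrite (@le_trans _ _ 0) ?oppr_le0// sqr_ge0.
apply: transform_kernel_ext (translation_transform_kernel hbeta hab halpha hphi hW
  (heat_pos_measurable t0) (fun x => heat_pos_ge0 x t0) _).
- by move=> z z0; rewrite (heat_pos_transform t0 (hz z z0)).2 mulrNN.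
- by move=> z z0; exact: (heat_pos_transform t0 (hz z z0)).1.
Qed.

Lemma compact_support_tame f M n : measurable_fun setT f -> (forall x, `|f x| <= M) ->
  (forall x, ~ (- n <= x <= n) -> f x = 0) -> tame f.
Proof.
move=> mf fM f0; split => //; first by exists M.
move=> z z0; have M0 : 0 <= M by exact: le_trans (fM 0).
have [n0|n0] := ltP n 0.
  rewrite (_ : (fun x => _) = (fun=> 0)); first exact: intg0.
  apply/funext => x; rewrite f0 ?mul0r// => /andP[h1 h2].
  by have := le_lt_trans (le_trans h1 h2) n0; rewrite oppr_lt0 => /(lt_trans n0); rewrite ltxx.
have ce : {within `[- n, n], continuous (e z)}.
  by apply: continuous_subspaceT; exact: real_jacobi_continuous hphi _.
have [c _ hc] := EVT_max (ge0_cp n0).2 ce.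
have ec0 : 0 <= e z c by exact: le_trans (e_ge1 c z0).
pose B : set T := [set` `[- n, n]].
have mB : measurable B by exact: measurable_itv.
have muB : (mu B < +oo)%E.
  rewrite /jacobi_measure.
  apply: (@le_lt_trans _ _ (\int[@lebesgue_measure R]_(x in B `&` @Rpos R) (A n)%:E)%E).
    apply: ge0_le_integral.
    - by apply: measurableI => //; exact: measurable_Rpos.
    - by move=> x _; rewrite lee_fin jacobi_weight_ge0.
    - by apply/measurable_EFinP; apply: measurable_funTS; exact: measurable_jacobi_weight.
    - exact: measurable_cst.
    - move=> x []; rewrite /B /Rpos /= !in_itv /= andbT => /andP[_ xn] x0.
      rewrite lee_fin; exact: (weight_nondecreasing (jacobi_sturm_weight hbeta hab halpha)).
  rewrite integral_cst; last by apply: measurableI => //; exact: measurable_Rpos.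
  apply: (@le_lt_trans _ _ ((A n)%:E * (@lebesgue_measure R) B)%E).
    apply: lee_wpmul2l; first by rewrite lee_fin jacobi_weight_ge0.
    apply: le_measure; rewrite ?inE//; apply: measurableI => //; exact: measurable_Rpos.
  rewrite lebesgue_measure_itv /=; case: ifPn => _; rewrite ?mule0 ?ltry//.
have iB : intg mu (\1_B : T -> R).
  apply/integrableP; split; first exact/measurable_EFinP/measurable_indic.
  rewrite (_ : integral _ _ _ = (\int[mu]_x (\1_B x)%:E)%E); last first.
    by apply: eq_integral => x _ /=; rewrite ger0_norm.
  by rewrite integral_indic// setIT.
apply: (intg_le _ _ (intgZ (M * e z c) iB)); first exact: measurable_funM.
move=> x; rewrite indicE; case: (boolP (x \in B)) => [|hx].
  move=> /set_mem xB; rewrite mulr1 normrM ler_pM//.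
  by rewrite ger0_norm ?hc//; exact: le_trans (e_ge1 x z0).
rewrite f0 ?mul0r ?normr0 ?mulr0//.
by move=> xn; move/negP: hx; apply; apply/mem_set; rewrite /B /= in_itv.
Qed.

Lemma heat_op_bounded t f M : 0 < t -> measurable_fun setT f ->
  (forall x, `|f x| <= M) -> forall x, `|op (S t) f x| <= M.
Proof.
move=> t0 mf fM x.
have := op_bounded e0 (heat_transform_kernel t0) x mf fM.
by rewrite mulr0 expR0 mulr1.
Qed.

Lemma heat_op_measurable t f : 0 < t -> measurable_fun setT f ->
  measurable_fun setT (op (S t) f).
Proof. by move=> t0 mf; exact (op_measurable (heat_transform_kernel t0) mf). Qed.

(** Both sides have the same transform. *)
Lemma heat_semigroup_tame t g : 0 < t -> tame g ->
  {ae mu, forall x, op (S t) (op (S t) g) x = op (S (t + t)) g x}.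
Proof.
move=> t0 tg; have tt0 : 0 < t + t by exact: addr_gt0.
have k1 := heat_transform_kernel t0; have k2 := heat_transform_kernel tt0.
have t1 := op_tame me e_ge1 e0 k1 tg.
have t2 := op_tame me e_ge1 e0 k1 t1; have t3 := op_tame me e_ge1 e0 k2 tg.
have hat z : 0 <= z -> Int mu (fun x => op (S t) (op (S t) g) x * e z x) =
    Int mu (fun x => op (S (t + t)) g x * e z x).
  move=> z0; rewrite (op_transform me e_ge1 e0 k1 t1 z0).
  rewrite (op_transform me e_ge1 e0 k1 tg z0) (op_transform me e_ge1 e0 k2 tg z0).
  by rewrite mulrA -expRD -mulrDl.
apply: (tame_eq_transform hbeta hab halpha hphi t2 t3).
  by move=> z z0; exact/hat/ltW.
have := hat 0 (lexx 0).
rewrite (_ : (fun x => _) = op (S t) (op (S t) g)).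
  by rewrite (_ : (fun x => _) = op (S (t + t)) g)//; apply/funext => x; rewrite e0 mulr1.
by apply/funext => x; rewrite e0 mulr1.
Qed.

(** Indicators of bounded intervals are tame, and they exhaust the line. *)
Lemma bounded_eq_of_tame f g M N : measurable_fun setT f -> measurable_fun setT g ->
  (forall x, `|f x| <= M) -> (forall x, `|g x| <= N) ->
  (forall q, tame q -> Int mu (fun x => f x * q x) = Int mu (fun x => g x * q x)) ->
  {ae mu, forall x, f x = g x}.
Proof.
move=> mf mg fM gN fg.
pose En (n : nat) : set T := [set` `[- n%:R, n%:R]].
have mEn n : measurable (En n) by exact: measurable_itv.
have tEn n : tame (\1_(En n)).
  apply: (@compact_support_tame _ 1 n%:R); first exact: measurable_indic.
    by move=> x; rewrite indicE; case: (_ \in _); rewrite ?normr1 ?normr0.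
  by move=> x hx; rewrite indicE memNset// /En /= in_itv.
have fgM x : `|f x - g x| <= M + N.
  by apply: le_trans (ler_normB _ _) _; rewrite lerD.
have cE x : exists n : nat, En n x.
  exists (Num.bound `|x|); rewrite /En /= in_itv /= -ler_norml ltW//.
  exact: archi_boundP.
have := tame_test_eq0 me e0 (measurable_funB mf mg) fgM mEn tEn cE.
have hq q : tame q -> Int mu (fun x => (f x - g x) * q x) = 0.
  move=> tq; rewrite (_ : (fun x => _) = (fun x => f x * q x - g x * q x)); last first.
    by apply/funext => x; rewrite mulrBl.
  have iq := tame_int hbeta hab halpha hphi tq.
  rewrite (IntB (intg_mul_bounded mf fM iq) (intg_mul_bounded mg gN iq)).
  by rewrite fg// subrr.
move=> /(_ hq); apply: jacobi_aeS => x /eqP; rewrite subr_eq0; by move/eqP.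
Qed.

(** By duality from tame functions, since bounded functions need not have a
    transform. *)
Lemma heat_semigroup t f M : 0 < t -> measurable_fun setT f ->
  (forall x, `|f x| <= M) ->
  {ae mu, forall x, op (S t) (op (S t) f) x = op (S (t + t)) f x}.
Proof.
move=> t0 mf fM; have tt0 : 0 < t + t by exact: addr_gt0.
have k1 := heat_transform_kernel t0; have k2 := heat_transform_kernel tt0.
have mS := heat_op_measurable t0 mf; have bS := heat_op_bounded t0 mf fM.
apply: (bounded_eq_of_tame (heat_op_measurable t0 mS) (heat_op_measurable tt0 mf)
  (heat_op_bounded t0 mS bS) (heat_op_bounded tt0 mf fM)) => q tq.
have tSq := op_tame me e_ge1 e0 k1 tq.
rewrite -(op_adjoint_tame e_ge1 e0 k1 mS bS tq).
rewrite -(op_adjoint_tame e_ge1 e0 k1 mf fM tSq).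
rewrite -(op_adjoint_tame e_ge1 e0 k2 mf fM tq).
apply: Int_ae.
- apply: measurable_funM => //.
  exact: tame_measurable (op_tame me e_ge1 e0 k1 tSq).
- apply: measurable_funM => //.
  exact: tame_measurable (op_tame me e_ge1 e0 k2 tq).
- by move: (heat_semigroup_tame t0 tq); apply: jacobi_aeS => x ->.
Qed.

(** Eigenvectors of S (2 t) are eigenvectors of S t, for the positive square
    root of the eigenvalue: on their span, the square root of opposite sign
    would contradict the positivity of S t = (S (t / 2))^2. *)
Lemma heat_eigen_halve t c f M : 0 < t -> 0 < c -> measurable_fun setT f ->
  (forall x, `|f x| <= M) -> intg mu (fun x => f x ^+ 2) ->
  {ae mu, forall x, op (S (t + t)) f x = c ^+ 2 * f x} ->
  {ae mu, forall x, op (S t) f x = c * f x}.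
Proof.
move=> t0 c0 mf fM f2 Sf.
have th0 : 0 < t / 2 by rewrite divr_gt0.
have k1 := heat_transform_kernel t0; have kh := heat_transform_kernel th0.
have mS := heat_op_measurable t0 mf; have bS := heat_op_bounded t0 mf fM.
have hat1 s : expR (s * 0) = 1 by rewrite mulr0 expR0.
have sqS := op_square e_ge1 e0 k1 (hat1 t) mf fM f2.
pose g : T -> R := fun x => op (S t) f x - c * f x.
have mg : measurable_fun setT g by apply: measurable_funB => //; exact: measurable_funM.
have gM x : `|g x| <= M + c * M.
  apply: le_trans (ler_normB _ _) _; rewrite lerD// normrM (gtr0_norm c0).
  by rewrite ler_wpM2l// ltW.
have g2 : intg mu (fun x => g x ^+ 2).
  have h1 := intgD (intgZ 2 sqS) (intgZ (2 * c ^+ 2) f2).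
  apply: (intg_le _ _ h1); first exact: measurable_funX.
  move=> x; rewrite ger0_norm ?sqr_ge0// /g -subr_ge0.
  rewrite [X in 0 <= X](_ : _ = (op (S t) f x + c * f x) ^+ 2) ?sqr_ge0//; ring.
have Sg : {ae mu, forall x, op (S t) g x = - c * g x}.
  have SSf := heat_semigroup t0 mf fM.
  move: Sf; apply: (@filterS2 _ _ (ae_filter_ringOfSetsType mu)) SSf => x h1 h2.
  have -> : op (S t) g x = op (S t) (op (S t) f) x - c * op (S t) f x.
    have i1 := kernel_intg_bounded e0 k1 x mS bS.
    have i2 := kernel_intg_bounded e0 k1 x mf fM.
    rewrite /kernel_op -(IntZ c i2) -IntB//; last exact: intgZ.
    by congr (Int mu _); apply/funext => y; rewrite /g /kernel_op; ring.
  by rewrite h1 h2 /g; ring.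
have SSg := heat_semigroup th0 mg gM; rewrite -splitr in SSg.
have bh := heat_op_bounded th0 mg gM; have mh := heat_op_measurable th0 mg.
have sqh := op_square e_ge1 e0 kh (hat1 _) mg gM g2.
have pos : 0 <= Int mu (fun x => g x * op (S t) g x).
  rewrite (_ : Int mu _ = Int mu (fun x => g x * op (S (t / 2)) (op (S (t / 2)) g) x)).
    rewrite (op_adjoint_square e_ge1 e0 kh mg mh gM bh g2 sqh).
    by apply: Int_ge0 => x; rewrite -expr2 sqr_ge0.
  apply: Int_ae.
  - exact (measurable_funM mg (heat_op_measurable t0 mg)).
  - exact (measurable_funM mg (heat_op_measurable th0 mh)).
  - by move: SSg; apply: jacobi_aeS => x ->.
have neg : Int mu (fun x => g x * op (S t) g x) = - c * Int mu (fun x => g x ^+ 2).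
  rewrite -(IntZ (- c) g2); apply: Int_ae.
  - exact (measurable_funM mg (heat_op_measurable t0 mg)).
  - exact (intg_measurable (intgZ (- c) g2)).
  - by move: Sg; apply: jacobi_aeS => x ->; ring.
have g20 : Int mu (fun x => g x ^+ 2) = 0.
  apply/eqP; rewrite eq_le Int_ge0; last by move=> x; exact: sqr_ge0.
  by rewrite andbT; move: pos; rewrite neg mulNr oppr_ge0 pmulr_rle0.
move: (Int_square_eq0 mg g2 g20); apply: jacobi_aeS => x /eqP.
by rewrite /g subr_eq0 => /eqP.
Qed.

End HeatSemigroup.

(** * The generator of the heat semigroup in weak form *)

Lemma expR_quadratic {R : realType} (x : R) : `|x| <= 2^-1 ->
  0 <= expR x - 1 - x <= 2 * x ^+ 2.
Proof.
move=> hx; have hx' : x <= 2^-1 by exact: le_trans (ler_norm _) hx.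
apply/andP; split; first by rewrite -addrA -opprD subr_ge0 expR_ge1Dx.
have h1 : 0 < 1 - x by move: hx'; lra.
have h2 : (1 - x) * expR x <= 1.
  rewrite -[leRHS](@expRxMexpNx_1 _ x) mulrC ler_wpM2l ?expR_ge0//.
  exact: expR_ge1Dx.
rewrite -(ler_pM2l h1).
have : 0 <= x ^+ 2 * (2^-1 - x) by rewrite mulr_ge0 ?sqr_ge0 ?subr_ge0.
move: h2; set E := expR x; rewrite !mulrBr; move=> h2 h3; nra.
Qed.

Section Generator.
Context {R : realType}.
Variables (alpha beta : R).
Hypotheses (hbeta : - 2^-1 <= beta) (hab : beta <= alpha)
  (halpha : - 2^-1 < alpha).
Variable phi : R[i] -> R -> R[i].
Hypothesis hphi : is_jacobi_function alpha beta phi.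
Variable W : R -> R -> R -> R.
Hypothesis hW : is_convolution_kernel alpha beta phi W.
Variable h : R -> R -> R.
Hypothesis hh : is_heat_kernel alpha beta phi h.
Local Notation mu := (jacobi_measure alpha beta).
Local Notation T := (measurableTypeR R).
Local Notation e := (jexp alpha beta phi).
Local Notation rho := (jacobi_rho alpha beta).
Local Notation K := (translation_kernel alpha beta W).
Local Notation tame := (@tame _ T R mu e).
Local Notation op := (@kernel_op _ T R mu).
Local Notation superexp := (superexp alpha beta phi).
Local Notation J := (green_op alpha beta).
Local Notation I := (green_opT alpha beta).
Local Notation hp := (heat_pos h).
Local Notation S t := (translation_kernel alpha beta W (heat_pos h t)).
Implicit Types (x y z u t s L c M : R) (f g k : T -> R).

Let e_ge1 z (x : T) : 0 <= z -> 1 <= e z x. Proof. exact: jexp_ge1. Qed.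
Let me z : measurable_fun setT (e z : T -> R). Proof. exact: jexp_measurable. Qed.
Let e0 (x : T) : e 0 x = 1. Proof. exact: jexp0. Qed.

Lemma heat_pos_superexp s : 0 < s -> superexp (hp s).
Proof.
move=> s0; split; first exact (heat_pos_measurable hh s0).
move=> z z0; have hz : - z <= rho ^+ 2.
  by rewrite (@le_trans _ _ 0) ?oppr_le0// sqr_ge0.
exact: (heat_pos_transform hbeta hab halpha hphi hh s0 hz).1.
Qed.

Lemma heat_pos_jexp s z : 0 < s -> 0 <= z ->
  Int mu (fun x => hp s x * e z x) = expR (s * z).
Proof.
move=> s0 z0; have hz : - z <= rho ^+ 2.
  by rewrite (@le_trans _ _ 0) ?oppr_le0// sqr_ge0.
by rewrite (heat_pos_transform hbeta hab halpha hphi hh s0 hz).2 mulrNN.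
Qed.

Lemma heat_pos_mass s : 0 < s -> Int mu (hp s) = 1.
Proof.
move=> s0; have := heat_pos_jexp s0 (lexx 0); rewrite mulr0 expR0 => <-.
by congr (Int mu _); apply/funext => x; rewrite e0 mulr1.
Qed.

Lemma green_op_ge0 k x : (forall y, 0 <= k y) -> 0 <= J k x.
Proof.
move=> k0; apply: Int_ge0 => y; rewrite mulr_ge0//; exact: green_ge0.
Qed.

(** The first-order coefficient of the Taylor formula below; it is s + O(s^2). *)
Definition heat_drift s : R := Int mu (J (hp s)).

Let sJ s : 0 < s -> superexp (J (hp s)).
Proof.
by move=> s0; apply: (green_op_superexp hbeta hab halpha hphi); exact: heat_pos_superexp.
Qed.

Let J0 s x : 0 < s -> 0 <= J (hp s) x.
Proof. by move=> s0; apply: green_op_ge0 => y; exact: heat_pos_ge0 hh _ _ _. Qed.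

Lemma heat_green_jexp s z : 0 < s -> 0 < z ->
  Int mu (fun x => J (hp s) x * e z x) = (expR (s * z) - 1) / z.
Proof.
move=> s0 z0; rewrite (green_op_transform hbeta hab halpha hphi z0 (heat_pos_superexp s0)).
by rewrite heat_pos_mass// heat_pos_jexp// ltW.
Qed.

(** The mean of J h_s is the limit at z = 0 of its transform (e^(sz) - 1) / z,
    because e_z <= 1 + z (e_1 - 1). *)
Lemma heat_drift_bounds s : 0 < s -> s <= heat_drift s <= expR s - 1.
Proof.
move=> s0; have [_ hJ] := sJ s0; have i0 := superexp_intg hbeta hab halpha hphi (sJ s0).
have i1 : intg mu (fun x => J (hp s) x * e 1 x) by exact: hJ.
have E1 := heat_green_jexp s0 ltr01; rewrite mulr1 divr1 in E1.
apply/andP; split; last first.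
  rewrite -E1; apply: Int_le => // x.
  by rewrite -[leLHS]mulr1 ler_wpM2l ?J0 ?e_ge1.
pose D := Int mu (fun x => J (hp s) x * e 1 x) - heat_drift s.
have hz z : 0 < z -> z <= 1 -> s <= heat_drift s + z * D.
  move=> z0 z1; apply: (@le_trans _ _ ((expR (s * z) - 1) / z)).
    by rewrite ler_pdivlMr// lerBrDl expR_ge1Dx.
  rewrite -(heat_green_jexp s0 z0) /heat_drift /D.
  have i2 := intgB i1 i0.
  rewrite -(IntB i1 i0) -(IntZ z i2) -(IntD i0 (intgZ z i2)).
  apply: Int_le; [exact: hJ (ltW z0)|exact: intgD i0 (intgZ z i2)|move=> x].
  have := @jexp_convex R alpha beta hbeta hab halpha phi hphi z x.
  rewrite (ltW z0) z1 => /(_ isT) hc; have := J0 x s0; nra.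
apply/ler_addgt0Pr => eps eps0.
have D0 : 0 < `|D| + 1 by rewrite ltr_wpDl.
pose z := Num.min 1 (eps / (`|D| + 1)).
have z0 : 0 < z by rewrite lt_min ltr01 divr_gt0.
apply: le_trans (hz z z0 _) _; first by rewrite ge_min lexx.
rewrite lerD2l; apply: le_trans (ler_norm _) _; rewrite normrM (gtr0_norm z0).
apply: (@le_trans _ _ (eps / (`|D| + 1) * `|D|)); first by rewrite ler_wpM2r// ge_min lexx orbT.
by rewrite -mulrA ler_piMr ?ltW// mulrC ltr_pdivrMr// mul1r ltrDl.
Qed.

(** Its translation kernel is the remainder of the Taylor formula below. *)
Definition heat_curvature s : T -> R := J (J (hp s)).

Lemma heat_curvature_kernel s : 0 < s ->
  @transform_kernel _ T R mu e
    (fun z => Int mu (fun x => heat_curvature s x * e z x)) (K (heat_curvature s)).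
Proof.
move=> s0; have [m1 h1] := green_op_superexp hbeta hab halpha hphi (sJ s0).
apply: (translation_transform_kernel hbeta hab halpha hphi hW m1 _ h1) => x.
by apply: green_op_ge0 => y; exact: J0.
Qed.

Lemma heat_curvature_jexp s z : 0 < s -> 0 < z ->
  Int mu (fun x => heat_curvature s x * e z x) =
  ((expR (s * z) - 1) / z - heat_drift s) / z.
Proof.
move=> s0 z0; rewrite /heat_curvature.
rewrite (green_op_transform hbeta hab halpha hphi z0 (sJ s0)).
by rewrite heat_green_jexp.
Qed.

Lemma heat_curvature_mass s : 0 < s ->
  Int mu (fun x => heat_curvature s x * e 0 x) <= expR s - 1 - s.
Proof.
move=> s0; have [_ h1] := green_op_superexp hbeta hab halpha hphi (sJ s0).
have [b1 _] := andP (heat_drift_bounds s0).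
apply: (@le_trans _ _ (Int mu (fun x => heat_curvature s x * e 1 x))).
  apply: Int_le; [exact: h1|exact: h1|move=> x].
  by rewrite e0 ler_wpM2l ?e_ge1//; apply: green_op_ge0 => y; exact: J0.
by rewrite heat_curvature_jexp// mulr1 !divr1 lerD2l lerN2.
Qed.

Section TestFunction.
Variable chi : T -> R.
Hypothesis tchi : tame chi.
Hypothesis chi0 : Int mu chi = 0.
Hypothesis chi1 : Int mu (J chi) = 0.

Let t1 : tame (J chi). Proof. exact: green_op_tame. Qed.
Let t2 : tame (J (J chi)). Proof. exact: green_op_tame. Qed.

(** Taylor formula of order two of the heat semigroup on the range of J^2,
    where -J inverts the generator; both sides have the same transform. *)
Lemma heat_taylor s : 0 < s ->
  {ae mu, forall x, op (S s) (J (J chi)) x - J (J chi) x - heat_drift s * J chi x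
    = op (K (heat_curvature s)) chi x}.
Proof.
move=> s0; have kS := heat_transform_kernel hbeta hab halpha hphi hW hh s0.
have kU := heat_curvature_kernel s0.
have t3 := op_tame me e_ge1 e0 kS t2; have t4 := op_tame me e_ge1 e0 kU tchi.
have t5 := tameB (tameB t3 t2) (tameZ (heat_drift s) t1).
have sp1 z : 0 < z -> Int mu (fun x => J chi x * e z x) = Int mu (fun x => chi x * e z x) / z.
  move=> z0; rewrite (green_op_transform hbeta hab halpha hphi z0 (tame_superexp tchi)).
  by rewrite chi0 subr0.
have sp2 z : 0 < z -> Int mu (fun x => J (J chi) x * e z x)
    = Int mu (fun x => chi x * e z x) / z / z.
  move=> z0; rewrite (green_op_transform hbeta hab halpha hphi z0 (tame_superexp t1)).
  by rewrite chi1 subr0 sp1.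
have lin z : 0 <= z -> Int mu (fun x => (op (S s) (J (J chi)) x - J (J chi) x
     - heat_drift s * J chi x) * e z x) =
    (expR (s * z) - 1) * Int mu (fun x => J (J chi) x * e z x)
    - heat_drift s * Int mu (fun x => J chi x * e z x).
  move=> z0; rewrite mulrBl mul1r -(op_transform me e_ge1 e0 kS t2 z0).
  have j1 := tame_intg t3 z0; have j2 := tame_intg t2 z0; have j3 := tame_intg t1 z0.
  rewrite -(IntZ _ j3) -(IntB j1 j2) -(IntB (intgB j1 j2) (intgZ _ j3)).
  by congr (Int mu _); apply/funext => x; ring.
apply: (tame_eq_transform hbeta hab halpha hphi t5 t4).
  move=> z z0; rewrite (op_transform me e_ge1 e0 kU tchi (ltW z0)) lin ?ltW//.
  rewrite heat_curvature_jexp// sp1// sp2//; field; exact: lt0r_neq0.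
have E0 k : Int mu k = Int mu (fun x => k x * e 0 x).
  by congr (Int mu _); apply/funext => x; rewrite e0 mulr1.
rewrite E0 lin// [RHS]E0 (op_transform me e_ge1 e0 kU tchi (lexx 0)).
by rewrite -!E0 chi0 chi1 mulr0 expR0 subrr mul0r !mulr0 subrr.
Qed.

(** The remainder is an operator of norm at most e^s - 1 - s on bounded functions. *)
Lemma heat_taylor_pairing s f B c : 0 < s -> measurable_fun setT f ->
  (forall x, `|f x| <= B) -> {ae mu, forall x, op (S s) f x = c * f x} ->
  `|(c - 1) * Int mu (fun x => f x * J (J chi) x)
    - heat_drift s * Int mu (fun x => f x * J chi x)| <=
  B * (expR s - 1 - s) * Int mu (fun x => `|chi x|).
Proof.
move=> s0 mf fB Sf; have kS := heat_transform_kernel hbeta hab halpha hphi hW hh s0.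
have kU := heat_curvature_kernel s0.
have t3 := op_tame me e_ge1 e0 kS t2; have t4 := op_tame me e_ge1 e0 kU tchi.
have j1 := intg_mul_bounded mf fB (tame_int hbeta hab halpha hphi t1).
have j2 := intg_mul_bounded mf fB (tame_int hbeta hab halpha hphi t2).
have j3 := intg_mul_bounded mf fB (tame_int hbeta hab halpha hphi t3).
have B0 : 0 <= B by exact: le_trans (fB 0).
have m1 := tame_measurable t1; have m2 := tame_measurable t2.
have m3 := tame_measurable t3; have m4 := tame_measurable t4.
have EE : Int mu (fun x => f x * op (S s) (J (J chi)) x)
    = c * Int mu (fun x => f x * J (J chi) x).
  rewrite (op_adjoint_tame e_ge1 e0 kS mf fB t2) -(IntZ c j2); apply: Int_ae.
  - exact (measurable_funM (op_measurable kS mf) m2).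
  - exact (intg_measurable (intgZ c j2)).
  - by move: Sf; apply: jacobi_aeS => x ->; rewrite mulrA.
rewrite mulrBl mul1r -EE -(IntZ (heat_drift s) j1) -(IntB j3 j2).
rewrite -(IntB (intgB j3 j2) (intgZ _ j1)).
rewrite (_ : Int mu _ = Int mu (fun x => f x * op (K (heat_curvature s)) chi x)).
  apply: le_trans (op_pairing_le e_ge1 e0 kU mf fB tchi) _.
  rewrite ler_wpM2r//; first by apply: Int_ge0.
  by rewrite ler_wpM2l// heat_curvature_mass.
apply: Int_ae.
- exact (intg_measurable (intgB (intgB j3 j2) (intgZ _ j1))).
- exact (measurable_funM mf m4).
- by move: (heat_taylor s0); apply: jacobi_aeS => x <-; ring.
Qed.

(** Divide the Taylor estimate by s, and let s tend to 0 along the given times. *)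
Lemma heat_eigen_weak f B theta : measurable_fun setT f -> (forall x, `|f x| <= B) ->
  (forall d, 0 < d -> exists2 s, 0 < s <= d &
    {ae mu, forall x, op (S s) f x = expR (- theta * s) * f x}) ->
  Int mu (fun x => f x * J chi x) + theta * Int mu (fun x => f x * J (J chi) x) = 0.
Proof.
move=> mf fB hs.
set Q := Int mu (fun x => f x * J chi x); set P := Int mu (fun x => f x * J (J chi) x).
have B0 : 0 <= B by exact: le_trans (fB 0).
pose N := Int mu (fun x => `|chi x|); have N0 : 0 <= N by exact: Int_ge0.
pose C := 2 * (theta ^+ 2 * `|P| + `|Q| + B * N).
have C0 : 0 <= C.
  apply: mulr_ge0; first exact: ler0n.
  apply: addr_ge0; last exact: mulr_ge0.
  by apply: addr_ge0 => //; apply: mulr_ge0 => //; exact: sqr_ge0.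
have th0 : 0 < `|theta| + 1 by rewrite ltr_wpDl.
have est d : 0 < d -> exists2 s, 0 < s <= d & `|Q + theta * P| <= C * s.
  move=> d0; pose d' := Num.min d (2^-1 / (`|theta| + 1)).
  have d'0 : 0 < d' by rewrite lt_min d0 divr_gt0// invr_gt0.
  have [s /andP[s0 sd] Sf] := hs d' d'0.
  exists s; first by rewrite s0 /=; apply: le_trans sd _; rewrite ge_min lexx.
  have sth : s * (`|theta| + 1) <= 2^-1.
    by rewrite -ler_pdivlMr//; apply: le_trans sd _; rewrite ge_min lexx orbT.
  have q1 : 0 <= expR s - 1 - s <= 2 * s ^+ 2.
    apply: expR_quadratic; rewrite (gtr0_norm s0).
    by apply: le_trans sth; rewrite ler_peMr ?(ltW s0)// lerDr.
  have q2 : 0 <= expR (- theta * s) - 1 - (- theta * s) <= 2 * (- theta * s) ^+ 2.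
    apply: expR_quadratic; rewrite normrM normrN (gtr0_norm s0) mulrC.
    by apply: le_trans sth; rewrite ler_wpM2l ?(ltW s0)// lerDl.
  have q3 := heat_drift_bounds s0.
  have := heat_taylor_pairing s0 mf fB Sf; rewrite -/P -/Q -/N.
  move: q1 q2 q3; set E := expR s; set F := expR (_ * s); set D := heat_drift s.
  move=> /andP[_ q1] /andP[q2 q2'] /andP[q3 q3'] q4.
  rewrite -(ler_pM2l s0) -{1}(gtr0_norm s0) -normrM.
  have -> : s * (Q + theta * P) =
      (F - 1 - (- theta * s)) * P - (D - s) * Q - ((F - 1) * P - D * Q) by ring.
  apply: le_trans (ler_normB _ _) _.
  apply: (@le_trans _ _ (2 * (- theta * s) ^+ 2 * `|P| + 2 * s ^+ 2 * `|Q|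
     + B * (2 * s ^+ 2) * N)); last first.
    by rewrite le_eqVlt; apply/orP; left; apply/eqP; rewrite /C; ring.
  apply: lerD.
    apply: le_trans (ler_normB _ _) _; apply: lerD; rewrite normrM ler_wpM2r//.
      by rewrite ger0_norm.
    by rewrite ger0_norm ?subr_ge0//; apply: le_trans _ q1; rewrite lerD2r.
  by apply: le_trans q4 _; rewrite ler_wpM2r// ler_wpM2l.
apply/eqP; rewrite -normr_le0; apply/ler_addgt0Pr => eps eps0; rewrite add0r.
have C1 : 0 < C + 1 by rewrite ltr_wpDl.
have [|s /andP[s0 sd] hC] := est (eps / (C + 1)); first by rewrite divr_gt0.
apply: le_trans hC _; apply: (@le_trans _ _ ((C + 1) * s)).
  by rewrite ler_wpM2r ?ltW// ltrDl.
by rewrite mulrC -ler_pdivlMr.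
Qed.

End TestFunction.

End Generator.

(** * From the weak equation to the differential equation *)

Lemma right_lim0_le {R : realType} (f g : R -> R) d : 0 < d ->
  (forall x, 0 < x -> x < d -> `|f x| <= g x) ->
  g x @[x --> 0^'+] --> (0 : R) -> f x @[x --> 0^'+] --> (0 : R).
Proof.
move=> d0 fg /cvgr0Pnorm_lt g0; apply/cvgr0Pnorm_lt => eps eps0.
have h1 := g0 _ eps0; near=> x.
apply: le_lt_trans (fg x _ _) _; [by near: x; exact: nbhs_right_gt|
  by near: x; exact: nbhs_right_lt|].
by apply: le_lt_trans (ler_norm _) _; near: x.
Unshelve. all: by end_near. Qed.

Lemma Int_projection d (T : measurableType d) (R : realType)
    (mu : {measure set T -> \bar R}) (u v : T -> R) :
  measurable_fun setT u -> measurable_fun setT v ->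
  intg mu (fun x => u x ^+ 2) -> intg mu (fun x => v x ^+ 2) ->
  exists c, Int mu (fun x => (v x - c * u x) * u x) = 0.
Proof.
move=> mu_ mv hu hv; have huv := intg_mul_square mv mu_ hv hu.
have E c : Int mu (fun x => (v x - c * u x) * u x) =
    Int mu (fun x => v x * u x) - c * Int mu (fun x => u x ^+ 2).
  rewrite -(IntZ c hu) -(IntB huv (intgZ c hu)).
  by congr (Int mu _); apply/funext => x; ring.
have [u0|u0] := eqVneq (Int mu (fun x => u x ^+ 2)) 0.
  exists 0; rewrite E mul0r subr0; apply/eqP; rewrite -sqrf_eq0 eq_le sqr_ge0 andbT.
  by apply: le_trans (Int_cauchy_schwarz mv mu_ hv hu) _; rewrite u0 mulr0.
by exists (Int mu (fun x => v x * u x) / Int mu (fun x => u x ^+ 2));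
  rewrite E divfK// subrr.
Qed.

Section GreenInversion.
Context {R : realType}.
Variables (alpha beta : R).
Hypotheses (hbeta : - 2^-1 <= beta) (hab : beta <= alpha)
  (halpha : - 2^-1 < alpha).
Variable phi : R[i] -> R -> R[i].
Hypothesis hphi : is_jacobi_function alpha beta phi.
Local Notation mu := (jacobi_measure alpha beta).
Local Notation A := (jacobi_weight alpha beta).
Local Notation a := (jacobi_log_weight alpha beta).
Local Notation T := (measurableTypeR R).
Local Notation e := (jexp alpha beta phi).
Local Notation rho := (jacobi_rho alpha beta).
Local Notation tame := (@tame _ T R mu e).
Local Notation J := (green_op alpha beta).
Local Notation I := (green_opT alpha beta).
Local Notation dA := (jacobi_density alpha beta).
Local Notation N g := (primitive0 (fun y => g y * dA y)).
Implicit Types (x y z u t s L c M : R) (f g k : T -> R).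

Let e_ge1 z (x : T) : 0 <= z -> 1 <= e z x. Proof. exact: jexp_ge1. Qed.
Let me z : measurable_fun setT (e z : T -> R). Proof. exact: jexp_measurable. Qed.
Let e0 (x : T) : e 0 x = 1. Proof. exact: jexp0. Qed.
Let wA : sturm_weight rho A a := jacobi_sturm_weight hbeta hab halpha.

Lemma jexp_bounded_on z X : 0 <= z -> exists K, forall x, `|x| <= X -> e z x <= K.
Proof.
move=> z0; have [X0|X0] := ltP X 0.
  by exists 0 => x hx; have := lt_le_trans X0 (le_trans (normr_ge0 x) hx); rewrite ltxx.
have ce : {within `[- X, X], continuous (e z)}.
  by apply: continuous_subspaceT; exact: real_jacobi_continuous hphi _.
have [c _ hc] := EVT_max (ge0_cp X0).2 ce.
by exists (e z c) => x hx; apply: hc; rewrite in_itv /= -ler_norml.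
Qed.

(** Dominate g by C e_1, and use I e_1 <= e_1 - 1. *)
Lemma green_opT_bound g C w : measurable_fun setT g ->
  (forall x, `|g x| <= C * e 1 x) -> `|I g w| <= C * (e 1 w - 1).
Proof.
move=> mg gC; have C0 : 0 <= C.
  have := le_trans (normr_ge0 _) (gC 0); rewrite pmulr_lge0//.
  exact: lt_le_trans ltr01 (e_ge1 _ ler01).
have [h1 h2] := greenT_jexp_le hbeta hab halpha hphi w (@ltr01 R).
have h3 := greenT_section_intg hbeta hab halpha hphi w ltr01 mg gC.
apply: (@le_trans _ _ (Int mu (fun y => C * (green alpha beta y w * e 1 y)))).
  apply: Int_norm_le => //; first exact: intgZ.
  move=> y; have G0 := @green_ge0 R alpha beta hbeta hab halpha y w.
  by rewrite normrM (ger0_norm G0) mulrCA ler_wpM2l.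
by rewrite (IntZ C h1) ler_wpM2l//; move: h2; rewrite divr1.
Qed.

Lemma bounded_jexp f B x : (forall x, `|f x| <= B) -> `|f x| <= B * e 1 x.
Proof. by move=> fB; apply: bounded_jexp_bound. Qed.

Lemma green_opT_congr f g w : measurable_fun setT f -> measurable_fun setT g ->
  {ae mu, forall x, f x = g x} -> I f w = I g w.
Proof.
move=> mf mg fg; have mG : measurable_fun setT (fun y : T => green alpha beta y w).
  apply: (@measurable2_section _ T R (fun w y => green alpha beta y w) w).
  by apply: measurable2_swap; exact: green_measurable.
apply: Int_ae; [exact: measurable_funM|exact: measurable_funM|].
by move: fg; apply: jacobi_aeS => x ->.
Qed.

(** By adjunction I g annihilates the chi that are orthogonal to 1 and to I 1;
    taking for chi a projection of I g, it is on each bounded interval a linear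
    combination c' + c I 1.  Then I (g - c) is constant there, so that g = c. *)
Lemma green_weak_const_itv g C X : measurable_fun setT g ->
  (forall x, `|g x| <= C * e 1 x) ->
  (forall chi, tame chi -> Int mu chi = 0 -> Int mu (J chi) = 0 ->
    Int mu (fun x => g x * J chi x) = 0) ->
  exists c, {ae mu, forall x, 0 < x < X -> g x = c}.
Proof.
move=> mg gC hg.
have one1 (x : T) : `|1 : R| <= 1 * e 1 x by rewrite normr1 mul1r e_ge1.
have m1 : measurable_fun setT (fun _ : T => 1 : R) by exact: measurable_cst.
pose D : set T := [set` `]0, X[].
have mD : measurable D by exact: measurable_itv.
have DX x : D x -> `|x| <= X.
  by rewrite /D /= in_itv /= => /andP[x0 xX]; rewrite gtr0_norm ?ltW.
have [K0 hK0] := jexp_bounded_on X ler01.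
pose K := Num.max 1 K0.
have K1 : 1 <= K by rewrite le_max lexx.
have hK x : D x -> e 1 x <= K by move=> /DX /hK0 h; rewrite le_max h orbT.
have C0 : 0 <= C.
  have := le_trans (normr_ge0 _) (gC 0); rewrite pmulr_lge0//.
  exact: lt_le_trans ltr01 (e_ge1 _ ler01).
pose cut (f : T -> R) : T -> R := f \_ D.
have cut0 f x : ~ D x -> cut f x = 0 by move=> Dx; rewrite /cut patchE memNset.
have cut1 f x : D x -> cut f x = f x by move=> Dx; rewrite /cut patchE mem_set.
have cutm f : measurable_fun setT f -> measurable_fun setT (cut f).
  move=> mf; apply/(measurable_restrictT _ mD).
  exact: measurable_funS mf.
have cut_tame f M : measurable_fun setT f -> 0 <= M -> (forall x, D x -> `|f x| <= M) ->
    tame (cut f).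
  move=> mf M0 fM; apply: (@compact_support_tame _ _ _ hbeta hab halpha _ hphi _ M X).
  - exact: cutm.
  - by move=> x; rewrite /cut patchE; case: ifPn => [/set_mem/fM//|_]; rewrite normr0.
  - move=> x xX; rewrite /cut patchE; case: ifPn => // /set_mem/DX.
    by rewrite ler_norml => /xX.
have mI := green_opT_measurable hbeta hab halpha mg.
have mI1 := green_opT_measurable hbeta hab halpha m1.
pose p0 := cut (fun=> 1); pose p1 := cut (I (fun=> 1)); pose q := cut (I g).
have tp0 : tame p0 by apply: (cut_tame _ 1) => // x _; rewrite normr1.
have tI f c : measurable_fun setT f -> (forall x, `|f x| <= c * e 1 x) -> 0 <= c ->
    tame (cut (I f)).
  move=> mf fc c0; apply: (cut_tame _ (c * K)).
  - exact: green_opT_measurable.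
  - by rewrite mulr_ge0// (le_trans ler01).
  - move=> x Dx; apply: le_trans (green_opT_bound x mf fc) _.
    by rewrite ler_wpM2l// (le_trans _ (hK x Dx))// gerBl.
have tp1 : tame p1 by exact: (tI _ 1).
have tq : tame q by exact: (tI _ C).
have sq f : tame f -> intg mu (fun x => f x ^+ 2) by move=> tf; exact: tame_square.
have ms f : tame f -> measurable_fun setT f by exact: tame_measurable.
have prod f f' : tame f -> tame f' -> intg mu (fun x => f x * f' x).
  by move=> tf tf'; apply: intg_mul_square; [exact: ms|exact: ms|exact: sq|exact: sq].
have [c hc] := Int_projection (ms _ tp0) (ms _ tp1) (sq _ tp0) (sq _ tp1).
pose p1' x := p1 x - c * p0 x; have tp1' : tame p1' by apply: tameB => //; exact: tameZ.
have [c' hc'] := Int_projection (ms _ tp0) (ms _ tq) (sq _ tp0) (sq _ tq).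
pose q1 x := q x - c' * p0 x; have tq1 : tame q1 by apply: tameB => //; exact: tameZ.
have [c'' hc''] := Int_projection (ms _ tp1') (ms _ tq1) (sq _ tp1') (sq _ tq1).
pose r x := q1 x - c'' * p1' x; have tr : tame r by apply: tameB => //; exact: tameZ.
have rp0 : Int mu (fun x => r x * p0 x) = 0.
  rewrite (_ : (fun x => _) = (fun x => q1 x * p0 x - c'' * (p1' x * p0 x))).
    have i1 := prod _ _ tq1 tp0; have i2 := prod _ _ tp1' tp0.
    by rewrite (IntB i1 (intgZ c'' i2)) (IntZ c'' i2) hc hc' mulr0 subrr.
  by apply/funext => x; rewrite /r; ring.
have rp1 : Int mu (fun x => r x * p1 x) = 0.
  rewrite (_ : (fun x => _) = (fun x => r x * p1' x + c * (r x * p0 x))).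
    have i1 := prod _ _ tr tp1'; have i2 := prod _ _ tr tp0.
    by rewrite (IntD i1 (intgZ c i2)) (IntZ c i2) rp0 mulr0 addr0.
  by apply/funext => x; rewrite /p1'; ring.
have rD x : ~ D x -> r x = 0.
  by move=> Dx; rewrite /r /q1 /p1' /q /p1 /p0 !cut0//; ring.
have r0 : Int mu r = 0.
  rewrite -[RHS]rp0; congr (Int mu _); apply/funext => x.
  have [Dx|Dx] := pselect (D x); first by rewrite /p0 cut1// mulr1.
  by rewrite rD// mul0r.
have rI f : Int mu (fun x => r x * cut f x) = Int mu (fun x => f x * r x).
  congr (Int mu _); apply/funext => x.
  have [Dx|Dx] := pselect (D x); first by rewrite cut1// mulrC.
  by rewrite rD// mul0r mulr0.
have sr := tame_superexp tr.
have rJ : Int mu (J r) = 0.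
  have := green_adjoint hbeta hab halpha hphi ltr01 m1 one1 sr.
  rewrite -rI -/p1 rp1 => <-.
  by congr (Int mu _); apply/funext => x; rewrite mul1r.
have rq : Int mu (fun x => r x * q x) = 0.
  rewrite /q rI -(green_adjoint hbeta hab halpha hphi ltr01 mg gC sr).
  exact: hg.
have rr : Int mu (fun x => r x ^+ 2) = 0.
  rewrite (_ : (fun x => _) = (fun x => (r x * q x - c' * (r x * p0 x))
    - c'' * (r x * p1 x - c * (r x * p0 x)))).
    have i1 := prod _ _ tr tq; have i2 := prod _ _ tr tp0; have i3 := prod _ _ tr tp1.
    have i4 := intgB i3 (intgZ c i2); have i5 := intgB i1 (intgZ c' i2).
    rewrite (IntB i5 (intgZ c'' i4)) (IntB i1 (intgZ c' i2)) (IntZ c'' i4).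
    by rewrite (IntB i3 (intgZ c i2)) !(IntZ _ i2) rp0 rp1 rq; ring.
  apply/funext => x; transitivity (r x * (q x - c' * p0 x - c'' * (p1 x - c * p0 x))).
    by rewrite expr2.
  by ring.
have r_ae := Int_square_eq0 (ms _ tr) (sq _ tr) rr.
have mg' : measurable_fun setT (fun x : T => g x - c'').
  by apply: measurable_funB => //; exact: measurable_cst.
have bg' : bounded_pos (fun x : T => g x - c'').
  move=> u; have [Ku hKu] := jexp_bounded_on u ler01.
  exists (C * Ku + `|c''|) => y /andP[y0 yu].
  apply: le_trans (ler_normB _ _) _; rewrite lerD2r; apply: le_trans (gC y) _.
  by rewrite ler_wpM2l// hKu// gtr0_norm.
exists c''.
have EI (w : T) : I (fun x => g x - c'') w = I g w - c'' * I (fun=> 1) w.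
  have h3 := greenT_section_intg hbeta hab halpha hphi w ltr01 mg gC.
  have h4 := greenT_section_intg hbeta hab halpha hphi w ltr01 m1 one1.
  rewrite /green_opT /kernel_op -(IntZ c'' h4) -(IntB h3 (intgZ c'' h4)).
  by congr (Int mu _); apply/funext => y; ring.
have key w : 0 < w < X -> I (fun x => g x - c'') w = c' - c'' * c.
  move=> /andP[w0 wX].
  pose v x := I (fun x => g x - c'') x - (c' - c'' * c).
  have cv : {for w, continuous v}.
    apply: continuousB; last exact: cvg_cst.
    exact: (green_opT_continuous hbeta hab halpha mg' bg' w0).
  apply/eqP; rewrite -subr_eq0; apply/negPn/negP => vw.
  have cN : {for w, continuous (fun x => `|v x|)} by apply: cvg_norm.
  have [|d d0 hd] := continuous_near_gt0 cN; first by rewrite normr_gt0.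
  have wd : w < Num.min X (w + d) by rewrite lt_min wX ltrDl.
  have [x /andP[wx]] := lebesgue_ae_point wd (jacobi_ae_lebesgue hbeta hab halpha r_ae).
  rewrite lt_min => /andP[xX xd] /(_ (lt_trans w0 wx)) rx.
  have : 0 < `|v x|.
    by apply: hd; rewrite ltr0_norm ?subr_lt0// opprB ltrBlDl.
  suff -> : v x = 0 by rewrite normr0 ltxx.
  have Dx : D x by rewrite /D /= in_itv /= xX (lt_trans w0 wx).
  move: rx; rewrite /v EI /r /q1 /p1' /q /p1 /p0 !cut1//.
  by move=> h; rewrite -[RHS]h; ring.
have := green_opT_const_eq0 hbeta hab halpha mg' bg' key.
by apply: jacobi_aeS => x h /h /eqP; rewrite subr_eq0 => /eqP.
Qed.

Lemma green_weak_const g C : measurable_fun setT g ->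
  (forall x, `|g x| <= C * e 1 x) ->
  (forall chi, tame chi -> Int mu chi = 0 -> Int mu (J chi) = 0 ->
    Int mu (fun x => g x * J chi x) = 0) ->
  exists c, {ae mu, forall x, g x = c}.
Proof.
move=> mg gC hg.
have /choice[c hc] : forall n : nat, exists c, {ae mu, forall x, 0 < x < n.+1%:R -> g x = c}.
  by move=> n; exact: green_weak_const_itv mg gC hg.
have cn n : c n = c 0%N.
  have h : {ae mu, forall x, 0 < x < 1 -> c n = c 0%N}.
    move: (hc 0%N); apply: (@filterS2 _ _ (ae_filter_ringOfSetsType mu)) (hc n).
    move=> x h1 h2 x01; rewrite -(h2 x01) h1//.
    by have /andP[-> x1] := x01; rewrite (lt_le_trans x1)// ler1n.
  have [x /andP[x0 x1]] := lebesgue_ae_point ltr01 (jacobi_ae_lebesgue hbeta hab halpha h).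
  by apply; rewrite ?x0 ?x1.
exists (c 0%N).
have pos := @jacobi_ae_Rpos R alpha beta.
have := ae_foralln hc.
move: pos; apply: (@filterS2 _ _ (ae_filter_ringOfSetsType mu)) => x x0 hx.
pose n := Num.bound `|x|; rewrite -(cn n); apply: hx; rewrite x0 /=.
apply: le_lt_trans (ler_norm _) _; apply: (lt_trans (archi_boundP (normr_ge0 x))).
by rewrite ltr_nat.
Qed.

(** For bounded f the function I f is continuous, and so is the representative
    F = C - theta I f = C - theta I F; then I F is twice differentiable. *)
Lemma green_eigen_regular f B C theta : measurable_fun setT f ->
  (forall x, `|f x| <= B) -> {ae mu, forall x, f x = C - theta * I f x} ->
  exists F p, [/\ measurable_fun setT F, {ae mu, forall x, f x = F x}, bounded_pos F,
    regular_solution a theta C F p & forall x, 0 < x -> {for x, continuous F}].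
Proof.
move=> mf fB fE; pose F : T -> R := fun x => C - theta * I f x.
have B0 : 0 <= B by exact: le_trans (fB 0).
have mF : measurable_fun setT F.
  apply: measurable_funB; first exact: measurable_cst.
  by apply: measurable_funM => //; exact: green_opT_measurable.
have IF w : I F w = I f w by apply: green_opT_congr => //; move: fE; apply: jacobi_aeS.
have Ib w := green_opT_bound w mf (fun x => bounded_jexp x fB).
have cF x : 0 < x -> {for x, continuous F}.
  move=> x0; apply: continuousB; first exact: cvg_cst.
  apply: continuousM; first exact: cvg_cst.
  exact: (green_opT_continuous hbeta hab halpha mf (bounded_bounded_pos fB) x0).
have bF : bounded_pos F.
  move=> u; have [Ku hKu] := jexp_bounded_on u ler01.
  exists (`|C| + `|theta| * (B * (Ku - 1))) => y /andP[y0 yu].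
  apply: le_trans (ler_normB _ _) _; rewrite lerD2l normrM ler_wpM2l//.
  apply: le_trans (Ib y) _; rewrite ler_wpM2l// lerD2r.
  by rewrite hKu// gtr0_norm.
pose p x := - theta * (N F x / A x).
exists F, p; split => //; split.
- move=> x x0; have [_ d1] := green_opT_derive hbeta hab halpha mF bF cF x0.
  have -> : F = (fun x => C - theta * I F x) by apply/funext => z; rewrite IF.
  have := is_derive_sub (is_derive_cst C x 1) (is_derive_scale theta d1).
  by rewrite sub0r -mulNr.
- move=> x x0; have [d1 _] := green_opT_derive hbeta hab halpha mF bF cF x0.
  have A0 : A x != 0 by rewrite gt_eqF// (weight_gt0 wA).
  have := is_derive_scale (- theta) (is_derive_div d1 (weight_derive wA x0) A0).
  move/is_derive_eq; apply; rewrite /p.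
  by field.
- have [_ _ l1 _] := jexp_solution hphi (@ler01 R).
  have : I f x @[x --> 0^'+] --> (0 : R).
    apply: (@right_lim0_le R _ (fun x => B * (e 1 x - 1)) 1) => //.
    rewrite -[X in _ --> X](_ : B * (1 - 1) = 0); last by rewrite subrr mulr0.
    by apply: cvgM; [exact: cvg_cst|apply: cvgB => //; exact: cvg_cst].
  move=> h; rewrite -[X in _ --> X](_ : C - theta * 0 = C); last by rewrite mulr0 subr0.
  by apply: cvgB; [exact: cvg_cst|apply: cvgM => //; exact: cvg_cst].
- have [M hM] := bF 1.
  apply: (@right_lim0_le R _ (fun x => `|theta| * M * x) 1) => //.
    move=> x x0 x1; rewrite /p normrM normrN -mulrA ler_wpM2l//.
    have A0 := weight_gt0 wA x0.
    rewrite normrM normfV (gtr0_norm A0) ler_pdivrMr//.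
    rewrite -mulrA [x * _]mulrC; apply: primitive0_density_le => // y /andP[y0 yx].
    by apply: hM; rewrite y0 (le_trans yx)// ltW.
  rewrite -[X in _ --> X](_ : `|theta| * M * 0 = 0); last by rewrite mulr0.
  apply: cvgM; first exact: cvg_cst.
  by apply: cvg_at_right_filter; exact: cvg_id.
Qed.

End GreenInversion.

(** * Square integrable eigenfunctions *)

Section SquareIntegrableSolution.
Context {R : realType}.
Variables (alpha beta : R).
Hypotheses (hbeta : - 2^-1 <= beta) (hab : beta <= alpha)
  (halpha : - 2^-1 < alpha).
Local Notation mu := (jacobi_measure alpha beta).
Local Notation A := (jacobi_weight alpha beta).
Local Notation a := (jacobi_log_weight alpha beta).
Local Notation T := (measurableTypeR R).
Local Notation rho := (jacobi_rho alpha beta).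
Local Notation dA := (jacobi_density alpha beta).
Local Notation N g := (primitive0 (fun y => g y * dA y)).
Implicit Types (x y z u t s L c M : R) (f g k : T -> R).

Let wA : sturm_weight rho A a := jacobi_sturm_weight hbeta hab halpha.

Lemma regular_solution_scale L c (y p : R -> R) d : regular_solution a L c y p ->
  regular_solution a L (d * c) (fun x => d * y x) (fun x => d * p x).
Proof.
move=> [d1 d2 l1 l2]; split.
- by move=> x x0; exact: is_derive_scale (d1 x x0).
- move=> x x0; have := is_derive_scale d (d2 x x0); move/is_derive_eq; apply; ring.
- by apply: cvgM => //; exact: cvg_cst.
- rewrite -[X in _ --> X](mulr0 d); by apply: cvgM => //; exact: cvg_cst.
Qed.

Lemma primitive0_density_le_Int g x : measurable_fun setT g ->
  (forall y, 0 <= g y) -> intg mu g -> N g x <= Int mu g.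
Proof.
move=> mg g0 hg; rewrite (@jacobi_IntE R alpha beta _ mg) /primitive0 /Rintegral.
have d0 := @jacobi_density_ge0 R alpha beta.
have h0 y : (0 <= (g y * dA y)%:E)%E by rewrite lee_fin mulr_ge0.
have md := @jacobi_density_measurable R alpha beta.
have fin : (\int[@lebesgue_measure R]_y (g y * dA y)%:E < +oo)%E.
  rewrite (_ : integral _ _ _ = (\int[mu]_y (g y)%:E)%E).
    by rewrite (IntE hg) ltry.
  rewrite (ge0_integral_density md d0 (@jacobi_measureE R alpha beta))//.
  exact/measurable_EFinP.
have le : (\int[@lebesgue_measure R]_(y in `[0%R, x]) (g y * dA y)%:E <=
    \int[@lebesgue_measure R]_y (g y * dA y)%:E)%E.
  apply: ge0_subset_integral => //.
  by apply/measurable_EFinP; apply: measurable_funM.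
apply: fine_le => //.
- rewrite ge0_fin_numE; first exact: le_lt_trans le fin.
  by apply: integral_ge0.
- by rewrite ge0_fin_numE//; apply: integral_ge0.
Qed.

(** There is no L^2 eigenfunction of the radial part: below the bottom rho^2
    of the spectrum the regular solution decays at most like e^(-rho x), and
    the weight grows like e^(2 rho x); above it the solution oscillates with
    amplitude A^(-1/2). *)
Lemma regular_solution_square_eq0 theta C (F p : R -> R) : measurable_fun setT (F : T -> R) ->
  (forall x, 0 < x -> {for x, continuous F}) -> bounded_pos F ->
  regular_solution a theta C F p -> intg mu (fun x => F x ^+ 2) ->
  forall x, 0 < x -> F x = 0.
Proof.
move=> mF cF bF sF F2.
pose g : T -> R := fun x => F x ^+ 2.
have mg : measurable_fun setT g by exact: measurable_funX.
have cg x : 0 < x -> {for x, continuous g}.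
  move=> x0; rewrite /g (_ : (fun x => _) = (fun x => F x * F x)); last first.
    by apply/funext => y; rewrite expr2.
  by apply: continuousM; exact: cF.
have bg : bounded_pos g.
  move=> u; have [M hM] := bF u; exists (M ^+ 2) => y /hM h.
  by rewrite /g normrX lerXn2r ?nnegrE//; exact: le_trans h.
have dN x : 0 < x -> is_derive x 1 (N g) (A x * F x ^+ 2).
  move=> x0; have [d1 _] := green_opT_derive hbeta hab halpha mg bg cg x0.
  by rewrite mulrC.
have Nle x : N g x <= Int mu g.
  by apply: primitive0_density_le_Int => // y; exact: sqr_ge0.
have [th|th] := leP theta (rho ^+ 2); last first.
  move=> x x0; apply: (solution_not_square_integrable wA sF th x0 (Xi := N g) (M := Int mu g)).
    by move=> y xy; apply: dN; exact: lt_le_trans xy.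
  by move=> y _; exact: Nle.
have [C0|C0] := eqVneq C 0.
  by rewrite C0 in sF; move=> x x0; exact (solution_unique0 wA sF x0).
have sF1 := regular_solution_scale C^-1 sF; rewrite mulVf// in sF1.
have low := solution_lower_bound wA sF1 th.
pose c := C ^+ 2 * (A 1 * expR (- 2 * rho)).
have A1 : 0 < A 1 by exact: weight_gt0 wA _ ltr01.
have c0 : 0 < c.
  apply: mulr_gt0; first by rewrite lt_def sqrf_eq0 C0 sqr_ge0.
  by apply: mulr_gt0 => //; exact: expR_gt0.
have grow x : 1 <= x -> c <= A x * F x ^+ 2.
  move=> x1; have x0 : 0 < x by exact: lt_le_trans x1.
  have h1 := low x x0; have h2 := weight_exp_growth wA ltr01 x1.
  have h3 : expR (- rho * x) ^+ 2 <= (C^-1 * F x) ^+ 2.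
    by rewrite lerXn2r ?nnegrE ?expR_ge0// (le_trans _ h1)// expR_ge0.
  have Ax : 0 <= A x by exact: ltW (weight_gt0 wA x0).
  have -> : A x * F x ^+ 2 = C ^+ 2 * (A x * (C^-1 * F x) ^+ 2) by field.
  rewrite /c ler_wpM2l ?sqr_ge0//.
  apply: (@le_trans _ _ (A x * expR (- rho * x) ^+ 2)); last by rewrite ler_wpM2l.
  apply: (@le_trans _ _ (A 1 * expR (2 * rho * (x - 1)) * expR (- rho * x) ^+ 2)).
    rewrite -mulrA ler_wpM2l ?(ltW A1)// -expRM_natl -expRD le_eqVlt; apply/orP; left.
    by apply/eqP; congr expR; ring.
  by rewrite ler_wpM2r// sqr_ge0.
have lin x : 1 <= x -> N g 1 - c * 1 <= N g x - c * x.
  move=> x1; apply: (@is_derive_ge0_le _ (fun x => N g x - c * x)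
    (fun x => A x * F x ^+ 2 - c * 1)) => //.
    move=> y /andP[y1 _].
    exact: (is_derive_sub (dN y (lt_le_trans ltr01 y1))
      (is_derive_scale c (is_derive_id y 1))).
  by move=> y /andP[y1 _]; rewrite subr_ge0 mulr1; exact: grow.
have N1 : 0 <= N g 1.
  rewrite /primitive0; apply: Rintegral_ge0 => y _.
  by rewrite mulr_ge0 ?sqr_ge0 ?jacobi_density_ge0.
pose x := 1 + (Int mu g + 1) / c.
have I0 : 0 <= Int mu g by apply: Int_ge0 => y; exact: sqr_ge0.
have := lin x; rewrite lerDl divr_ge0 ?(ltW c0) ?addr_ge0// => /(_ isT).
have := Nle x.
have -> : c * x = c + (Int mu g + 1) by rewrite /x; field; exact: lt0r_neq0.
move: N1 I0; set n1 := N g 1; set nx := N g x; set i := Int mu g; lra.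
Qed.

End SquareIntegrableSolution.

Section HeatEigen.
Context {R : realType}.
Variables (alpha beta : R).
Hypotheses (hbeta : - 2^-1 <= beta) (hab : beta <= alpha)
  (halpha : - 2^-1 < alpha).
Variable phi : R[i] -> R -> R[i].
Hypothesis hphi : is_jacobi_function alpha beta phi.
Variable W : R -> R -> R -> R.
Hypothesis hW : is_convolution_kernel alpha beta phi W.
Variable h : R -> R -> R.
Hypothesis hh : is_heat_kernel alpha beta phi h.
Local Notation mu := (jacobi_measure alpha beta).
Local Notation T := (measurableTypeR R).
Local Notation e := (jexp alpha beta phi).
Local Notation tame := (@tame _ T R mu e).
Local Notation op := (@kernel_op _ T R mu).
Local Notation J := (green_op alpha beta).
Local Notation I := (green_opT alpha beta).
Local Notation S t := (translation_kernel alpha beta W (heat_pos h t)).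
Implicit Types (x y z u t s L c M : R) (f g k : T -> R).

Let e_ge1 z (x : T) : 0 <= z -> 1 <= e z x. Proof. exact: jexp_ge1. Qed.

(** By adjunction, the pairing of f + theta I f with J chi is the left-hand side
    of the weak equation [heat_eigen_weak]. *)
Lemma heat_eigen_green f B theta : measurable_fun setT f -> (forall x, `|f x| <= B) ->
  (forall d, 0 < d -> exists2 s, 0 < s <= d &
    {ae mu, forall x, op (S s) f x = expR (- theta * s) * f x}) ->
  exists C, {ae mu, forall x, f x = C - theta * I f x}.
Proof.
move=> mf fB hs; pose g : T -> R := fun x => f x + theta * I f x.
have fe x := bounded_jexp hbeta hab halpha hphi x fB.
have B0 : 0 <= B by exact: le_trans (fB 0).
have mI : measurable_fun setT (I f) by exact: green_opT_measurable.
have Ie x : `|I f x| <= B * e 1 x.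
  apply: le_trans (green_opT_bound hbeta hab halpha hphi x mf fe) _.
  by rewrite ler_wpM2l// gerBl.
have mg : measurable_fun setT g by apply: measurable_funD => //; exact: measurable_funM.
have ge x : `|g x| <= (B + `|theta| * B) * e 1 x.
  rewrite mulrDl; apply: le_trans (ler_normD _ _) _; apply: lerD => //.
  by rewrite normrM -mulrA ler_wpM2l.
have [|C hC] := green_weak_const hbeta hab halpha hphi mg ge.
  move=> chi tchi chi0 chi1.
  have sc := tame_superexp tchi.
  have sJ := green_op_superexp hbeta hab halpha hphi sc.
  have i1 := green_op_intg hbeta hab halpha hphi ltr01 mf fe sc.
  have i2 := green_opT_intg hbeta hab halpha hphi ltr01 mf fe sJ.
  rewrite (_ : (fun x => _) = (fun x => f x * J chi x + theta * (I f x * J chi x))).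
    rewrite (IntD i1 (intgZ theta i2)) (IntZ theta i2).
    rewrite -(green_adjoint hbeta hab halpha hphi ltr01 mf fe sJ).
    exact: (heat_eigen_weak hbeta hab halpha hphi hW hh tchi chi0 chi1 mf fB hs).
  by apply/funext => x; rewrite /g; ring.
exists C; move: hC; apply: jacobi_aeS => x; rewrite /g => <-; ring.
Qed.

Lemma heat_eigen_eq0 f B theta : measurable_fun setT f -> (forall x, `|f x| <= B) ->
  intg mu (fun x => f x ^+ 2) ->
  (forall d, 0 < d -> exists2 s, 0 < s <= d &
    {ae mu, forall x, op (S s) f x = expR (- theta * s) * f x}) ->
  {ae mu, forall x, f x = 0}.
Proof.
move=> mf fB f2 hs; have [C hC] := heat_eigen_green mf fB hs.
have [F [p [mF fF bF sF cF]]] := green_eigen_regular hbeta hab halpha hphi mf fB hC.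
have F2 : intg mu (fun x => F x ^+ 2).
  apply: intg_ae f2; first exact: measurable_funX.
  by move: fF; apply: jacobi_aeS => x ->.
have F0 := regular_solution_square_eq0 hbeta hab halpha mF cF bF sF F2.
have : {ae mu, forall x, F x = 0} by exact: jacobi_ae_pos.
move: fF; apply: (@filterS2 _ _ (ae_filter_ringOfSetsType mu)) => x h1 h2.
by rewrite h1.
Qed.

End HeatEigen.

(** * Components of functions in L^p and a Young inequality *)

(** Extension by zero turns componentwise integrals over the half-line into
    integrals over the line of real functions. *)
Definition re_pos {R : realType} (f : R -> R[i]) : measurableTypeR R -> R :=
  (@complex.Re R \o f) \_ (@Rpos R).

Definition im_pos {R : realType} (f : R -> R[i]) : measurableTypeR R -> R :=
  (@complex.Im R \o f) \_ (@Rpos R).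

Definition norm_pos {R : realType} (f : R -> R[i]) : measurableTypeR R -> R :=
  (fun x => Normc.normc (f x)) \_ (@Rpos R).

Section LpComponents.
Context {R : realType}.
Variable mu : {measure set (measurableTypeR R) -> \bar R}.
Local Notation T := (measurableTypeR R).
Implicit Types (f : R -> R[i]) (x y r : R) (k : T -> R).

Lemma patch_pos (k : R -> R) x : 0 < x -> (k \_ (@Rpos R)) x = k x.
Proof. by move=> x0; rewrite patchE mem_set// /Rpos /= in_itv /= andbT. Qed.

Lemma patch_nonpos (k : R -> R) x : x <= 0 -> (k \_ (@Rpos R)) x = 0.
Proof.
move=> x0; rewrite patchE memNset// /Rpos /= in_itv /= andbT.
by move=> /lt_le_trans/(_ x0); rewrite ltxx.
Qed.

Lemma re_pos_measurable f : cmeasurable f -> measurable_fun setT (re_pos f).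
Proof. by move=> [m1 _]; apply/(measurable_restrictT _ (@measurable_Rpos R)). Qed.

Lemma im_pos_measurable f : cmeasurable f -> measurable_fun setT (im_pos f).
Proof. by move=> [_ m1]; apply/(measurable_restrictT _ (@measurable_Rpos R)). Qed.

Lemma norm_posE f x :
  norm_pos f x = Num.sqrt (re_pos f x ^+ 2 + im_pos f x ^+ 2).
Proof.
have [x0|x0] := leP x 0.
  by rewrite /norm_pos /re_pos /im_pos !patch_nonpos// expr0n addr0 sqrtr0.
by rewrite /norm_pos /re_pos /im_pos !patch_pos//=; case: (f x).
Qed.

Lemma norm_pos_ge0 f x : 0 <= norm_pos f x.
Proof. by rewrite norm_posE sqrtr_ge0. Qed.

Lemma re_pos_le f x : `|re_pos f x| <= norm_pos f x.
Proof. by rewrite norm_posE -sqrtr_sqr ler_wsqrtr// lerDl sqr_ge0. Qed.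

Lemma im_pos_le f x : `|im_pos f x| <= norm_pos f x.
Proof. by rewrite norm_posE -sqrtr_sqr ler_wsqrtr// lerDr sqr_ge0. Qed.

Lemma norm_pos_measurable f : cmeasurable f -> measurable_fun setT (norm_pos f).
Proof.
move=> mf; rewrite (_ : norm_pos f = (@Num.sqrt R) \o
    (fun x => re_pos f x ^+ 2 + im_pos f x ^+ 2)); last first.
  by apply/funext => x; rewrite norm_posE.
apply: measurableT_comp.
  by apply: continuous_measurable_fun; exact: sqrt_continuous.
by apply: measurable_funD; apply: measurable_funX;
  [exact: re_pos_measurable|exact: im_pos_measurable].
Qed.

Lemma Lp_norm_power f r : r != 0 ->
  (Lp_norm mu r f `^ r = \int[mu]_x (norm_pos f x `^ r)%:E)%E.
Proof.
move=> r0; rewrite /Lp_norm poweR_Lnorm//; apply: eq_integral => x _.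
rewrite (_ : patch _ _ _ x = (norm_pos f x)%:E); last first.
  by rewrite /norm_pos !patchE; case: ifP.
by rewrite /= ger0_norm ?norm_pos_ge0.
Qed.

Lemma Lp_intg f r : 0 < r -> in_Lp mu r f -> intg mu (fun x => norm_pos f x `^ r).
Proof.
move=> r0 [mf fr]; apply: intg_lty.
  by apply: measurableT_comp (measurable_powR _) _; exact: norm_pos_measurable.
rewrite (_ : integral _ _ _ = Lp_norm mu r f `^ r)%E; first exact: poweR_lty.
rewrite Lp_norm_power ?gt_eqF//; apply: eq_integral => x _.
by rewrite ger0_norm ?powR_ge0.
Qed.

Lemma intg_power_le k (n : T -> R) r : 0 <= r -> measurable_fun setT k ->
  (forall x, `|k x| <= n x) -> intg mu (fun x => n x `^ r) ->
  intg mu (fun x => `|k x| `^ r).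
Proof.
move=> r0 mk kn; apply: intg_le.
  by apply: measurableT_comp (measurable_powR _) _; exact: measurableT_comp.
move=> x; rewrite ger0_norm ?powR_ge0// ge0_ler_powR// nnegrE//.
exact: le_trans (kn x).
Qed.

Lemma Lp_intg_re f r : 0 < r -> in_Lp mu r f -> intg mu (fun x => `|re_pos f x| `^ r).
Proof.
move=> r0 hf; apply: (intg_power_le (ltW r0) _ (re_pos_le f) (Lp_intg r0 hf)).
exact: re_pos_measurable hf.1.
Qed.

Lemma Lp_intg_im f r : 0 < r -> in_Lp mu r f -> intg mu (fun x => `|im_pos f x| `^ r).
Proof.
move=> r0 hf; apply: (intg_power_le (ltW r0) _ (im_pos_le f) (Lp_intg r0 hf)).
exact: im_pos_measurable hf.1.
Qed.

End LpComponents.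

Lemma young_powR {R : realType} (p q a b : R) : 1 < p -> 1 < q ->
  p^-1 + q^-1 = 1 -> 0 <= a -> 0 <= b -> a * b <= a `^ p + b `^ q.
Proof.
move=> p1 q1 pq a0 b0.
have p0 : 0 < p by exact: lt_trans p1.
have q0 : 0 < q by exact: lt_trans q1.
apply: le_trans (conjugate_powR a0 b0 p0 q0 pq) _.
by apply: lerD; rewrite ler_piMr ?powR_ge0// invf_le1// ltW.
Qed.

Section IteratedIntegral.
Context d {T : measurableType d} {R : realType}.
Variable mu : {sigma_finite_measure set T -> \bar R}.
Implicit Types (F G : T -> T -> R).

Lemma Int2D F G : intg2 mu F -> intg2 mu G ->
  Int mu (fun x => Int mu (fun y => F x y + G x y)) =
  Int mu (fun x => Int mu (F x)) + Int mu (fun x => Int mu (G x)).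
Proof.
move=> hF hG; rewrite -(IntD (intg2_Int hF) (intg2_Int hG)); apply: Int_ae.
- exact: intg_measurable (intg2_Int (intg2D hF hG)).
- exact: intg_measurable (intgD (intg2_Int hF) (intg2_Int hG)).
- move: (intg2_section hG); apply: filterS2 (intg2_section hF) => x h1 h2.
  exact: IntD.
Qed.

Lemma intg2_norm F : intg2 mu F -> intg2 mu (fun x y => `|F x y|).
Proof.
move=> [mF hF]; split; first exact: measurable2_norm.
rewrite (_ : integral _ _ _ = (\int[mu]_x \int[mu]_y (`|F x y|)%:E)%E)//.
by apply: eq_integral => x _; apply: eq_integral => y _; rewrite normr_id.
Qed.

Lemma Int2_le F G : intg2 mu F -> intg2 mu G -> (forall x y, F x y <= G x y) ->
  Int mu (fun x => Int mu (F x)) <= Int mu (fun x => Int mu (G x)).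
Proof.
move=> hF hG FG; have [mF _] := hF; have [mG _] := hG.
have hD : intg2 mu (fun x y => G x y - F x y).
  apply: (@intg2_le _ _ _ mu _ (fun x y => `|G x y| + `|F x y|)).
  - exact: measurable_funB.
  - by move=> x y; exact: ler_normB.
  - by apply: intg2D; exact: intg2_norm.
rewrite (_ : (fun x => Int mu (G x)) = (fun x => Int mu (fun y => F x y + (G x y - F x y)))).
  by rewrite Int2D// lerDl; apply: Int_ge0 => x; apply: Int_ge0 => y; rewrite subr_ge0.
by apply/funext => x; congr (Int mu _); apply/funext => y; rewrite addrC subrK.
Qed.

End IteratedIntegral.

Section YoungBound.
Context {R : realType}.
Variables (alpha beta : R).
Hypotheses (hbeta : - 2^-1 <= beta) (hab : beta <= alpha)
  (halpha : - 2^-1 < alpha).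
Variable phi : R[i] -> R -> R[i].
Hypothesis hphi : is_jacobi_function alpha beta phi.
Variable W : R -> R -> R -> R.
Hypothesis hW : is_convolution_kernel alpha beta phi W.
Local Notation mu := (jacobi_measure alpha beta).
Local Notation T := (measurableTypeR R).
Local Notation Wp := (positive_kernel W).
Local Notation op := (@kernel_op _ T R mu).
Implicit Types (x y z u t s L c M : R) (f g k : T -> R).

Lemma Wp_intg2 f x : measurable_fun setT f -> (forall y, 0 <= f y) ->
  intg mu f -> 0 < x ->
  intg2 mu (fun y u => f y * Wp x y u) /\
  Int mu (fun y => Int mu (fun u => f y * Wp x y u)) = Int mu f.
Proof.
move=> mf f0 hf x0.
have E y : 0 < y -> Int mu (fun u => f y * Wp x y u) = f y.
  move=> y0; have [i1 E1] := Wp_mass hbeta hab halpha hphi hW x0 y0.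
  by rewrite (IntZ _ i1) E1 mulr1.
have h : intg2 mu (fun y u => f y * Wp x y u).
  apply: (intg2_bound _ hf).
    apply: measurable2_mul; first exact: measurable2_fst.
    exact: (Wp_measurable2 hW).
  move=> y; have [y0|y0] := ltP 0 y.
    have [i1 E1] := Wp_mass hbeta hab halpha hphi hW x0 y0.
    rewrite (_ : integral _ _ _ = (\int[mu]_u (f y * Wp x y u)%:E)%E).
      by rewrite (IntE (intgZ _ i1)) E.
    by apply: eq_integral => u _; rewrite ger0_norm// mulr_ge0// (Wp_ge0 hW).
  rewrite integral0_eq ?lee_fin// => u _.
  by rewrite (Wp_sym12 hW) Wp_nonpos// mulr0 normr0.
split => //; apply: Int_ae => //; first exact: intg_measurable (intg2_Int h).
exact: jacobi_ae_pos.
Qed.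

(** Young's inequality L^p * L^q into L^infty, with a crude constant: |f| k is
    at most |f|^p + k^q, and W x y has mass one in each variable. *)
Lemma translation_op_young p q k f : 1 < p -> 1 < q -> p^-1 + q^-1 = 1 ->
  measurable_fun setT k -> (forall x, 0 <= k x) -> measurable_fun setT f ->
  intg mu (fun x => `|f x| `^ p) -> intg mu (fun x => k x `^ q) ->
  forall x, intg mu (fun y => translation_kernel alpha beta W k x y * f y) /\
    `|op (translation_kernel alpha beta W k) f x| <=
    Int mu (fun x => `|f x| `^ p) + Int mu (fun x => k x `^ q).
Proof.
move=> p1 q1 pq mk k0 mf fp kq x.
have [x0|x0] := leP x 0.
  rewrite /kernel_op (_ : (fun y => _) = (fun=> 0)); last first.
    by apply/funext => y; rewrite translation_kernel_nonpos// mul0r.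
  by rewrite Int0 normr0; split; [exact: intg0|rewrite addr_ge0// Int_ge0// => y;
    exact: powR_ge0].
have mfp : measurable_fun setT (fun x => `|f x| `^ p) by exact: intg_measurable fp.
have mkq : measurable_fun setT (fun x => k x `^ q) by exact: intg_measurable kq.
have [h1 E1] := Wp_intg2 mfp (fun y => powR_ge0 _ _) fp x0.
have [h2 E2] := Wp_intg2 mkq (fun y => powR_ge0 _ _) kq x0.
have h2' := intg2_swap h2; have F2 := intg2_Fubini h2; rewrite E2 in F2.
rewrite (_ : (fun x y => _) = (fun y u => k u `^ q * Wp x y u)) in h2'; last first.
  by apply/funext => y; apply/funext => u; rewrite (Wp_sym23 hW).
have F2' : Int mu (fun y => Int mu (fun u => k u `^ q * Wp x y u)) = Int mu (fun u => k u `^ q).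
  rewrite F2; congr (Int mu _); apply/funext => y; congr (Int mu _).
  by apply/funext => u; rewrite (Wp_sym23 hW).
pose F y u := `|f y| * (k u * Wp x y u).
have mF : @measurable2 _ T R F.
  apply: measurable2_mul; first by apply: measurable2_fst; exact: measurableT_comp.
  by apply: measurable2_mul; [exact: measurable2_snd|exact: (Wp_measurable2 hW)].
have F0 y u : 0 <= F y u by rewrite mulr_ge0// mulr_ge0// (Wp_ge0 hW).
have FG y u : F y u <= `|f y| `^ p * Wp x y u + k u `^ q * Wp x y u.
  by rewrite /F mulrA -mulrDl ler_wpM2r ?(Wp_ge0 hW)// young_powR.
have hG := intg2D h1 h2'.
have hF : intg2 mu F.
  by apply: intg2_le mF _ hG => y u; rewrite ger0_norm.
have IF y : Int mu (F y) = `|f y| * translation_kernel alpha beta W k x y.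
  rewrite /F Int_scale_ge0//; first by apply: measurable_funM => //; exact: (Wp_measurable1 hW).
  by move=> u; rewrite mulr_ge0// (Wp_ge0 hW).
have IFE : (fun y => Int mu (F y)) = (fun y => `|f y| * translation_kernel alpha beta W k x y).
  exact/funext.
have iF := intg2_Int hF; rewrite IFE in iF.
have K0 y := translation_kernel_ge0 hW k0 x y.
have mK : measurable_fun setT (translation_kernel alpha beta W k x).
  exact: measurable2_section (translation_kernel_measurable hW mk k0).
have nK y : `|translation_kernel alpha beta W k x y * f y| =
    `|f y| * translation_kernel alpha beta W k x y.
  by rewrite normrM (ger0_norm (K0 y)) mulrC.
have iK : intg mu (fun y => translation_kernel alpha beta W k x y * f y).
  by apply: (intg_le _ _ iF) => [|y]; [exact: measurable_funM|rewrite nK].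
split => //; apply: (@le_trans _ _ (Int mu (fun y => Int mu (F y)))).
  by rewrite IFE; apply: Int_norm_le => // y; rewrite nK.
apply: le_trans (Int2_le hF hG FG) _.
rewrite le_eqVlt; apply/orP; left; apply/eqP.
by rewrite (Int2D h1 h2') E1 F2'.
Qed.

End YoungBound.

(** * Periodic points *)

Lemma conjugate_exponent {R : realType} (p : R) : 1 < p ->
  exists q, 1 < q /\ p^-1 + q^-1 = 1.
Proof.
move=> p1; have p0 : 0 < p by exact: lt_trans p1.
have p1' : 0 < p - 1 by rewrite subr_gt0.
exists (p / (p - 1)); split; first by rewrite ltr_pdivlMr// mul1r ltrBlDr ltrDl.
by field; rewrite !gt_eqF.
Qed.

Section ShiftedSemigroup.
Context {R : realType}.
Variables (alpha beta : R).
Hypotheses (hbeta : - 2^-1 <= beta) (hab : beta <= alpha)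
  (halpha : - 2^-1 < alpha).
Variable phi : R[i] -> R -> R[i].
Hypothesis hphi : is_jacobi_function alpha beta phi.
Variable W : R -> R -> R -> R.
Hypothesis hW : is_convolution_kernel alpha beta phi W.
Variable h : R -> R -> R.
Hypothesis hh : is_heat_kernel alpha beta phi h.
Local Notation mu := (jacobi_measure alpha beta).
Local Notation T := (measurableTypeR R).
Local Notation Wp := (positive_kernel W).
Local Notation op := (@kernel_op _ T R mu).
Local Notation S t := (translation_kernel alpha beta W (heat_pos h t)).
Implicit Types (x y z u t s L c M : R) (f g k : T -> R).

Lemma heat_pos_intg_power t q : 0 < t -> 1 < q -> intg mu (fun x => heat_pos h t x `^ q).
Proof.
move=> t0 q1; have := Lp_intg_re (lt_trans ltr01 q1) (heat_Lp hh t0 (ltW q1)).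
rewrite (_ : (fun x => _) = (fun x => heat_pos h t x `^ q))//.
apply/funext => x; rewrite (_ : re_pos _ x = heat_pos h t x)//.
by rewrite ger0_norm// (heat_pos_ge0 hh).
Qed.

Lemma translation_heat t x y : 0 < x -> 0 < y ->
  translation alpha beta W x (fun u => (h t u)%:C%C) y = (S t x y)%:C%C.
Proof.
move=> x0 y0; rewrite /translation /cintegral; congr (_ +i* _)%C.
  rewrite Rintegral_mkcond /translation_kernel /Int; congr (Rintegral _ _ _).
  apply/funext => u; have [u0|u0] := leP u 0.
    by rewrite patch_nonpos// /heat_pos patch_nonpos// mul0r.
  by rewrite patch_pos//= /heat_pos patch_pos// Wp_pos// mulr0 subr0.
rewrite -[RHS](Int0 mu) Rintegral_mkcond; congr (Rintegral _ _ _).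
apply/funext => u; have [u0|u0] := leP u 0; first by rewrite patch_nonpos.
by rewrite patch_pos//= mulr0 mul0r addr0.
Qed.

Lemma shifted_semigroup_re theta t (f : R -> R[i]) x : 0 < t ->
  re_pos (shifted_semigroup alpha beta W h theta t f) x =
  expR (theta * t) * op (S t) (re_pos f) x.
Proof.
move=> t0; rewrite /shifted_semigroup gt_eqF//.
have [x0|x0] := leP x 0.
  rewrite {1}/re_pos patch_nonpos// /kernel_op (_ : (fun y => _) = (fun=> 0)) ?Int0 ?mulr0//.
  by apply/funext => y; rewrite translation_kernel_nonpos// mul0r.
rewrite /re_pos patch_pos//= mul0r subr0; congr (_ * _).
rewrite Rintegral_mkcond /kernel_op /Int; congr (Rintegral _ _ _).
apply/funext => y; have [y0|y0] := leP y 0; first by rewrite !patch_nonpos// mulr0.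
by rewrite !patch_pos//= translation_heat//; case: (f y) => u v /=; rewrite mul0r subr0.
Qed.

Lemma shifted_semigroup_im theta t (f : R -> R[i]) x : 0 < t ->
  im_pos (shifted_semigroup alpha beta W h theta t f) x =
  expR (theta * t) * op (S t) (im_pos f) x.
Proof.
move=> t0; rewrite /shifted_semigroup gt_eqF//.
have [x0|x0] := leP x 0.
  rewrite {1}/im_pos patch_nonpos// /kernel_op (_ : (fun y => _) = (fun=> 0)) ?Int0 ?mulr0//.
  by apply/funext => y; rewrite translation_kernel_nonpos// mul0r.
rewrite /im_pos patch_pos//= mul0r addr0; congr (_ * _).
rewrite Rintegral_mkcond /kernel_op /Int; congr (Rintegral _ _ _).
apply/funext => y; have [y0|y0] := leP y 0; first by rewrite !patch_nonpos// mulr0.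
by rewrite !patch_pos//= translation_heat//; case: (f y) => u v /=; rewrite mul0r addr0.
Qed.

(** By the Young inequality a fixed point is bounded, hence square integrable
    as p <= 2; by [heat_eigen_halve] it is then an eigenfunction of S_s for the
    times s = t / 2^n, which tend to 0. *)
Lemma heat_fixed_eq0 p theta t f : 1 < p <= 2 -> 0 < t -> measurable_fun setT f ->
  intg mu (fun x => `|f x| `^ p) ->
  {ae mu, forall x, expR (theta * t) * op (S t) f x = f x} ->
  {ae mu, forall x, f x = 0}.
Proof.
move=> /andP[p1 p2] t0 mf fp ff.
have [q [q1 pq]] := conjugate_exponent p1.
have hq := heat_pos_intg_power t0 q1.
have mh := heat_pos_measurable hh t0.
have young := translation_op_young hbeta hab halpha hphi hW p1 q1 pq mh
  (fun x => heat_pos_ge0 hh x t0) mf fp hq.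
pose B := expR (theta * t) * (Int mu (fun x => `|f x| `^ p) +
  Int mu (fun x => heat_pos h t x `^ q)).
(* a bounded representative of f *)
pose g : T -> R := fun x => expR (theta * t) * op (S t) f x.
have kS s : 0 < s -> transform_kernel mu _ _ _ :=
  heat_transform_kernel hbeta hab halpha hphi hW hh (t := s).
have mS := op_measurable (kS t t0) mf.
have mg : measurable_fun setT g by apply: measurable_funM => //; exact: measurable_cst.
have gB x : `|g x| <= B.
  rewrite /g normrM ger0_norm ?expR_ge0// ler_wpM2l ?expR_ge0//.
  exact: (young x).2.
have B0 : 0 <= B by exact: le_trans (gB 0).
have gp : intg mu (fun x => `|g x| `^ p).
  apply: intg_ae fp; first by apply: measurableT_comp (measurable_powR _) _;
    exact: measurableT_comp.
  by move: ff; apply: jacobi_aeS => x fx; rewrite /g fx.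
have g2 : intg mu (fun x => g x ^+ 2).
  apply: (intg_le _ _ (intgZ (B `^ (2 - p)) gp)); first exact: measurable_funX.
  move=> x; rewrite normrX -powR_mulrn//.
  have -> : `|g x| `^ 2 = `|g x| `^ (2 - p) * `|g x| `^ p.
    rewrite -powRD ?subrK//; apply/implyP => /eqP h2.
    by exfalso; move: h2; apply/eqP; rewrite pnatr_eq0.
  by rewrite ler_wpM2r ?powR_ge0// ge0_ler_powR// ?nnegrE ?subr_ge0.
have Sg : {ae mu, forall x, op (S t) g x = expR (- theta * t) * g x}.
  apply: jacobi_ae_pos => x x0; rewrite /g mulrA -expRD mulNr addNr expR0 mul1r.
  have mSx : measurable_fun setT (S t x) by exact: kernel_section (kS t t0) x.
  apply: Int_ae; [exact: measurable_funM|exact: measurable_funM|].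
  by move: ff; apply: jacobi_aeS => y fy; rewrite /g fy.
have dyadic (n : nat) :
    {ae mu, forall x, op (S (t / 2 ^+ n)) g x = expR (- theta * (t / 2 ^+ n)) * g x}.
  elim: n => [|n IH]; first by rewrite expr0 divr1.
  have tn : 0 < t / 2 ^+ n.+1 by rewrite divr_gt0// exprn_gt0.
  have tnE : t / 2 ^+ n = t / 2 ^+ n.+1 + t / 2 ^+ n.+1.
    by rewrite exprS; field; rewrite expf_neq0.
  apply: (heat_eigen_halve hbeta hab halpha hphi hW hh tn (expR_gt0 _) mg gB g2).
  rewrite -tnE; move: IH; apply: jacobi_aeS => x ->.
  by rewrite expr2 -expRD -mulrDr -tnE.
have g0 : {ae mu, forall x, g x = 0}.
  apply: (heat_eigen_eq0 hbeta hab halpha hphi hW hh mg gB g2 (theta := theta)) => d d0.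
  pose n := Num.bound (t / d).
  exists (t / 2 ^+ n) => //; rewrite divr_gt0 ?exprn_gt0//=.
  rewrite ler_pdivrMr ?exprn_gt0// mulrC -ler_pdivrMr//.
  apply: le_trans (ltW (archi_boundP _)) _; first by rewrite divr_ge0// ltW.
  by rewrite -natrX ler_nat ltnW// ltn_expl.
by move: ff; apply: (@filterS2 _ _ (ae_filter_ringOfSetsType mu)) g0 => x h1 h2; rewrite -h2.
Qed.

Lemma shifted_semigroup_no_periodic p theta (f : R -> R[i]) t : 1 < p <= 2 ->
  in_Lp mu p f -> 0 < t ->
  Lp_eq mu (shifted_semigroup alpha beta W h theta t f) f -> Lp_eq mu f (fun=> 0).
Proof.
move=> hp hf t0 ff; have [p1 _] := andP hp; have p0 := lt_trans ltr01 p1.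
have r0 : {ae mu, forall x, re_pos f x = 0}.
  apply: (heat_fixed_eq0 hp t0 (re_pos_measurable hf.1) (Lp_intg_re p0 hf) (theta := theta)).
  move: ff; apply: jacobi_aeS => x fx; rewrite -shifted_semigroup_re//.
  rewrite /re_pos !patchE; case: ifP => // /set_mem x0.
  by rewrite /= fx.
have i0 : {ae mu, forall x, im_pos f x = 0}.
  apply: (heat_fixed_eq0 hp t0 (im_pos_measurable hf.1) (Lp_intg_im p0 hf) (theta := theta)).
  move: ff; apply: jacobi_aeS => x fx; rewrite -shifted_semigroup_im//.
  rewrite /im_pos !patchE; case: ifP => // /set_mem x0.
  by rewrite /= fx.
move: i0; apply: (@filterS2 _ _ (ae_filter_ringOfSetsType mu)) r0 => x h1 h2 x0.
have x0' : 0 < x by move: x0; rewrite /Rpos /= in_itv /= andbT.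
move: h1 h2; rewrite /re_pos /im_pos !patch_pos//=.
by case: (f x) => u v /= -> ->.
Qed.

End ShiftedSemigroup.

(** * The ground state *)

Lemma cmeasurableP {R : realType} (f : R -> R[i]) :
  measurable_fun setT (re_pos f) -> measurable_fun setT (im_pos f) -> cmeasurable f.
Proof.
by move=> m1 m2; split; apply/(measurable_restrictT _ (@measurable_Rpos R)).
Qed.

Section GroundState.
Context {R : realType}.
Variables (alpha beta : R).
Hypotheses (hbeta : - 2^-1 <= beta) (hab : beta <= alpha)
  (halpha : - 2^-1 < alpha).
Variable phi : R[i] -> R -> R[i].
Hypothesis hphi : is_jacobi_function alpha beta phi.
Local Notation mu := (jacobi_measure alpha beta).
Local Notation A := (jacobi_weight alpha beta).
Local Notation T := (measurableTypeR R).
Local Notation rho := (jacobi_rho alpha beta).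
Local Notation E := (real_jacobi alpha beta phi).
Implicit Types (x y z u t s L c M : R) (f g k : T -> R).

Let wA := jacobi_sturm_weight hbeta hab halpha.

Definition ground_state : T -> R := E (rho ^+ 2).
Local Notation phi0 := ground_state.

Lemma ground_state_solution :
  regular_solution (jacobi_log_weight alpha beta) (rho ^+ 2) 1 phi0 phi0^`()%classic.
Proof. exact: (real_jacobi_solution hphi (lexx _)). Qed.

Lemma ground_state_ge0 x : 0 <= phi0 x.
Proof.
have pos y : 0 < y -> 0 <= phi0 y.
  move=> y0; apply: le_trans (solution_lower_bound wA ground_state_solution (lexx _) y0).
  exact: expR_ge0.
have [x0|x0|->] := ltgtP x 0; last by rewrite /phi0 (real_jacobi0 hphi).
  by rewrite /phi0 -(real_jacobi_even hphi) pos// oppr_gt0.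
exact: pos.
Qed.

Lemma ground_state_measurable : measurable_fun setT phi0.
Proof. exact: real_jacobi_measurable hphi _. Qed.

Lemma jacobi_weight_le_exp x : 0 < x -> A x <= 2 `^ (2 * beta + 1) * expR (2 * rho * x).
Proof.
move=> x0; rewrite /jacobi_weight.
have s0 : 0 < sinh x by exact: sinh_gt0.
have hs : 2 * sinh x <= expR x.
  by rewrite /sinh mulrC divfK// gerBl expR_ge0.
have hc : 2 * cosh x <= 2 * expR x.
  rewrite /cosh mulrC divfK// mulr_natl mulr2n lerD2l ler_expR.
  by move: x0; lra.
have c0 : 0 < cosh x by exact: cosh_gt0.
have e1 : 0 <= 2 * alpha + 1 by move: halpha; lra.
have e2 : 0 <= 2 * beta + 1 by move: hbeta; lra.
apply: (@le_trans _ _ (expR x `^ (2 * alpha + 1) * (2 * expR x) `^ (2 * beta + 1))).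
  have s0' : 0 <= 2 * sinh x by rewrite mulr_ge0// ltW.
  have c0' : 0 <= 2 * cosh x by rewrite mulr_ge0// ltW.
  apply: ler_pM; [exact: powR_ge0|exact: powR_ge0| |].
    by apply: ge0_ler_powR => //; rewrite nnegrE ?expR_ge0.
  by apply: ge0_ler_powR => //; rewrite nnegrE// (le_trans c0').
rewrite powRM ?expR_ge0// -!expRM mulrCA -expRD.
rewrite le_eqVlt; apply/orP; left; apply/eqP; congr (_ * expR _).
by rewrite /jacobi_rho; ring.
Qed.

(** The ground state decays like e^(-kappa x) for every kappa < rho, while the
    weight grows like e^(2 rho x): it belongs to L^q(mu) for all q > 2. *)
Lemma ground_state_power_intg q : 2 < q -> intg mu (fun x => phi0 x `^ q).
Proof.
move=> q2; have q0 : 0 < q by exact: lt_trans q2.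
have r0 : 0 < rho by exact: jacobi_rho_gt0.
have qi : q^-1 < 2^-1 by rewrite ltf_pV2// posrE.
have qi0 : 0 < q^-1 by rewrite invr_gt0.
pose kappa := rho * (2^-1 + q^-1).
have k0 : 0 < kappa < rho.
  have h1 : 2^-1 + q^-1 < 1 by move: qi; lra.
  rewrite /kappa; apply/andP; split; first by rewrite mulr_gt0// addr_gt0.
  by rewrite -subr_gt0 -[X in X - _]mulr1 -mulrBr mulr_gt0// subr_gt0.
pose eta := q * kappa - 2 * rho.
have eta0 : 0 < eta.
  rewrite (_ : eta = rho * (q / 2 - 1)).
    by rewrite mulr_gt0// subr_gt0 ltr_pdivlMr// mul1r.
  by rewrite /eta /kappa; field; rewrite gt_eqF.
have [x1 [C [x11 hC]]] := solution_upper_bound wA ground_state_solution k0.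
have x10 : 0 < x1 by exact: lt_le_trans x11.
have ce : {within `[0, x1], continuous phi0}.
  by apply: continuous_subspaceT; exact: real_jacobi_continuous hphi _.
have [c _ hc] := EVT_max (ltW x10) ce.
have pc : 0 <= phi0 c by exact: ground_state_ge0.
have C0 : 0 <= C.
  have := le_trans (ground_state_ge0 x1) (hC x1 (lexx _)).
  by rewrite pmulr_lge0// expR_gt0.
pose D1 := phi0 c `^ q * A x1 * expR (eta * x1).
pose D2 := C `^ q * 2 `^ (2 * beta + 1).
have D10 : 0 <= D1 by rewrite !mulr_ge0 ?powR_ge0 ?expR_ge0 ?jacobi_weight_ge0.
have D20 : 0 <= D2 by rewrite !mulr_ge0 ?powR_ge0.
have bound x : 0 < x -> phi0 x `^ q * A x <= (D1 + D2) * expR (- eta * x).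
  move=> x0; have [xx1|xx1] := leP x x1.
    apply: (@le_trans _ _ (D1 * expR (- eta * x))); last first.
      by rewrite ler_wpM2r ?expR_ge0// lerDl.
    rewrite /D1 -mulrA -expRD -[leLHS]mulr1.
    have h1 : phi0 x `^ q <= phi0 c `^ q.
      apply: ge0_ler_powR; rewrite ?nnegrE ?ground_state_ge0 ?(ltW q0)//.
      by apply: hc; rewrite in_itv /= (ltW x0).
    have h2 : A x <= A x1 by exact: (weight_nondecreasing wA).
    have h3 : 1 <= expR (eta * x1 + - eta * x).
      rewrite -[leLHS]expR0 ler_expR mulNr -mulrBr.
      by apply: mulr_ge0; [exact: ltW|rewrite subr_ge0].
    have h4 := jacobi_weight_ge0 alpha beta x.
    exact (ler_pM (mulr_ge0 (powR_ge0 _ _) h4) ler01 (ler_pM (powR_ge0 _ _) h4 h1 h2) h3).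
  apply: (@le_trans _ _ (D2 * expR (- eta * x))); last first.
    by rewrite ler_wpM2r ?expR_ge0// lerDr.
  have h1 : phi0 x `^ q <= (C * expR (- kappa * x)) `^ q.
    apply: ge0_ler_powR; rewrite ?nnegrE ?ground_state_ge0 ?(ltW q0) ?mulr_ge0 ?expR_ge0//.
    exact/hC/ltW.
  have h2 := jacobi_weight_le_exp x0.
  apply: le_trans (ler_pM (powR_ge0 _ _) (jacobi_weight_ge0 alpha beta x) h1 h2) _.
  rewrite powRM ?expR_ge0// -expRM mulrACA -expRD.
  rewrite le_eqVlt; apply/orP; left; apply/eqP; congr (_ * expR _).
  by rewrite /eta; ring.
have mp : measurable_fun setT (fun x : T => phi0 x `^ q).
  apply: measurableT_comp (measurable_powR _) _; exact: ground_state_measurable.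
apply: intg_lty => //.
rewrite (_ : integral _ _ _ = (\int[mu]_x (phi0 x `^ q)%:E)%E); last first.
  by apply: eq_integral => x _; rewrite ger0_norm ?powR_ge0.
rewrite (@jacobi_integralE R alpha beta); [|exact/measurable_EFinP|by move=> x; rewrite lee_fin powR_ge0].
apply: (@le_lt_trans _ _ (\int[@lebesgue_measure R]_(x in `]0%R, +oo[)
   ((D1 + D2) * expR (- eta * x))%:E)%E).
  apply: ge0_le_integral.
  - exact: measurable_itv.
  - by move=> x _; rewrite -EFinM lee_fin mulr_ge0 ?powR_ge0 ?jacobi_weight_ge0.
  - apply/measurable_EFinP; apply: measurable_funTS; apply: measurable_funM => //.
    exact: measurable_jacobi_weight.
  - apply/measurable_EFinP; apply: measurable_funTS; apply: measurable_funM => //.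
    by apply: measurableT_comp; [exact: measurable_expR|exact: measurable_funM].
  - by move=> x; rewrite /= in_itv /= andbT => x0; rewrite -EFinM lee_fin bound.
have ie := integrable_exp_decay 0 eta0.
have mI : measurable ([set` `[0%R, +oo[] : set T) by exact: measurable_itv.
have := integrableZl mI (D1 + D2) ie.
move=> /integrableP[_]; apply: le_lt_trans.
apply: (@le_trans _ _ (\int[@lebesgue_measure R]_(x in `[0%R, +oo[)
   ((D1 + D2) * expR (- eta * x))%:E)%E).
  apply: ge0_subset_integral => //; try exact: measurable_itv.
  - apply/measurable_EFinP; apply: measurable_funTS; apply: measurable_funM => //.
    by apply: measurableT_comp; [exact: measurable_expR|exact: measurable_funM].
  - by move=> x _; rewrite lee_fin mulr_ge0 ?expR_ge0 ?addr_ge0.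
  - by move=> x /=; rewrite !in_itv /= !andbT; exact: ltW.
rewrite le_eqVlt; apply/orP; left; apply/eqP; apply: eq_integral => x _.
by rewrite /= ger0_norm// mulr_ge0 ?expR_ge0 ?addr_ge0.
Qed.

Section Pairing.
Variables (p q : R).
Hypotheses (p1 : 1 < p) (p2 : p < 2) (pq : p^-1 + q^-1 = 1) (q1 : 1 < q).

Let q2 : 2 < q.
Proof.
have [h1 h2] := conj p1 p2; have p0 : 0 < p by exact: lt_trans p1.
have : 2^-1 < p^-1 by rewrite ltf_pV2// posrE.
have q0 : 0 < q by exact: lt_trans q1.
move=> h3; rewrite -ltf_pV2 ?posrE//; have := pq; lra.
Qed.

Let P := Int mu (fun x => phi0 x `^ q).

Lemma ground_state_pairing f : measurable_fun setT f ->
  intg mu (fun x => `|f x| `^ p) ->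
  intg mu (fun x => f x * phi0 x) /\
  `|Int mu (fun x => f x * phi0 x)| <= Int mu (fun x => `|f x| `^ p) + P.
Proof.
move=> mf fp; have h0 := ground_state_power_intg q2.
have le x : `|f x * phi0 x| <= `|f x| `^ p + phi0 x `^ q.
  by rewrite normrM (ger0_norm (ground_state_ge0 x)) young_powR ?ground_state_ge0.
have i1 : intg mu (fun x => f x * phi0 x).
  apply: (intg_le _ _ (intgD fp h0)); last exact: le.
  by apply: measurable_funM => //; exact: ground_state_measurable.
by split => //; rewrite /P -(IntD fp h0); apply: Int_norm_le => //; exact: intgD.
Qed.

(** Apply the previous bound to f / d. *)
Lemma ground_state_pairing_small f d : 0 < d -> measurable_fun setT f ->
  intg mu (fun x => `|f x| `^ p) -> Int mu (fun x => `|f x| `^ p) <= d `^ p ->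
  `|Int mu (fun x => f x * phi0 x)| <= d * (1 + P).
Proof.
move=> d0 mf fp fd; have [i1 _] := ground_state_pairing mf fp.
have E x : `|d^-1 * f x| `^ p = d `^ (- p) * `|f x| `^ p.
  rewrite normrM powRM// ger0_norm ?invr_ge0 ?ltW//.
  by rewrite -powR_inv1 ?ltW// -powRrM mulN1r.
have mg : measurable_fun setT (fun x => d^-1 * f x) by exact: measurable_funM.
have gp : intg mu (fun x => `|d^-1 * f x| `^ p).
  by rewrite (_ : (fun x => _) = (fun x => d `^ (- p) * `|f x| `^ p));
    [exact: intgZ|exact/funext].
have [_] := ground_state_pairing mg gp.
rewrite (_ : (fun x => `|d^-1 * f x| `^ p) = (fun x => d `^ (- p) * `|f x| `^ p));
  last exact/funext.
rewrite (_ : (fun x => d^-1 * f x * phi0 x) = (fun x => d^-1 * (f x * phi0 x))); last first.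
  by apply/funext => x; rewrite mulrA.
rewrite (IntZ _ i1) (IntZ _ fp) normrM gtr0_norm ?invr_gt0// mulrC ler_pdivrMr//.
move=> h; apply: le_trans h _; rewrite mulrC ler_wpM2l ?(ltW d0)// lerD2r.
rewrite powRN mulrC ler_pdivrMr ?powR_gt0// mul1r//.
Qed.

End Pairing.

End GroundState.

(** * Orbits are not dense *)

Section NotHypercyclic.
Context {R : realType}.
Variables (alpha beta : R).
Hypotheses (hbeta : - 2^-1 <= beta) (hab : beta <= alpha)
  (halpha : - 2^-1 < alpha).
Variable phi : R[i] -> R -> R[i].
Hypothesis hphi : is_jacobi_function alpha beta phi.
Variable W : R -> R -> R -> R.
Hypothesis hW : is_convolution_kernel alpha beta phi W.
Variable h : R -> R -> R.
Hypothesis hh : is_heat_kernel alpha beta phi h.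
Local Notation mu := (jacobi_measure alpha beta).
Local Notation T := (measurableTypeR R).
Local Notation op := (@kernel_op _ T R mu).
Local Notation rho := (jacobi_rho alpha beta).
Local Notation phi0 := (ground_state alpha beta phi).
Local Notation S t := (translation_kernel alpha beta W (heat_pos h t)).
Local Notation shift theta := (shifted_semigroup alpha beta W h theta).
Variables (p : R).
Hypotheses (p1 : 1 < p) (p2 : p < 2).
Implicit Types (x y z u t s L c M : R) (f g k : T -> R).

Let phi0_ge0 (x : T) : 0 <= phi0 x. Proof. exact: ground_state_ge0. Qed.

(** Fubini, the symmetry of S_t, and S_t phi_0 = e^(-rho^2 t) phi_0. *)
Lemma ground_state_heat t f : 0 < t -> measurable_fun setT f ->
  intg mu (fun x => `|f x| `^ p) ->
  intg mu (fun x => op (S t) f x * phi0 x) /\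
  Int mu (fun x => op (S t) f x * phi0 x) =
    expR (- t * rho ^+ 2) * Int mu (fun x => f x * phi0 x).
Proof.
move=> t0 mf fp; have [q [q1 pq]] := conjugate_exponent p1.
have [i1 _] := ground_state_pairing hbeta hab halpha hphi p1 p2 pq q1 mf fp.
have [h1 E1] := heat_pos_transform hbeta hab halpha hphi hh t0 (lexx (rho ^+ 2)).
have mh := heat_pos_measurable hh t0.
have h0 x : 0 <= heat_pos h t x := heat_pos_ge0 hh x t0.
have S0 x y : 0 <= S t x y := translation_kernel_ge0 hW h0 x y.
have mS : @measurable2 _ T R (S t).
  exact (translation_kernel_measurable hW mh h0).
have m0 : measurable_fun setT phi0 by exact: (ground_state_measurable hphi).
have Ssym x y : S t x y = S t y x := translation_kernel_sym hW _ x y.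
have young := translation_op_young hbeta hab halpha hphi hW p1 q1 pq mh h0 mf fp
  (heat_pos_intg_power hh t0 q1).
have eig y : 0 < y -> intg mu (fun x => S t y x * phi0 x) /\
    Int mu (fun x => S t y x * phi0 x) = expR (- t * rho ^+ 2) * phi0 y.
  move=> y0; have := translation_kernel_eigen hbeta hab halpha hphi hW mh h0
    (lexx (rho ^+ 2)) phi0_ge0 h1 y0.
  by rewrite E1.
have neg x y : y <= 0 -> S t x y = 0.
  by move=> y0; rewrite Ssym translation_kernel_nonpos.
pose F x y := phi0 x * (S t x y * f y).
have mF : @measurable2 _ T R F.
  apply: measurable2_mul; first exact: measurable2_fst.
  by apply: measurable2_mul => //; exact: measurable2_snd.
have Fy y : 0 < y -> Int mu (fun x => F x y) = expR (- t * rho ^+ 2) * (f y * phi0 y).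
  move=> y0; have [i2 E2] := eig y y0.
  rewrite (_ : (fun x => _) = (fun x => f y * (S t y x * phi0 x))).
    by rewrite (IntZ _ i2) E2 mulrCA.
  by apply/funext => x; rewrite /F Ssym; ring.
have hF : intg2 mu F.
  apply: (@intg2_swap _ T R mu (fun y x => F x y)).
  apply: (@intg2_bound _ T R mu _ (fun y => expR (- t * rho ^+ 2) * `|f y * phi0 y|)).
  - exact: measurable2_swap.
  - exact/intgZ/intg_norm.
  - move=> y; have [y0|y0] := ltP 0 y; last first.
      rewrite integral0_eq ?lee_fin ?mulr_ge0 ?expR_ge0//.
      by move=> x _; rewrite /F neg// mul0r mulr0 normr0.
    have [i2 E2] := eig y y0.
    rewrite (_ : integral _ _ _ = (\int[mu]_x (`|f y| * (S t y x * phi0 x))%:E)%E).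
      rewrite (IntE (intgZ _ i2)) (IntZ _ i2) E2 lee_fin normrM (ger0_norm (phi0_ge0 y)).
      by rewrite mulrCA.
    apply: eq_integral => x _; congr EFin; rewrite /F Ssym !normrM.
    by rewrite (ger0_norm (phi0_ge0 x)) (ger0_norm (S0 y x)); ring.
have Fx x : Int mu (F x) = op (S t) f x * phi0 x.
  by rewrite /F (IntZ _ (young x).1) mulrC.
have iF := intg2_Int hF; have := intg2_Fubini hF.
rewrite (_ : (fun x => Int mu (F x)) = (fun x => op (S t) f x * phi0 x)) in iF *;
  last exact/funext.
move=> E2; split => //; rewrite E2 -(IntZ _ i1); apply: Int_ae.
- exact: intg_measurable (intg2_Int (intg2_swap hF)).
- by apply: measurable_funM => //; exact: measurable_funM.
- exact: jacobi_ae_pos.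
Qed.

Lemma shifted_semigroup_ground_state theta t (f : R -> R[i]) : 0 <= t ->
  in_Lp mu p f ->
  intg mu (fun x => re_pos (shift theta t f) x * phi0 x) /\
  Int mu (fun x => re_pos (shift theta t f) x * phi0 x) =
    expR ((theta - rho ^+ 2) * t) * Int mu (fun x => re_pos f x * phi0 x).
Proof.
move=> t0 hf; have mf := re_pos_measurable hf.1.
have fp := Lp_intg_re (lt_trans ltr01 p1) hf.
have [q [q1 pq]] := conjugate_exponent p1.
have [i1 _] := ground_state_pairing hbeta hab halpha hphi p1 p2 pq q1 mf fp.
move: t0; rewrite le_eqVlt => /predU1P[<-|t0].
  by rewrite /shifted_semigroup eqxx mulr0 expR0 mul1r.
have [i2 E2] := ground_state_heat t0 mf fp.
rewrite (_ : (fun x => _) = (fun x => expR (theta * t) * (op (S t) (re_pos f) x * phi0 x))).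
  split; first exact: intgZ.
  by rewrite (IntZ _ i2) E2 mulrA -expRD; congr (expR _ * _); ring.
by apply/funext => x; rewrite shifted_semigroup_re// mulrA.
Qed.

Lemma shifted_semigroup_measurable theta t (f : R -> R[i]) : 0 <= t ->
  in_Lp mu p f -> cmeasurable (shift theta t f).
Proof.
move=> t0 hf; have [mr mi] := (re_pos_measurable hf.1, im_pos_measurable hf.1).
move: t0; rewrite le_eqVlt => /predU1P[<-|t0].
  by rewrite /shifted_semigroup eqxx; exact: hf.1.
have kS := heat_transform_kernel hbeta hab halpha hphi hW hh t0.
apply: cmeasurableP.
  rewrite (_ : re_pos _ = fun x => expR (theta * t) * op (S t) (re_pos f) x); last first.
    by apply/funext => x; rewrite shifted_semigroup_re.
  apply: measurable_funM; first exact: measurable_cst.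
  exact (op_measurable kS mr).
rewrite (_ : im_pos _ = fun x => expR (theta * t) * op (S t) (im_pos f) x); last first.
  by apply/funext => x; rewrite shifted_semigroup_im.
apply: measurable_funM; first exact: measurable_cst.
exact (op_measurable kS mi).
Qed.

Lemma re_pos_sub (f g : R -> R[i]) x : re_pos (fun y => f y - g y) x = re_pos f x - re_pos g x.
Proof.
have [x0|x0] := leP x 0; first by rewrite /re_pos !patch_nonpos// subr0.
by rewrite /re_pos !patch_pos//=; case: (f x) => a1 b1; case: (g x).
Qed.

Lemma im_pos_sub (f g : R -> R[i]) x : im_pos (fun y => f y - g y) x = im_pos f x - im_pos g x.
Proof.
have [x0|x0] := leP x 0; first by rewrite /im_pos !patch_nonpos// subr0.
by rewrite /im_pos !patch_pos//=; case: (f x) => a1 b1; case: (g x).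
Qed.

Lemma Lp_norm_re_lt (u : R -> R[i]) d : 0 < d -> cmeasurable u ->
  (Lp_norm mu p u < d%:E)%E ->
  intg mu (fun x => `|re_pos u x| `^ p) /\ Int mu (fun x => `|re_pos u x| `^ p) <= d `^ p.
Proof.
move=> d0 mu_ ud; have p0 : 0 < p by exact: lt_trans p1.
have mp (k : T -> R) : measurable_fun [set: T] k ->
    measurable_fun [set: T] (fun x : T => k x `^ p).
  by move=> mk; exact: (measurableT_comp (measurable_powR p) mk).
apply: intg_ge0P.
- by apply: mp; apply: measurableT_comp => //; exact: re_pos_measurable.
- by move=> x; exact: powR_ge0.
- apply: (@le_trans _ _ (\int[mu]_x (norm_pos u x `^ p)%:E)%E).
    apply: ge0_le_integral => //.
    + apply/measurable_EFinP; apply: mp; apply: measurableT_comp => //.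
      exact: re_pos_measurable.
    + apply/measurable_EFinP; apply: mp; exact: norm_pos_measurable.
    + move=> x _; rewrite lee_fin ge0_ler_powR ?nnegrE ?(ltW p0)//.
        exact: norm_pos_ge0.
      exact: re_pos_le.
  rewrite -(Lp_norm_power mu u (lt0r_neq0 p0)).
  have : (0 <= Lp_norm mu p u)%E by exact: Lnorm_ge0.
  move: ud; case: (Lp_norm mu p u) => [r| |]//; rewrite lte_fin lee_fin => rd r0.
  by rewrite poweR_EFin lee_fin ge0_ler_powR ?nnegrE ?(ltW p0) ?(ltW d0) ?(ltW rd).
Qed.

Lemma in_Lp_scale c (f : R -> R[i]) : in_Lp mu p f -> in_Lp mu p (fun x => c%:C%C * f x).
Proof.
move=> hf; have p0 : 0 < p by exact: lt_trans p1.
have E x : re_pos (fun x => c%:C%C * f x) x = c * re_pos f x.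
  have [x0|x0] := leP x 0; first by rewrite /re_pos !patch_nonpos// mulr0.
  by rewrite /re_pos !patch_pos//=; case: (f x) => a1 b1 /=; rewrite mul0r subr0.
have E' x : im_pos (fun x => c%:C%C * f x) x = c * im_pos f x.
  have [x0|x0] := leP x 0; first by rewrite /im_pos !patch_nonpos// mulr0.
  by rewrite /im_pos !patch_pos//=; case: (f x) => a1 b1 /=; rewrite mul0r addr0.
have mf := re_pos_measurable hf.1; have mf' := im_pos_measurable hf.1.
split.
  apply: cmeasurableP.
    by rewrite (_ : re_pos _ = fun x => c * re_pos f x); [exact: measurable_funM|exact/funext].
  by rewrite (_ : im_pos _ = fun x => c * im_pos f x); [exact: measurable_funM|exact/funext].
apply: (@lty_poweRy _ _ p); first exact: lt0r_neq0.
rewrite Lp_norm_power ?lt0r_neq0//.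
rewrite (_ : integral _ _ _ = (\int[mu]_x (`|c| `^ p * norm_pos f x `^ p)%:E)%E).
  by rewrite (IntE (intgZ _ (Lp_intg p0 hf))) ltry.
apply: eq_integral => x _; congr EFin; rewrite -powRM ?norm_pos_ge0//; congr (_ `^ _).
by rewrite !norm_posE E E' !exprMn -mulrDr sqrtrM ?sqr_ge0// sqrtr_sqr.
Qed.

(** Along an orbit, the pairing with the ground state is an exponential: its
    modulus is monotone, so that its values are not dense. *)
Lemma shifted_semigroup_not_hypercyclic theta : ~ Lp_hypercyclic mu p (shift theta).
Proof.
move=> [f [hf dense]]; have [q [q1 pq]] := conjugate_exponent p1.
pose P := Int mu (fun x => phi0 x `^ q).
have P0 : 0 <= P by apply: Int_ge0 => x; exact: powR_ge0.
pose l := Int mu (fun x => re_pos f x * phi0 x).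
have t1 : 0 < (1 : R) by exact: ltr01.
have hh1 := heat_Lp hh t1 (ltW p1).
have [ih Eh] := heat_pos_transform hbeta hab halpha hphi hh t1 (lexx (rho ^+ 2)).
have near c eps : 0 < eps -> exists2 t, 0 <= t &
    `|expR ((theta - rho ^+ 2) * t) * l - c| <= eps.
  move=> eps0; pose c' := c / expR (- 1 * rho ^+ 2).
  pose g x := c'%:C%C * (h 1 x)%:C%C.
  have hg : in_Lp mu p g by exact: in_Lp_scale.
  have d0 : 0 < eps / (1 + P) by rewrite divr_gt0// ltr_pwDl.
  have [t [t0 ht]] := dense g hg _ d0.
  exists t => //; have [i1 E1] := shifted_semigroup_ground_state theta t0 hf.
  pose u x := shift theta t f x - g x.
  have mT := shifted_semigroup_measurable theta t0 hf.
  have mu_ : cmeasurable u.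
    apply: cmeasurableP.
      rewrite (_ : re_pos u = fun x => re_pos (shift theta t f) x - re_pos g x).
        by apply: measurable_funB; [exact: re_pos_measurable mT|exact: re_pos_measurable hg.1].
      by apply/funext => x; exact: re_pos_sub.
    rewrite (_ : im_pos u = fun x => im_pos (shift theta t f) x - im_pos g x).
      by apply: measurable_funB; [exact: im_pos_measurable mT|exact: im_pos_measurable hg.1].
    by apply/funext => x; exact: im_pos_sub.
  have [iu lu] := Lp_norm_re_lt d0 mu_ ht.
  have := ground_state_pairing_small hbeta hab halpha hphi p1 p2 pq q1 d0
    (re_pos_measurable mu_) iu lu.
  rewrite -/P divfK; last by rewrite gt_eqF// ltr_pwDl.
  rewrite (_ : (fun x => _) = (fun x => re_pos (shift theta t f) x * phi0 x -
     c' * (heat_pos h 1 x * phi0 x))); last first.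
    apply/funext => x; rewrite re_pos_sub mulrBl mulrA; congr (_ - _ * _).
    have [x0|x0] := leP x 0.
      by rewrite /re_pos /heat_pos !patch_nonpos// mulr0.
    by rewrite /re_pos /heat_pos !patch_pos//= mulr0 subr0.
  by rewrite (IntB i1 (intgZ c' ih)) (IntZ c' ih) Eh E1 -/l /c' divfK// gt_eqF// expR_gt0.
pose kap := theta - rho ^+ 2.
have [[l0 k0]|small] : (l != 0 /\ 0 < kap) \/
    (forall t, 0 <= t -> `|expR (kap * t) * l| <= `|l|).
  have [->|l0] := eqVneq l 0; first by right => t _; rewrite mulr0.
  have [k0|k0] := leP kap 0; last by left.
  right => t t0; rewrite normrM ler_piMl// ger0_norm ?expR_ge0//.
  by rewrite -[leRHS]expR0 ler_expR mulr_le0_ge0.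
  (* growing modulus: the orbit stays away from 0 *)
- have l0' : 0 < `|l| by rewrite normr_gt0.
  have [|t t0] := near 0 (`|l| / 2); first by rewrite divr_gt0.
  rewrite subr0 -/kap normrM (ger0_norm (expR_ge0 _)) => hl.
  have : 1 <= expR (kap * t) by rewrite -[leLHS]expR0 ler_expR mulr_ge0// ltW.
  move: hl l0'; set E := expR _; set n := `|l| => *; nra.
  (* modulus bounded by its initial value *)
- have [|t t0] := near (`|l| + 1) (2^-1); first by rewrite invr_gt0.
  rewrite -/kap => hl; have := small t t0; move: hl.
  rewrite distrC => hl hs; have := lerB_dist (`|l| + 1) (expR (kap * t) * l).
  rewrite [X in X - _]ger0_norm ?addr_ge0// => h1.
  move: hl hs h1; set a := `|_ - _|; set b := `|expR _ * _|; set n := `|l|; lra.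
Qed.

End NotHypercyclic.

Theorem theorem4p2 (R : realType) (alpha beta : R)
  (hbeta : - 2^-1 <= beta) (hab : beta <= alpha) (halpha : - 2^-1 < alpha)
  (phi : R[i] -> R -> R[i]) (hphi : is_jacobi_function alpha beta phi)
  (W : R -> R -> R -> R) (hW : is_convolution_kernel alpha beta phi W)
  (h : R -> R -> R) (hh : is_heat_kernel alpha beta phi h)
  (p theta : R) (hp : 1 < p <= 2) :
  (forall (f : R -> R[i]) (t : R),
     in_Lp (jacobi_measure alpha beta) p f -> 0 < t ->
     Lp_eq (jacobi_measure alpha beta)
       (shifted_semigroup alpha beta W h theta t f) f ->
     Lp_eq (jacobi_measure alpha beta) f (fun=> 0)) /\
  (p < 2 ->
     ~ Lp_hypercyclic (jacobi_measure alpha beta) p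
         (shifted_semigroup alpha beta W h theta)).
Proof.
split=> [f t hf t0|p2].
  exact: (shifted_semigroup_no_periodic hbeta hab halpha hphi hW hh hp hf t0).
have [p1 _] := andP hp.
exact: (shifted_semigroup_not_hypercyclic hbeta hab halpha hphi hW hh p1 p2).
Qed.
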